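(* Let $\zeta\in\mathbb C\setminus\mathbb Q$. The following Verma modules in the principal block $\mathcal B_0$ of category $\mathcal O$ for $D(2|1;\zeta)$ have the following composition factors: \begin{align*} M_{000}&=L_{000}+L_1^{-++}+L_1^{-+-}+L_1^{--+}+2L_1^{---},\\ M_1^{+--}&=L_1^{+--}+L_{000}+L_1^{---}+L_2^{---},\\ M_1^{+-+}&=L_1^{+-+}+L_1^{+--}+L_{000}+L_1^{-++}+L_1^{--+}+L_1^{---}+L_2^{--+}+L_2^{---},\\ M_1^{++-}&=L_1^{++-}+L_1^{+--}+L_{000}+L_1^{-++}+L_1^{-+-}+L_1^{---}+L_2^{-+-}+L_2^{---},\\ M_1^{+++}&=L_1^{+++}+L_1^{++-}+L_1^{+-+}+L_1^{+--}+L_{000}+2L_1^{-++}+L_1^{-+-}+L_1^{--+}+L_1^{---}\\ &\quad+L_2^{-++}+L_2^{-+-}+L_2^{--+}+L_2^{---}. \end{align*}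
   Context: $\mathfrak g=D(2|1;\zeta)$ is the $17$-dimensional simple Lie superalgebra of basic type with Cartan matrix $\begin{pmatrix}0&1&\zeta\\-1&2&0\\-1&0&2\end{pmatrix}$, whose first simple root is odd and whose other two simple roots are even. Its Cartan subalgebra $\mathfrak h$ has basis $h_{2\delta},h_{2\epsilon_1},h_{2\epsilon_2}$ with dual basis $\delta,\epsilon_1,\epsilon_2$ of $\mathfrak h^*$. The simple roots are $\delta-\epsilon_1-\epsilon_2$ (odd), $2\epsilon_1$, $2\epsilon_2$; positive even roots $2\delta,2\epsilon_1,2\epsilon_2$; positive odd roots $\delta\pm\epsilon_1\pm\epsilon_2$. $\mathfrak n_+$ is the sum of positive root spaces and $\rho=-\delta+\epsilon_1+\epsilon_2$. The weight lattice is $X=\mathbb Z\delta+\mathbb Z\epsilon_1+\mathbb Z\epsilon_2$, and $(x,y,z)$ stands for $x\delta+y\epsilon_1+z\epsilon_2$. $\mathcal O$ is the category of finitely generated $\mathfrak h$-semisimple $\mathfrak g$-modules with weights in $X$ that are locally finite over $\mathfrak n_+$. For $\lambda\in X$, $M_\lambda$ is the Verma module of highest weight $\lambda-\rho$ (note the $\rho$-shift) and $L_\lambda$ its unique irreducible quotient. For $\zeta\notin\mathbb Q$, $\mathcal B_0$ is the block containing the trivial module; its simple objects are the $L_\lambda$ with $\lambda\in\{(\pm n,\pm n,\pm n)\mid n\ge1\}\cup\{(0,0,0)\}$. Notation: for $n\ge1$ and signs $a,b,c\in\{+,-\}$, $M_n^{abc}=M_{an,bn,cn}$ and $L_n^{abc}=L_{an,bn,cn}$;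 $M_{000}=M_{(0,0,0)}$ and $L_{000}=L_{(0,0,0)}$. Writing $M_\mu=\sum_\lambda p_{\lambda\mu}L_\lambda$ means that the composition multiplicity $[M_\mu:L_\lambda]$ equals $p_{\lambda\mu}$ for every $\lambda$ (zero if $L_\lambda$ does not appear). *)

(* Defs.v *)
From HB Require Import structures.
From mathcomp Require Import all_boot all_order all_algebra.
From mathcomp.multinomials Require Import monalg.
From mathcomp Require Import boolp reals.
From mathcomp.real_closed Require Import complex.
From mathcomp Require Import ring.

Set Implicit Arguments.
Unset Strict Implicit.
Unset Printing Implicit Defensive.

Import GRing.Theory.
Local Open Scope ring_scope.
Local Open Scope quotient_scope.

(* [lie_part false] and [lie_part true] are the even and the odd part. *)
Record lieSuperalgebra (K : fieldType) := LieSuperalgebra {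
  lie_sort :> vectType K;
  lie_part : bool -> {vspace lie_sort};
  lie_br : lie_sort -> lie_sort -> lie_sort;
  lie_part_sum : (lie_part false + lie_part true = fullv)%VS;
  lie_part_cap : (lie_part false :&: lie_part true = 0)%VS;
  lie_br_linearl : forall y, linear (lie_br^~ y);
  lie_br_linearr : forall x, linear (lie_br x);
  lie_br_part : forall a b x y, x \in lie_part a -> y \in lie_part b ->
    lie_br x y \in lie_part (a (+) b);
  lie_br_anti : forall a b x y, x \in lie_part a -> y \in lie_part b ->
    lie_br x y = - ((-1) ^+ (a && b) *: lie_br y x);
  lie_jacobi : forall a b x y z, x \in lie_part a -> y \in lie_part b ->
    lie_br x (lie_br y z) =
      lie_br (lie_br x y) z + (-1) ^+ (a && b) *: lie_br y (lie_br x z)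
}.

(* Modules carry no Z/2-grading.  For the algebra D21 below and weights in X
   the parity of a weight vector can be read off the first coordinate of its
   weight modulo 2, so that submodules and homomorphisms of weight modules are
   automatically compatible with the gradings (up to a parity shift). *)
Record lieModule (K : fieldType) (L : lieSuperalgebra K) := LieModule {
  mod_sort :> lmodType K;
  act : L -> mod_sort -> mod_sort;
  act_linearl : forall v, linear (act^~ v);
  act_linearr : forall x, linear (act x);
  act_br : forall a b x y v, x \in lie_part L a -> y \in lie_part L b ->
    act (lie_br x y) v =
      act x (act y v) - (-1) ^+ (a && b) *: act y (act x v)
}.

Arguments act {K L l} x v : rename.

Record subspace (K : fieldType) (V : lmodType K) := Subspace {
  subspace_pred :> {pred V};
  subspace_closed : submod_closed subspace_pred
}.

HB.instance Definition _ (K : fieldType) (V : lmodType K) (S : subspace V) :=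
  GRing.isSubmodClosed.Build K V (subspace_pred S)
    (GRing.submod_closed_semi (subspace_closed S)).

Section QuotientLmodule.
Variables (K : fieldType) (V : lmodType K) (S : subspace V).

Definition quot :=
  Quotient.quot (GRing.ZmodClosed.clone V (subspace_pred S) _).
HB.instance Definition _ := GRing.Zmodule.on quot.
HB.instance Definition _ := Quotient.on quot.
Local Notation Q := quot.

Definition quot_scale (a : K) := lift_op1 Q ( *:%R a).

Lemma pi_scale a :
  {morph \pi_Q : x / a *: x >-> quot_scale a x}.
Proof.
move=> x; unlock quot_scale; apply/eqP; rewrite piE Quotient.equivE.
by rewrite -scalerBr rpredZ // Quotient.idealrBE reprK.
Qed.

Canonical pi_scale_morph a := PiMorph1 (pi_scale a).

Lemma quot_scalerA a b x :
  quot_scale a (quot_scale b x) = quot_scale (a * b) x.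
Proof. by rewrite -[x]reprK !piE scalerA. Qed.

Lemma quot_scale1r : left_id 1 quot_scale.
Proof. by move=> x; rewrite -[x]reprK !piE scale1r. Qed.

Lemma quot_scalerDr : right_distributive quot_scale +%R.
Proof. by move=> a x y; rewrite -[x]reprK -[y]reprK !piE scalerDr. Qed.

Lemma quot_scalerDl x : {morph quot_scale^~ x : a b / a + b}.
Proof. by move=> a b; rewrite -[x]reprK !piE scalerDl. Qed.

HB.instance Definition _ := GRing.Zmodule_isLmodule.Build K quot
  quot_scalerA quot_scale1r quot_scalerDr quot_scalerDl.

Lemma quot_piD (x y : V) :
  \pi_Q (x + y) = \pi_Q x + \pi_Q y.
Proof. by rewrite piE. Qed.

Lemma quot_piZ a (x : V) :
  \pi_Q (a *: x) = a *: \pi_Q x.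
Proof. exact: pi_scale. Qed.

Lemma quot_piP (x y : V) :
  reflect (\pi_Q x = \pi_Q y) (x - y \in S).
Proof. by rewrite Quotient.idealrBE; apply: eqP. Qed.

End QuotientLmodule.

Section QuotientModule.
Variables (K : fieldType) (L : lieSuperalgebra K) (V : lmodType K).
Variables (op : L -> V -> V) (S : subspace V).
Local Notation Q := (quot S).
Hypothesis op_linearl : forall v, linear (op^~ v).
Hypothesis op_linearr : forall x, linear (op x).
Hypothesis op_stable : forall x v, v \in S -> op x v \in S.
Hypothesis op_br : forall a b x y v, x \in lie_part L a -> y \in lie_part L b ->
  op (lie_br x y) v - (op x (op y v) - (-1) ^+ (a && b) *: op y (op x v)) \in S.

Definition quot_op (x : L) (u : Q) : Q :=
  \pi_Q (op x (repr u)).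

Lemma quot_opE x v : quot_op x (\pi_Q v) = \pi_Q (op x v).
Proof.
apply/quot_piP; have opB u w : op x u - op x w = op x (u - w).
  by rewrite -scaleN1r addrC -op_linearr scaleN1r addrC.
by rewrite opB op_stable //; apply/quot_piP; rewrite reprK.
Qed.

Lemma quot_op_linearl u : linear (quot_op^~ u).
Proof. by move=> a x y; rewrite /quot_op op_linearl quot_piD quot_piZ. Qed.

Lemma quot_op_linearr x : linear (quot_op x).
Proof.
move=> a u w; rewrite -[u]reprK -[w]reprK -quot_piZ -quot_piD !quot_opE.
by rewrite op_linearr quot_piD quot_piZ.
Qed.

Lemma quot_op_br a b x y u : x \in lie_part L a -> y \in lie_part L b ->
  quot_op (lie_br x y) u =
    quot_op x (quot_op y u) - (-1) ^+ (a && b) *: quot_op y (quot_op x u).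
Proof.
move=> xa yb; have [v ->] : exists v, u = \pi_Q v.
  by exists (repr u); rewrite reprK.
rewrite !(quot_opE _ v) quot_opE (quot_opE y) -scaleNr -quot_piZ -quot_piD.
by apply/quot_piP; rewrite scaleNr; apply: op_br.
Qed.

Definition quotient_module : lieModule L :=
  LieModule quot_op_linearl quot_op_linearr quot_op_br.

End QuotientModule.

Section Submodules.
Variables (K : fieldType) (L : lieSuperalgebra K) (M : lieModule L).
Implicit Types N A B : {pred M}.

Definition is_submodule N :=
  submod_closed N /\ forall x v, v \in N -> act x v \in N.

Definition simple_quotient A B :=
  [/\ {subset B <= A}, ~ {subset A <= B} &
      forall N, is_submodule N -> {subset B <= N} -> {subset N <= A} ->
        N =i B \/ N =i A].

(* An isomorphism of A / B with S, given by a homomorphism from A onto S with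
   kernel B; the values of f outside A are irrelevant. *)
Definition subquotient_iso A B (S : lieModule L) :=
  exists f : M -> S,
  [/\ {in A &, forall u v a, f (a *: u + v) = a *: f u + f v},
      {in A, forall v x, f (act x v) = act x (f v)},
      forall w, exists2 v, v \in A & f v = w &
      {in A, forall v, f v = 0 <-> v \in B}].

Definition in_maximal_sum : {pred M} := fun v =>
  `[< exists2 s : seq M, v = \sum_(w <- s) w &
      {in s, forall w, exists N,
         [/\ is_submodule N, exists u, u \notin N & w \in N]} >].

Lemma in_maximal_sum_submodule : is_submodule in_maximal_sum.
Proof.
have stab (f : M -> M) v : (forall u w, f (u + w) = f u + f w) -> f 0 = 0 ->
    (forall N w, is_submodule N -> w \in N -> f w \in N) ->
    v \in in_maximal_sum -> f v \in in_maximal_sum.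
  move=> fD f0 fN /asboolP[s -> sN]; apply/asboolP.
  exists (map f s); first by rewrite big_map (big_morph f fD f0).
  move=> _ /mapP[w ws ->]; have [N [NN Nu wN]] := sN w ws.
  by exists N; split=> //; apply: fN.
split; last first.
  move=> x v; apply: stab => [u w||N w NN]; last exact: NN.2.
    by rewrite -[u]scale1r act_linearr !scale1r.
  by have := act_linearr (l := M) x (-1) 0 0; rewrite scaler0 addr0 scaleN1r addNr.
split; first by apply/asboolP; exists [::]; rewrite ?big_nil.
move=> a u v Ju Jv.
have : a *: u \in in_maximal_sum.
  apply: stab Ju => [||N w [[N0 Nl] _] Nw]; first exact: scalerDr.
    exact: scaler0.
  by rewrite -[a *: w]addr0 Nl.
case/asboolP: Jv => s' -> s'N /asboolP[s -> sN]; apply/asboolP.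
exists (s ++ s'); first by rewrite big_cat.
by move=> w; rewrite mem_cat => /orP[/sN|/s'N].
Qed.

Definition maximal_sum : subspace M := Subspace in_maximal_sum_submodule.1.

Lemma maximal_sum_stable x v : v \in maximal_sum -> act x v \in maximal_sum.
Proof. exact: in_maximal_sum_submodule.2. Qed.

Lemma maximal_sum_br a b x y v : x \in lie_part L a -> y \in lie_part L b ->
  act (lie_br x y) v - (act x (act y v) - (-1) ^+ (a && b) *: act y (act x v))
    \in maximal_sum.
Proof.
by move=> xa yb; rewrite (act_br _ xa yb) subrr; apply: (subspace_closed _).1.
Qed.

End Submodules.

Definition sgn (b : bool) : int := if b then 1 else -1.

(* Sign triples index the basis v_s1 (x) v_s2 (x) v_s3 of the odd part. *)
Definition signs := (bool * bool * bool)%type.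

Definition sg (s : signs) (i : 'I_3) : bool :=
  nth false [:: s.1.1; s.1.2; s.2] i.

Definition set_sg (s : signs) (i : 'I_3) (b : bool) : signs :=
  (if i == 0 then b else s.1.1, if i == 1 then b else s.1.2,
   if i == 2 then b else s.2).

(* Root basis of the 17-dimensional space sl_2^3 + C^2 (x) C^2 (x) C^2; index
   i = 0, 1, 2 corresponds to delta, epsilon_1, epsilon_2.  [bE i true] and
   [bE i false] are the raising and the lowering operator of the i-th sl_2. *)
Definition gbasis := ('I_3 + 'I_3 * bool + signs)%type.
Definition bH (i : 'I_3) : gbasis := inl (inl i).
Definition bE (i : 'I_3) (b : bool) : gbasis := inl (inr (i, b)).
Definition bO (s : signs) : gbasis := inr s.

Definition bparity (b : gbasis) : bool := if b is inr _ then true else false.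

(* The invariant symplectic form psi on C^2, and the term
   c * p(v_b, v_c) of the i-th sl_2 where p(x, y) z = psi(y, z) x + psi(x, z) y
   for z in C^2. *)
Definition psi (b c : bool) : int := if b == c then 0 else sgn b.

Definition pterm (c : int * int) (r : int) (i : 'I_3) (b b' : bool) :=
  let k := r * (if b == b' then 2 * sgn b else -1) in
  ((c.1 * k, c.2 * k), if b == b' then bE i b else bH i).

(* The bracket of two basis vectors as a list of terms ((m, n), e) standing for
   (m + n zeta) e.  On two odd vectors it is
     [x1 x2 x3, y1 y2 y3] = s1 psi(x2, y2) psi(x3, y3) p(x1, y1) + ...
   with (s1, s2, s3) = (-(1 + zeta), 1, zeta). *)
Definition bracket_table (a b : gbasis) : seq (int * int * gbasis) :=
  match a, b with
  | inl (inl i), inl (inl j) => [::]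
  | inl (inl i), inl (inr (j, e)) =>
      if i == j then [:: ((2 * sgn e, 0), bE j e)] else [::]
  | inl (inr (j, e)), inl (inl i) =>
      if i == j then [:: ((- (2 * sgn e), 0), bE j e)] else [::]
  | inl (inr (i, e)), inl (inr (j, f)) =>
      if (i == j) && (e != f) then [:: ((sgn e, 0), bH i)] else [::]
  | inl (inl i), inr s => [:: ((sgn (sg s i), 0), bO s)]
  | inr s, inl (inl i) => [:: ((- sgn (sg s i), 0), bO s)]
  | inl (inr (i, e)), inr s =>
      if sg s i == e then [::] else [:: ((1, 0), bO (set_sg s i e))]
  | inr s, inl (inr (i, e)) =>
      if sg s i == e then [::] else [:: ((-1, 0), bO (set_sg s i e))]
  | inr (x1, x2, x3), inr (y1, y2, y3) =>
      [:: pterm (-1, -1) (psi x2 y2 * psi x3 y3) 0 x1 y1;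
          pterm (1, 0) (psi x1 y1 * psi x3 y3) 1 x2 y2;
          pterm (0, 1) (psi x1 y1 * psi x2 y2) 2 x3 y3]
  end.

Lemma malg_scaleAr (K : fieldType) (I : monomType) c (s t : {malg K[I]}) :
  s * (c *: t) = c *: (s * t).
Proof.
apply/malgP => k; rewrite mcoeffZ.
rewrite (mcoeffMlw _ (finmap.fsubset_refl (msupp s)) (msuppZ_le c t)).
rewrite mcoeffMl mulr_sumr; apply: eq_bigr => k1 _.
rewrite mulr_sumr; apply: eq_bigr => k2 _.
by rewrite mcoeffZ mulrCA mulrnAr.
Qed.

Lemma supercommutator_scaleN1 (K : fieldType) (T : lalgType K) (e : K) (x y z t : T) :
  -1 *: (1 * (x * y - e *: (y * x) - z) * t) + 0 =
    z * t - (x * (y * t) - e *: (y * (x * t))).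
Proof. by rewrite addr0 scaleN1r mul1r !mulrBl -scalerAl -!mulrA opprB. Qed.

Section Construction.
Variables (K : fieldType) (zeta : K).

Definition D21_space := {ffun gbasis -> K^o}.

Definition gvec (b : gbasis) : D21_space := [ffun c => (b == c)%:R].

Definition coef (c : int * int) : K := c.1%:~R + c.2%:~R * zeta.

Definition D21_br (x y : D21_space) : D21_space :=
  \sum_a \sum_b (x a * y b) *:
    \sum_(t <- bracket_table a b) coef t.1 *: gvec t.2.

Definition D21_part (p : bool) : {vspace D21_space} :=
  <<[seq gvec b | b in [pred c | bparity c == p]]>>%VS.

(* Formal computations with coefficients m + n zeta + k zeta ^ 2. *)

Definition cmul (c d : int * int) : int * int * int :=
  (c.1 * d.1, c.1 * d.2 + c.2 * d.1, c.2 * d.2).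
Definition clift (c : int * int) : int * int * int := (c, 0).
Definition copp (c : int * int * int) : int * int * int :=
  (- c.1.1, - c.1.2, - c.2).
Definition cadd (c d : int * int * int) : int * int * int :=
  (c.1.1 + d.1.1, c.1.2 + d.1.2, c.2 + d.2).
Definition coef2 (c : int * int * int) : K :=
  c.1.1%:~R + c.1.2%:~R * zeta + c.2%:~R * zeta ^+ 2.

Definition terms := seq (int * int * int * gbasis).
Definition tval (l : terms) : D21_space := \sum_(t <- l) coef2 t.1 *: gvec t.2.
Definition tscale (e : bool) (l : terms) : terms :=
  if e then [seq (copp t.1, t.2) | t <- l] else l.
Fixpoint tcoef (l : terms) (b : gbasis) : int * int * int :=
  if l is t :: l' then
    if t.2 == b then cadd t.1 (tcoef l' b) else tcoef l' b
  else (0, 0, 0).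
Definition tab1 (a b : gbasis) : terms :=
  [seq (clift t.1, t.2) | t <- bracket_table a b].
Definition tabr (a b c : gbasis) : terms :=
  [seq (cmul t.1 u.1, u.2) | t <- bracket_table b c, u <- bracket_table a t.2].
Definition tabl (a b c : gbasis) : terms :=
  [seq (cmul t.1 u.1, u.2) | t <- bracket_table a b, u <- bracket_table t.2 c].

Definition all_ord3 : seq 'I_3 :=
  [:: @Ordinal 3 0 isT; @Ordinal 3 1 isT; @Ordinal 3 2 isT].
Definition all_gbasis : seq gbasis :=
  [seq bH i | i <- all_ord3] ++
  [seq bE i b | i <- all_ord3, b <- [:: true; false]] ++
  [seq bO (b, c, d) | b <- [:: true; false], '(c, d) <-
      [:: (true, true); (true, false); (false, true); (false, false)]].

Lemma mem_all_gbasis b : b \in all_gbasis.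
Proof.
by case: b => [[[[|[|[|]]]]|[[[|[|[|]]]] ? []]]|[[[] []] []]].
Qed.

Lemma coef2_add c d : coef2 (cadd c d) = coef2 c + coef2 d.
Proof. by rewrite /coef2 /= !intrD; ring. Qed.

Lemma coef2_opp c : coef2 (copp c) = - coef2 c.
Proof. by rewrite /coef2 /= !intrN; ring. Qed.

Lemma coef2_mul c d : coef2 (cmul c d) = coef c * coef d.
Proof. by rewrite /coef2 /coef /= !(intrD, intrM); ring. Qed.

Lemma coef2_lift c : coef2 (clift c) = coef c.
Proof. by rewrite /coef2 /coef mul0r addr0. Qed.

Lemma tvalE l b : tval l b = coef2 (tcoef l b).
Proof.
rewrite /tval; elim: l => [|t l IH].
  by rewrite big_nil ffunE /coef2 /= !mul0r !addr0.
rewrite big_cons !ffunE /= {}IH; case: eqP => _; last by rewrite scaler0 add0r.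
by rewrite coef2_add -[_ *: _]/(_ * _) mulr1.
Qed.

Lemma tval_cat l l' : tval (l ++ l') = tval l + tval l'.
Proof. exact: big_cat. Qed.

Lemma tval_scale (e : bool) l : tval (tscale e l) = (-1) ^+ e *: tval l.
Proof.
case: e; last by rewrite scale1r.
rewrite /tval /= big_map scaleN1r -sumrN; apply: eq_bigr => t _.
by rewrite coef2_opp scaleNr.
Qed.

Definition teq (l l' : terms) : bool :=
  all (fun b => tcoef l b == tcoef l' b) all_gbasis.

Lemma tvalP l l' : teq l l' -> tval l = tval l'.
Proof.
move=> /allP ll'; apply/ffunP => b; rewrite !tvalE.
by rewrite (eqP (ll' b (mem_all_gbasis b))).
Qed.

Lemma gvec_sum (x : D21_space) : x = \sum_a x a *: gvec a.
Proof.
apply/ffunP => b; rewrite sum_ffunE (bigD1 b) //= big1 => [|a /negbTE ab].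
  by rewrite !ffunE eqxx addr0 -[RHS]/(_ * _) mulr1.
by rewrite !ffunE ab scaler0.
Qed.

Lemma D21_br_linearl y : linear (D21_br^~ y).
Proof.
move=> c x x'; rewrite /D21_br scaler_sumr -big_split; apply: eq_bigr => a _ /=.
rewrite scaler_sumr -big_split; apply: eq_bigr => b _ /=.
by rewrite !ffunE scalerA -scalerDl mulrDl mulrA.
Qed.

Lemma D21_br_linearr x : linear (D21_br x).
Proof.
move=> c y y'; rewrite /D21_br scaler_sumr -big_split; apply: eq_bigr => a _ /=.
rewrite scaler_sumr -big_split; apply: eq_bigr => b _ /=.
by rewrite !ffunE scalerA -scalerDl mulrDr mulrCA.
Qed.

HB.instance Definition _ x :=
  GRing.isLinear.Build K D21_space D21_space *:%R (D21_br x)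
    (D21_br_linearr x).

Lemma D21_br_suml I (r : seq I) (P : pred I) (F : I -> K) G y :
  D21_br (\sum_(i <- r | P i) F i *: G i) y =
    \sum_(i <- r | P i) F i *: D21_br (G i) y.
Proof.
pose f := GRing.isLinear.Build K D21_space D21_space *:%R (D21_br^~ y)
    (D21_br_linearl y).
pose g : {linear D21_space -> D21_space} := HB.pack (D21_br^~ y) f.
rewrite -[LHS]/(g _) linear_sum; apply: eq_bigr => i _.
exact: linearZ.
Qed.

Lemma D21_br_sumr I (r : seq I) (P : pred I) (F : I -> K) G x :
  D21_br x (\sum_(i <- r | P i) F i *: G i) =
    \sum_(i <- r | P i) F i *: D21_br x (G i).
Proof. by rewrite linear_sum; apply: eq_bigr => i _; rewrite linearZ. Qed.

Lemma D21_br_gvec a b :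
  D21_br (gvec a) (gvec b) = \sum_(t <- bracket_table a b) coef t.1 *: gvec t.2.
Proof.
rewrite /D21_br (bigD1 a) //= [X in _ + X]big1 ?addr0 => [|c /negbTE ca].
  rewrite (bigD1 b) //= [X in _ + X]big1 ?addr0 => [|c /negbTE cb].
    by rewrite !ffunE !eqxx mulr1 scale1r.
  by rewrite !ffunE [b == c]eq_sym cb mulr0 scale0r.
by rewrite big1 // => d _; rewrite !ffunE eq_sym ca mul0r scale0r.
Qed.

Lemma tab1E a b : D21_br (gvec a) (gvec b) = tval (tab1 a b).
Proof.
rewrite D21_br_gvec /tval big_map; apply: eq_bigr => t _.
by rewrite coef2_lift.
Qed.

Lemma tabrE a b c :
  D21_br (gvec a) (D21_br (gvec b) (gvec c)) = tval (tabr a b c).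
Proof.
rewrite (D21_br_gvec b) D21_br_sumr /tval big_allpairs_dep; apply: eq_bigr => t _.
rewrite D21_br_gvec scaler_sumr; apply: eq_bigr => u _.
by rewrite coef2_mul scalerA.
Qed.

Lemma tablE a b c :
  D21_br (D21_br (gvec a) (gvec b)) (gvec c) = tval (tabl a b c).
Proof.
rewrite (D21_br_gvec a) D21_br_suml /tval big_allpairs_dep; apply: eq_bigr => t _.
rewrite D21_br_gvec scaler_sumr; apply: eq_bigr => u _.
by rewrite coef2_mul scalerA.
Qed.

Lemma all2_gbasis (P : gbasis -> gbasis -> bool) :
  all (fun a => all (P a) all_gbasis) all_gbasis -> forall a b, P a b.
Proof.
by move=> /allP h a b; have /allP := h a (mem_all_gbasis a); apply; apply: mem_all_gbasis.
Qed.

Lemma gvec_anti a b : D21_br (gvec a) (gvec b) =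
  - ((-1) ^+ (bparity a && bparity b) *: D21_br (gvec b) (gvec a)).
Proof.
rewrite !tab1E -tval_scale -scaleN1r -[-1]expr1 -(tval_scale true).
apply: tvalP; move: a b; apply: all2_gbasis; vm_compute; reflexivity.
Qed.

Lemma gvec_parity a b :
  all (fun t => bparity t.2 == bparity a (+) bparity b) (bracket_table a b).
Proof. by move: a b; apply: all2_gbasis; vm_compute. Qed.

Lemma gvec_jacobi a b c :
  D21_br (gvec a) (D21_br (gvec b) (gvec c)) =
    D21_br (D21_br (gvec a) (gvec b)) (gvec c) +
      (-1) ^+ (bparity a && bparity b) *:
         D21_br (gvec b) (D21_br (gvec a) (gvec c)).
Proof.
rewrite !tabrE tablE -tval_scale -tval_cat.
pose P a b c := teq (tabr a b c)
  (tabl a b c ++ tscale (bparity a && bparity b) (tabr b a c)).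
apply: tvalP; rewrite -/(P a b c); suff /allP : all (P a b) all_gbasis.
  by apply; apply: mem_all_gbasis.
move: a b; apply: (all2_gbasis (P := fun a b => all (P a b) all_gbasis)).
vm_compute; reflexivity.
Qed.

Lemma D21_partP p (x : D21_space) :
  reflect (forall a, bparity a != p -> x a = 0) (x \in D21_part p).
Proof.
apply: (iffP idP) => [xp a ap|xp].
  rewrite (coord_span (X := in_tuple _) xp) sum_ffunE big1 // => i _.
  have /imageP[b bp ->] := mem_nth 0 (ltn_ord i).
  rewrite !ffunE; case: eqP bp => [-> /eqP /= bp|_ _]; last exact: scaler0.
  by rewrite bp eqxx in ap.
rewrite [x]gvec_sum; apply: memv_suml => a _.
have [ap|/xp ->] := eqVneq (bparity a) p; last by rewrite scale0r mem0v.
by rewrite memvZ ?memv_span ?image_f // inE ap.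
Qed.

Lemma D21_part_sumE p (x : D21_space) : x \in D21_part p ->
  x = \sum_(a | bparity a == p) x a *: gvec a.
Proof.
move=> /D21_partP xp; rewrite {1}[x]gvec_sum [LHS](bigID (fun a => bparity a == p)).
by rewrite /= [X in _ + X]big1 ?addr0 // => a /xp ->; rewrite scale0r.
Qed.

Lemma gvec_part a : gvec a \in D21_part (bparity a).
Proof.
apply/D21_partP => b; rewrite ffunE; case: (a =P b) => [->|_ _]; last by [].
by rewrite eqxx.
Qed.

Lemma D21_part_sum : (D21_part false + D21_part true = fullv)%VS.
Proof.
apply/eqP; rewrite eqEsubv subvf; apply/subvP => x _; rewrite [x]gvec_sum.
apply: memv_suml => a _; apply: memvZ; have := gvec_part a.
by case: (bparity a); apply: subvP; rewrite ?addvSl ?addvSr.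
Qed.

Lemma D21_part_cap : (D21_part false :&: D21_part true = 0)%VS.
Proof.
apply/eqP; rewrite -subv0; apply/subvP => x /memv_capP[/D21_partP x0 /D21_partP x1].
rewrite memv0; apply/eqP/ffunP => a; rewrite ffunE.
by case: (boolP (bparity a)) => pa; [apply: x0|apply: x1]; rewrite ?pa // (negbTE pa).
Qed.

Lemma D21_br_part a b x y : x \in D21_part a -> y \in D21_part b ->
  D21_br x y \in D21_part (a (+) b).
Proof.
move=> /D21_part_sumE -> /D21_part_sumE ->.
rewrite D21_br_suml; apply: memv_suml => c /eqP <-; apply: memvZ.
rewrite D21_br_sumr; apply: memv_suml => d /eqP <-; apply: memvZ.
rewrite D21_br_gvec big_seq; apply: memv_suml => t ts; apply: memvZ.
by have /allP/(_ t ts)/eqP <- := gvec_parity c d; apply: gvec_part.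
Qed.

Lemma D21_br_sum2 (P Q : pred gbasis) (x y : gbasis -> K) :
  D21_br (\sum_(c | P c) x c *: gvec c) (\sum_(d | Q d) y d *: gvec d) =
  \sum_(c | P c) \sum_(d | Q d) (x c * y d) *: D21_br (gvec c) (gvec d).
Proof.
rewrite D21_br_suml; apply: eq_bigr => c _.
by rewrite D21_br_sumr scaler_sumr; apply: eq_bigr => d _; rewrite scalerA.
Qed.

Lemma D21_br_anti a b x y : x \in D21_part a -> y \in D21_part b ->
  D21_br x y = - ((-1) ^+ (a && b) *: D21_br y x).
Proof.
move=> /D21_part_sumE -> /D21_part_sumE ->.
rewrite !D21_br_sum2 exchange_big /= scaler_sumr -sumrN.
apply: eq_bigr => d /eqP db; rewrite scaler_sumr -sumrN.
apply: eq_bigr => c /eqP ca; rewrite gvec_anti ca db scalerN !scalerA.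
by congr (- (_ *: _)); ring.
Qed.

Lemma D21_jacobi_gvec2 c d z :
  D21_br (gvec c) (D21_br (gvec d) z) =
    D21_br (D21_br (gvec c) (gvec d)) z +
      (-1) ^+ (bparity c && bparity d) *:
         D21_br (gvec d) (D21_br (gvec c) z).
Proof.
rewrite [z]gvec_sum !D21_br_sumr scaler_sumr -big_split /=.
apply: eq_bigr => e _; rewrite gvec_jacobi scalerDr !scalerA.
by congr (_ + _ *: _); ring.
Qed.

Lemma D21_jacobi_gvec1 b c y z : y \in D21_part b ->
  D21_br (gvec c) (D21_br y z) =
    D21_br (D21_br (gvec c) y) z +
      (-1) ^+ (bparity c && b) *: D21_br y (D21_br (gvec c) z).
Proof.
move=> /D21_part_sumE ->.
rewrite !D21_br_suml !D21_br_sumr D21_br_suml scaler_sumr -big_split /=.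
apply: eq_bigr => d /eqP <-; rewrite D21_jacobi_gvec2 scalerDr !scalerA.
by congr (_ + _ *: _); ring.
Qed.

Lemma D21_jacobi a b x y z : x \in D21_part a -> y \in D21_part b ->
  D21_br x (D21_br y z) =
    D21_br (D21_br x y) z + (-1) ^+ (a && b) *: D21_br y (D21_br x z).
Proof.
move=> /D21_part_sumE -> yb.
rewrite !D21_br_suml !D21_br_sumr scaler_sumr -big_split /=.
apply: eq_bigr => c /eqP <-; rewrite (D21_jacobi_gvec1 _ _ yb) scalerDr !scalerA.
by congr (_ + _ *: _); ring.
Qed.

Definition D21 : lieSuperalgebra K :=
  LieSuperalgebra D21_part_sum D21_part_cap D21_br_linearl D21_br_linearr
    D21_br_part D21_br_anti D21_jacobi.

Lemma D21_dim : \dim {:D21} = 17.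
Proof. by rewrite dimvf /dim /= !card_sum !card_prod !card_ord card_bool. Qed.

(* The Chevalley generators of the distinguished simple system
   delta - epsilon_1 - epsilon_2, 2 epsilon_1, 2 epsilon_2. *)

Definition cartan_matrix : 'M[K]_3 :=
  \matrix_(i, j) nth 0 (nth [::] [:: [:: 0; 1; zeta]; [:: -1; 2; 0];
                                     [:: -1; 0; 2]] i) j.

Definition chevalley_e (i : 'I_3) : D21_space :=
  if i == 0 then gvec (bO (true, false, false)) else gvec (bE i true).

Definition chevalley_f (i : 'I_3) : D21_space :=
  if i == 0 then 2^-1 *: gvec (bO (false, true, true)) else gvec (bE i false).

Definition chevalley_h (i : 'I_3) : D21_space :=
  if i == 0 then
    2^-1 *: ((1 + zeta) *: gvec (bH 0) + gvec (bH 1) + zeta *: gvec (bH 2))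
  else gvec (bH i).

Lemma D21_brDl x x' y : D21_br (x + x') y = D21_br x y + D21_br x' y.
Proof. by have := D21_br_linearl y 1 x x'; rewrite !scale1r. Qed.

Lemma D21_br0l y : D21_br 0 y = 0.
Proof. by have := D21_br_linearl y (-1) 0 0; rewrite scaler0 addr0 scaleN1r addNr. Qed.

Lemma D21_brZl c x y : D21_br (c *: x) y = c *: D21_br x y.
Proof. by have := D21_br_linearl y c x 0; rewrite D21_br0l !addr0. Qed.

Lemma ord3P (P : 'I_3 -> Prop) : P 0 -> P 1 -> P 2 -> forall i, P i.
Proof.
move=> P0 P1 P2 [[|[|[|]]]] // lt; [move: P0|move: P1|move: P2];
  by congr P; apply: val_inj.
Qed.

Lemma D21_chevalley (i j : 'I_3) : 2 != 0 :> K ->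
  [/\ D21_br (chevalley_h i) (chevalley_h j) = 0,
      D21_br (chevalley_h i) (chevalley_e j) = cartan_matrix i j *: chevalley_e j,
      D21_br (chevalley_h i) (chevalley_f j) =
        - cartan_matrix i j *: chevalley_f j &
      D21_br (chevalley_e i) (chevalley_f j) = (i == j)%:R *: chevalley_h i].
Proof.
move=> K2; rewrite mxE; move: i; apply: ord3P; move: j; apply: ord3P;
rewrite /chevalley_h /chevalley_e /chevalley_f /=;
rewrite ?(D21_brDl, D21_brZl, linearD, linearZ) /= ?D21_brDl ?D21_brZl ?D21_br_gvec;
rewrite ?(big_cons, big_nil) /coef /=; split;
apply/ffunP => b; rewrite !ffunE /=; rewrite /GRing.scale /=; try by field.
by rewrite /psi /sgn /= !(intrM, intrN); ring.
Qed.

(* Weights.  The vectors gvec (bH i) are h_{2 delta}, h_{2 epsilon_1},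
   h_{2 epsilon_2}, and weights are given by their values on these vectors. *)

Definition weight := 'rV[int]_3.

Definition wt (x y z : int) : weight := \row_j [:: x; y; z]`_j.

Definition rho : weight := wt (-1) 1 1.

Definition positive_roots : seq weight :=
  [:: wt 2 0 0; wt 0 2 0; wt 0 0 2;
      wt 1 1 1; wt 1 1 (-1); wt 1 (-1) 1; wt 1 (-1) (-1)].

Definition bweight (b : gbasis) : weight :=
  match b with
  | inl (inl _) => 0
  | inl (inr (i, e)) => (2 * sgn e) *: delta_mx 0 i
  | inr s => \row_i sgn (sg s i)
  end.

Lemma gvec_weight i b :
  D21_br (gvec (bH i)) (gvec b) = (bweight b 0 i)%:~R *: gvec b.
Proof.
rewrite D21_br_gvec; case: b => [[j|[j e]]|s] /=.
- by rewrite big_nil mxE scale0r.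
- rewrite !mxE eqxx /=; case: eqP => _ /=.
    by rewrite big_seq1 /coef mul0r addr0 mulr1.
  by rewrite big_nil mulr0 scale0r.
- by rewrite mxE big_seq1 /coef mul0r addr0.
Qed.

Definition n_plus : {vspace D21} :=
  <<[seq gvec b | b in [pred c | bweight c \in positive_roots]]>>%VS.

Definition tensor_algebra := {malg K[{fmonom gbasis}]}.

Definition tensor_gen (x : D21) : tensor_algebra :=
  \sum_b mkmalgU (fmu b) ((x : D21_space) b).

(* The two-sided ideal of the tensor algebra defining U(g), plus the left ideal
   generated by n_+ and by h - mu(h) for h in the Cartan subalgebra. *)
Inductive verma_relation (mu : weight) : tensor_algebra -> Prop :=
| VermaZero : verma_relation mu 0
| VermaLinear c s t : verma_relation mu s -> verma_relation mu t ->
    verma_relation mu (c *: s + t)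
| VermaEnveloping p q x y s t : x \in lie_part D21 p -> y \in lie_part D21 q ->
    verma_relation mu
      (s * (tensor_gen x * tensor_gen y
            - (-1) ^+ (p && q) *: (tensor_gen y * tensor_gen x)
            - tensor_gen (lie_br x y)) * t)
| VermaNilpotent s x : x \in n_plus -> verma_relation mu (s * tensor_gen x)
| VermaCartan s i : verma_relation mu
    (s * (tensor_gen (gvec (bH i) : D21) - ((mu 0 i)%:~R)%:A)).

Definition verma_pred mu : {pred tensor_algebra} := fun t => `[< verma_relation mu t >].

Lemma verma_pred_closed mu : submod_closed (verma_pred mu).
Proof.
split; first by apply/asboolP; apply: VermaZero.
by move=> c s t /asboolP ms /asboolP mt; apply/asboolP; apply: VermaLinear.
Qed.

Definition verma_subspace mu := Subspace (verma_pred_closed mu).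

Lemma tensor_gen_linear : linear tensor_gen.
Proof.
move=> c x y; rewrite /tensor_gen scaler_sumr -big_split; apply: eq_bigr => b _.
by apply/malgP => k; rewrite !(mcoeffD, mcoeffZ, mcoeffU, ffunE) mulrnAr -mulrnDl.
Qed.

Lemma tensor_scaleAr c (s t : tensor_algebra) : s * (c *: t) = c *: (s * t).
Proof. exact: malg_scaleAr. Qed.

Definition tensor_op (x : D21) (t : tensor_algebra) := tensor_gen x * t.

Lemma tensor_op_linearl t : linear (tensor_op^~ t).
Proof.
by move=> c x y; rewrite /tensor_op tensor_gen_linear mulrDl scalerAl.
Qed.

Lemma tensor_op_linearr x : linear (tensor_op x).
Proof. by move=> c s t; rewrite /tensor_op mulrDr tensor_scaleAr. Qed.

Lemma tensor_op_stable mu x t :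
  t \in verma_subspace mu -> tensor_op x t \in verma_subspace mu.
Proof.
move=> /asboolP mt; apply/asboolP; rewrite /tensor_op.
elim: mt => {t} [|c s t _ ms _ mt|p q y z s t yp zq|s y yn|s i].
- by rewrite mulr0; apply: VermaZero.
- by rewrite mulrDr tensor_scaleAr; apply: VermaLinear.
- by rewrite 2!mulrA; apply: VermaEnveloping.
- by rewrite mulrA; apply: VermaNilpotent.
- by rewrite mulrA; apply: VermaCartan.
Qed.

Lemma tensor_op_br mu p q x y t : x \in lie_part D21 p -> y \in lie_part D21 q ->
  tensor_op (lie_br x y) t -
    (tensor_op x (tensor_op y t) - (-1) ^+ (p && q) *: tensor_op y (tensor_op x t))
  \in verma_subspace mu.
Proof.
move=> xp yq; apply/asboolP.
have := VermaEnveloping mu 1 t xp yq => /(VermaLinear (-1)).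
by move=> /(_ _ (VermaZero mu)); rewrite supercommutator_scaleN1.
Qed.

Definition verma_module (mu : weight) : lieModule D21 :=
  quotient_module tensor_op_linearl tensor_op_linearr
    (tensor_op_stable (mu := mu)) (tensor_op_br mu).

(* The rho-shift: M_lambda has highest weight lambda - rho. *)
Definition Verma (lam : weight) : lieModule D21 := verma_module (lam - rho).

(* L_lambda: the quotient by the sum of all proper submodules, which is the
   unique maximal submodule of M_lambda. *)
Definition Simple (lam : weight) : lieModule D21 :=
  quotient_module (act_linearl (l := Verma lam)) (act_linearr (l := Verma lam))
    (maximal_sum_stable (M := Verma lam)) (maximal_sum_br (M := Verma lam)).

Section CategoryO.
Variable M : lieModule D21.
Implicit Types (N : {pred M}) (s : seq M).

Definition weight_vector (mu : weight) (v : M) :=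
  forall i : 'I_3, act (gvec (bH i) : D21) v = (mu 0 i)%:~R *: v.

Definition lin_comb s (v : M) :=
  exists c : 'I_(size s) -> K, v = \sum_i c i *: s`_i.

(* Phrased for submodules N of M; M itself is the case N = predT. *)
Definition in_category_O N :=
  [/\ is_submodule N,
      exists2 s : seq M, {subset s <= N} & forall N', is_submodule N' ->
        {subset s <= N'} -> {subset N <= N'},
      {in N, forall v, exists2 s : seq M, v = \sum_(w <- s) w &
        {in s, forall w, w \in N /\ exists mu, weight_vector mu w}} &
      {in N, forall v, exists2 s : seq M, lin_comb s v &
        forall x w, x \in n_plus -> w \in s -> lin_comb s (act x w)}].

Definition composition_series (n : nat) (W : nat -> {pred M}) :=
  [/\ W 0 =i pred1 0, W n =i predT,
      forall i, (i <= n)%N -> in_category_O (W i) &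
      forall i, (i < n)%N -> simple_quotient (W i.+1) (W i)].

Definition composition_multiplicity n (W : nat -> {pred M}) (lam : weight) : nat :=
  #|[set i : 'I_n | `[< subquotient_iso (W i.+1) (W i) (Simple lam) >]]|.

(* The list p encodes the multiplicities: [M : L_lambda] is the number of
   occurrences of lambda in p, for all lambda in X.  That this number does not
   depend on the composition series is part of the assertion. *)
Definition composition_factors (p : seq weight) :=
  (exists n W, composition_series n W) /\
  forall n W, composition_series n W ->
    forall lam, composition_multiplicity n W lam = count_mem lam p.

End CategoryO.

End Construction.

(* Main.v *)
Require Import Defs.
From HB Require Import structures.
From Stdlib Require Import ZArith.
From mathcomp Require Import all_boot all_order all_algebra finmap.
From mathcomp Require Import ssrZ.
From mathcomp.multinomials Require Import monalg.
From mathcomp Require Import boolp reals.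
From mathcomp.real_closed Require Import complex.
From mathcomp Require Import ring zify.

Set Implicit Arguments.
Unset Strict Implicit.
Unset Printing Implicit Defensive.

Import Order.TTheory GRing.Theory Num.Theory.
Local Open Scope ring_scope.
Local Open Scope quotient_scope.


(** The composition factors of a Verma module are determined by the dimensions of
    finitely many weight spaces, once it is known which simple modules can occur.

    The Poincare-Birkhoff-Witt basis is obtained from a model: a vector space on
    symbols for straightened monomials, on which the root vectors act by explicit
    rules that are polynomial in [zeta], the exponents and the highest weight.  The
    bracket relations are polynomial identities ([bracket_defect0]).  The Verma module
    maps to the model ([verma_module_like]), which makes its lowering words linearly
    independent; they span because words can be put in standard order
    ([pbw_closed]).  Hence the weight spaces are known ([low_indices]).

    Linkage ([linked_weight]): the Casimir element acts on a highest weight vector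
    of weight [(a, b, c) - rho] by [b ^ 2 + zeta c ^ 2 - (1 + zeta) a ^ 2], and by 0
    on the five modules.  As [zeta] is irrational, [a ^ 2 = b ^ 2 = c ^ 2].  A product
    of Casimir elements of the even sl_2 that annihilates the module bounds these
    squares by 4.  Thirteen weights remain.

    Every nonzero subquotient contains a highest weight vector ([exists_singular]).
    So the total dimension of the thirteen weight spaces grows in every strict
    inclusion of submodules, and a chain of minimal steps is a composition series
    ([composition_series_exists]); a step is isomorphic to the simple module with the
    weight of its highest weight vector ([iso_of_singular]).

    A weight vector lies in the largest proper submodule exactly when no raising word
    brings it to a nonzero multiple of the generator.  So the dimension of a weight
    space of a simple module is the rank of a matrix of polynomials in [zeta]
    ([form_rank_dim], [simple_weight_dim]).  In all cases that are needed elimination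
    finds pivots that are integer multiples of [zeta ^ i * (1 + zeta) ^ j].

    The weight spaces of the factors of a composition series add up to those of the
    Verma module.  The dimensions of the thirteen weight spaces of the thirteen
    simple modules form a unitriangular table, so the multiplicities are the only
    solution of a linear system ([unitriangular_perm]), and the lists of the theorem
    solve it ([five_factors_check]). *)

(** * Integer polynomials with a computable normal form *)

(** A list of terms, each a coefficient with the exponents of seven variables.
    Sums are kept without zero terms and without repeated monomials, so that a
    polynomial identity is certified by an empty list. *)
Definition zpoly := seq (Z * seq nat).

Fixpoint monom_mul (m n : seq nat) : seq nat :=
  match m, n with
  | [::], _ => n
  | _, [::] => m
  | a :: m', b :: n' => (a + b)%N :: monom_mul m' n'
  end.

Fixpoint term_add (c : Z) (m : seq nat) (p : zpoly) : zpoly :=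
  if p is (c', m') :: p' then
    if m == m' then
      let s := Z.add c c' in if Z.eqb s Z0 then p' else (s, m') :: p'
    else (c', m') :: term_add c m p'
  else [:: (c, m)].

Definition poly_add (p q : zpoly) : zpoly := foldr (fun t => term_add t.1 t.2) q p.

Definition poly_mul (p q : zpoly) : zpoly :=
  foldr (fun t r =>
    poly_add [seq (Z.mul t.1 u.1, monom_mul t.2 u.2) | u <- q] r) [::] p.

Definition poly_const (c : Z) : zpoly :=
  if Z.eqb c Z0 then [::] else [:: (c, nseq 7 0%N)].
Definition poly_var (i : nat) : zpoly := [:: (Zpos xH, set_nth 0%N (nseq 7 0%N) i 1%N)].
Definition poly_opp (p : zpoly) : zpoly := [seq (Z.opp t.1, t.2) | t <- p].

Fixpoint poly_mul_exp (p : zpoly) (n : nat) (q : zpoly) : zpoly :=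
  if n is n'.+1 then poly_mul p (poly_mul_exp p n' q) else q.

Fixpoint monom_subst (s : seq zpoly) (m : seq nat) : zpoly :=
  match s, m with
  | p :: s', n :: m' => poly_mul_exp p n (monom_subst s' m')
  | _, _ => poly_const (Zpos xH)
  end.

Definition poly_subst (s : seq zpoly) (p : zpoly) : zpoly :=
  foldr (fun t r =>
    poly_add (poly_mul (poly_const t.1) (monom_subst s t.2)) r) [::] p.

(** * Straightening *)

(** The variables are zeta, then the exponents k_0, k_1, k_2 of the three even
    lowering operators, then the highest weight. *)
Definition pzeta := poly_var 0.
Definition pk (i : 'I_3) := poly_var i.+1.
Definition pmu (i : 'I_3) := poly_var i.+4.
Definition pint (n : int) : zpoly := poly_const (Z_of_int n).
Definition pcoef (c : int * int) : zpoly :=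
  poly_add (pint c.1) (poly_mul (pint c.2) pzeta).

(** The index [((k0, k1, k2), S)] stands for the monomial
    [f0 ^ k0 * S * f1 ^ k1 * f2 ^ k2] applied to the highest weight vector, where
    [f0, f1, f2] are the even lowering operators and [S] is an increasing product
    of odd ones.  In a [vec] the exponents are relative to symbolic exponents
    [k_0, k_1, k_2], so that one [vec] describes a rule for all monomials. *)
Definition pbw_index := ((int * int * int) * seq (bool * bool))%type.
Definition vec := seq (zpoly * pbw_index).

Definition exps_add (k d : int * int * int) : int * int * int :=
  (k.1.1 + d.1.1, k.1.2 + d.1.2, k.2 + d.2).
Definition unit_exps (c : int) (i : 'I_3) : int * int * int :=
  (if i == 0 then c else 0, if i == 1 then c else 0, if i == 2 then c else 0).

Fixpoint vterm_add (c : zpoly) (x : pbw_index) (v : vec) : vec :=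
  if v is (c', x') :: v' then
    if x == x' then
      let s := poly_add c c' in if nilp s then v' else (s, x') :: v'
    else (c', x') :: vterm_add c x v'
  else if nilp c then [::] else [:: (c, x)].
Definition vec_add (v w : vec) : vec := foldr (fun t => vterm_add t.1 t.2) w v.
Definition vec_scale (c : zpoly) (v : vec) : vec := [seq (poly_mul c t.1, t.2) | t <- v].
Definition vec_sum (vs : seq vec) : vec := foldr vec_add [::] vs.

Definition all_odd : seq (bool * bool) :=
  [:: (true, true); (true, false); (false, true); (false, false)].
Definition odd_rank (a : bool * bool) : nat := index a all_odd.
Definition lower_odd (a : bool * bool) : gbasis := bO (false, a.1, a.2).

Definition bterms (a b : gbasis) : seq (zpoly * gbasis) :=
  [seq (pcoef t.1, t.2) | t <- bracket_table a b].

Definition low0 : gbasis := bE 0 false.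
Definition unit_vec (x : pbw_index) : vec := [:: (poly_const (Zpos xH), x)].

(** Two odd lowering operators bracket into the line of [f0], which commutes with
    all lowering operators and moves to the front. *)
Fixpoint odd_insert (a : bool * bool) (S : seq (bool * bool)) : vec :=
  if S is a' :: S' then
    if (odd_rank a < odd_rank a')%N then unit_vec (0, a :: S)
    else if a == a' then [::]
    else vec_add
      (vec_sum [seq vec_scale t.1 (unit_vec (unit_exps 1 0, S'))
               | t <- bterms (lower_odd a) (lower_odd a')])
      [seq (poly_opp t.1, (t.2.1, a' :: t.2.2)) | t <- odd_insert a S']
  else unit_vec (0, [:: a]).

(** The action on [f1 ^ k_1 * f2 ^ k_2 * v] is that of sl_2 on Verma modules. *)
Definition straight0 (b : gbasis) : vec :=
  match b with
  | inl (inl i) =>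
    [:: (poly_add (pmu i) (if i == 0 then [::] else poly_mul (pint (-2)) (pk i)),
         (0, [::]))]
  | inl (inr (i, true)) =>
    if i == 0 then [::] else
    [:: (poly_mul (pk i) (poly_add (pmu i) (poly_add (poly_opp (pk i)) (pint 1))),
         (unit_exps (-1) i, [::]))]
  | inl (inr (i, false)) => unit_vec (unit_exps 1 i, [::])
  | inr _ => [::]
  end.

Definition vec_shift (d : int * int * int) (v : vec) : vec :=
  [seq (t.1, (exps_add t.2.1 d, t.2.2)) | t <- v].

(** The action on [S * f1 ^ k_1 * f2 ^ k_2 * v]: the operator is moved past the
    first odd factor at the cost of a bracket. *)
Fixpoint straight (S : seq (bool * bool)) (b : gbasis) {struct S} : vec :=
  if b is inr (false, b1, b2) then odd_insert (b1, b2) S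
  else if S is a :: S' then
    vec_add (vec_sum [seq vec_scale t.1 (straight S' t.2) | t <- bterms b (lower_odd a)])
      (vec_sum [seq vec_scale (if bparity b then poly_opp t.1 else t.1)
                      (vec_shift t.2.1 (odd_insert a t.2.2))
               | t <- straight S' b])
  else straight0 b.

(** Moving [b] past [f0 ^ k_0] gives [f0 ^ k_0 * b + k_0 f0 ^ (k_0 - 1) * [b, f0]],
    and a second commutator only for the raising operator of the same sl_2, where
    [[[e, f0], f0] = -2 f0]. *)
Definition pbw_action (b : gbasis) (S : seq (bool * bool)) : vec :=
  let k0 := pk 0 in
  vec_add (straight S b)
    (vec_add
      (vec_sum [seq vec_scale (poly_mul k0 t.1)
                      (vec_shift (unit_exps (-1) 0) (straight S t.2))
               | t <- bterms b low0])
      (if b == bE 0 true then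
         [:: (poly_mul k0 (poly_add (pint 1) (poly_opp k0)), (unit_exps (-1) 0, S))]
       else [::])).

Definition odd_subsets : seq (seq (bool * bool)) :=
  [seq mask [:: m.1.1; m.1.2; m.2.1; m.2.2] all_odd |
     m <- [seq (x, y) | x <- [seq (a, b) | a <- [:: true; false], b <- [:: true; false]],
                        y <- [seq (a, b) | a <- [:: true; false], b <- [:: true; false]]]].

Definition pbw_table : seq (seq vec) :=
  Eval vm_compute in [seq map (pbw_action b) odd_subsets | b <- all_gbasis].
Definition act_table (b : gbasis) (S : seq (bool * bool)) : vec :=
  nth [::] (nth [::] pbw_table (index b all_gbasis)) (index S odd_subsets).

(** The rules are polynomials in the exponents; to apply them to a monomial with
    exponents [k_i + k] these sums are substituted. *)
Definition env_shift (s : seq zpoly) (k : int * int * int) : seq zpoly :=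
  if s is [:: z, k0, k1, k2 & m] then
    [:: z, poly_add k0 (pint k.1.1), poly_add k1 (pint k.1.2),
        poly_add k2 (pint k.2) & m]
  else s.

Definition vec_act (s : seq zpoly) (b : gbasis) (v : vec) : vec :=
  vec_sum [seq [seq (poly_mul t.1 (poly_subst (env_shift s t.2.1) u.1),
                     (exps_add t.2.1 u.2.1, u.2.2)) | u <- act_table b t.2.2] | t <- v].

Definition generic : seq zpoly := [seq poly_var i | i <- iota 0 7].

Definition bracket_defect (a b : gbasis) (S : seq (bool * bool)) : vec :=
  let v := unit_vec (0, S) in
  let ab := vec_act generic a (vec_act generic b v) in
  let ba := vec_act generic b (vec_act generic a v) in
  vec_add ab (vec_add
    (vec_scale (pint (if bparity a && bparity b then 1 else -1)) ba)
    (vec_sum [seq vec_scale (poly_opp t.1) (vec_act generic t.2 v) | t <- bterms a b])).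

(** The rules satisfy the bracket relations of the Lie superalgebra, as polynomial
    identities in [zeta], the exponents and the highest weight.  This contains the
    linear independence in the Poincare-Birkhoff-Witt theorem for Verma modules. *)
Lemma bracket_defect0 : all (fun a => all (fun b => all (fun S => nilp (bracket_defect a b S))
  odd_subsets) all_gbasis) all_gbasis.
Proof. by vm_compute. Qed.

Arguments act_table : simpl never.
Opaque pbw_table.

(** * Evaluation of symbolic vectors *)

Section Lift.
Variables (K : fieldType) (I : choiceType) (V : lmodType K).
Local Open Scope fset_scope.

Definition malg_lift (F : I -> V) (g : {malg K[I]}) : V :=
  \sum_(x <- msupp g) g@_x *: F x.

Lemma malg_liftEw F (g : {malg K[I]}) (d : {fset I}) : msupp g `<=` d ->
  malg_lift F g = \sum_(x <- d) g@_x *: F x.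
Proof.
move=> gd; apply: big_fset_incl => // x _ xg.
by rewrite mcoeff_outdom ?scale0r.
Qed.

Lemma malg_lift_linear F : linear (malg_lift F).
Proof.
move=> c g h; pose d := msupp g `|` msupp h `|` msupp (c *: g + h).
rewrite (@malg_liftEw _ _ d) ?fsubsetUr // (@malg_liftEw _ g d); last first.
  by rewrite /d -fsetUA fsubsetUl.
rewrite (@malg_liftEw _ h d); last by rewrite /d fsetUAC fsubsetUr.
rewrite scaler_sumr -big_split; apply: eq_bigr => x _ /=.
by rewrite mcoeffD mcoeffZ scalerDl scalerA.
Qed.

HB.instance Definition _ F := GRing.isLinear.Build K {malg K[I]} V *:%R
  (malg_lift F) (malg_lift_linear F).

Lemma malg_liftU F x c : malg_lift F << c *g x >> = c *: F x.
Proof.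
by rewrite (malg_liftEw _ msuppU_le) big_seq_fset1 mcoeffUU.
Qed.

Lemma malgU_scale (x : I) (c : K) : << c *g x >> = c *: << x >> :> {malg K[I]}.
Proof. by apply/malgP => y; rewrite mcoeffZ !mcoeffU mulr_natr. Qed.

Lemma malg_sum (g : {malg K[I]}) : g = \sum_(x <- msupp g) g@_x *: << x >>.
Proof. by rewrite {1}[g]monalgE; apply: eq_bigr => x _; rewrite malgU_scale. Qed.

End Lift.

Section Evaluation.
Variable K : fieldType.
Implicit Types (E : seq K) (p q : zpoly).

Definition zval (z : Z) : K := (int_of_Z z)%:~R.

Lemma zvalD y z : zval (Z.add y z) = zval y + zval z.
Proof. by rewrite /zval -intrD -rmorphD. Qed.

Lemma zvalM y z : zval (Z.mul y z) = zval y * zval z.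
Proof. by rewrite /zval -intrM -rmorphM. Qed.

Lemma zvalN z : zval (Z.opp z) = - zval z.
Proof. by rewrite /zval -intrN -rmorphN. Qed.

Lemma zval_int n : zval (Z_of_int n) = n%:~R.
Proof. by rewrite /zval Z_of_intK. Qed.

Fixpoint monom_val E (m : seq nat) : K :=
  match E, m with
  | x :: E', n :: m' => x ^+ n * monom_val E' m'
  | _, _ => 1
  end.

Definition poly_val E p : K := \sum_(t <- p) zval t.1 * monom_val E t.2.

Lemma monom_valM E m n : monom_val E (monom_mul m n) = monom_val E m * monom_val E n.
Proof.
elim: E m n => [|x E IH] [|a m] [|b n] //=; rewrite ?mul1r ?mulr1 //.
by rewrite IH exprD mulrACA.
Qed.

Lemma monom_val0 E n : monom_val E (nseq n 0%N) = 1.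
Proof. by elim: E n => [|x E IH] [|n] //=; rewrite IH expr0 mulr1. Qed.

Lemma poly_val_nil E : poly_val E [::] = 0.
Proof. exact: big_nil. Qed.

Lemma poly_val_cons E t p :
  poly_val E (t :: p) = zval t.1 * monom_val E t.2 + poly_val E p.
Proof. exact: big_cons. Qed.

Lemma poly_val_term E c m p :
  poly_val E (term_add c m p) = zval c * monom_val E m + poly_val E p.
Proof.
elim: p => [|[c' m'] p IH] /=; first by rewrite poly_val_cons.
case: eqP => [<-|_]; last by rewrite !poly_val_cons IH addrCA.
rewrite poly_val_cons /= addrA -mulrDl -zvalD.
case: Z.eqb_spec => [->|_]; last by rewrite poly_val_cons.
by rewrite /zval /= mul0r add0r.
Qed.

Lemma poly_valD E p q : poly_val E (poly_add p q) = poly_val E p + poly_val E q.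
Proof.
elim: p => [|t p IH] /=; first by rewrite poly_val_nil add0r.
by rewrite poly_val_term IH poly_val_cons addrA.
Qed.

Lemma poly_valM E p q : poly_val E (poly_mul p q) = poly_val E p * poly_val E q.
Proof.
elim: p => [|t p IH] /=; first by rewrite !poly_val_nil mul0r.
rewrite poly_valD IH poly_val_cons mulrDl; congr (_ + _).
rewrite /poly_val big_map mulr_sumr; apply: eq_bigr => u _ /=.
by rewrite zvalM monom_valM mulrACA.
Qed.

Lemma poly_valN E p : poly_val E (poly_opp p) = - poly_val E p.
Proof.
rewrite /poly_val big_map -sumrN; apply: eq_bigr => t _ /=.
by rewrite zvalN mulNr.
Qed.

Lemma poly_val_const E c : poly_val E (poly_const c) = zval c.
Proof.
rewrite /poly_const; case: Z.eqb_spec => [->|_]; first by rewrite poly_val_nil.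
by rewrite poly_val_cons poly_val_nil (monom_val0 E 7) mulr1 addr0.
Qed.

Lemma poly_val_int E n : poly_val E (pint n) = n%:~R.
Proof. by rewrite poly_val_const zval_int. Qed.

Lemma poly_val1 E : poly_val E (poly_const (Zpos xH)) = 1.
Proof. by rewrite poly_val_const. Qed.

Lemma poly_val_mul_exp E p n q :
  poly_val E (poly_mul_exp p n q) = poly_val E p ^+ n * poly_val E q.
Proof. by elim: n => [|n IH] /=; rewrite ?mul1r // poly_valM IH exprS mulrA. Qed.

Lemma poly_val_subst E s p :
  poly_val E (poly_subst s p) = poly_val [seq poly_val E q | q <- s] p.
Proof.
elim: p => [|t p IH] /=; first by rewrite !poly_val_nil.
rewrite poly_valD poly_valM poly_val_const IH poly_val_cons; congr (_ * _ + _).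
elim: s (t.2) {IH} => [|q s IHs] [|n m] //=; rewrite ?poly_val1 //.
by rewrite poly_val_mul_exp IHs.
Qed.

Lemma poly_val_coef zeta E c :
  poly_val (zeta :: E) (pcoef c) = coef zeta c.
Proof.
rewrite poly_valD poly_valM !poly_val_int; congr (_ + _ * _).
rewrite /pzeta /poly_var poly_val_cons poly_val_nil /= addr0 expr1 mul1r.
by rewrite -[_ :: _]/(nseq 6 0%N) monom_val0 mulr1.
Qed.

End Evaluation.

(** * Straightened monomials in a module *)

Section Straightened.
Variables (K : fieldType) (zeta : K) (mu : weight) (V : lmodType K).
Variable e : pbw_index -> V.

Definition point (k : int * int * int) : seq K :=
  [:: zeta; k.1.1%:~R; k.1.2%:~R; k.2%:~R; (mu 0 0)%:~R; (mu 0 1)%:~R; (mu 0 2)%:~R].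

Definition vec_val (E : seq K) (k : int * int * int) (v : vec) : V :=
  \sum_(t <- v) poly_val E t.1 *: e (exps_add k t.2.1, t.2.2).

Lemma vec_val_nil E k : vec_val E k [::] = 0.
Proof. exact: big_nil. Qed.

Lemma vec_val_cons E k t v : vec_val E k (t :: v) =
  poly_val E t.1 *: e (exps_add k t.2.1, t.2.2) + vec_val E k v.
Proof. exact: big_cons. Qed.

Lemma vec_val_seq1 E k t : vec_val E k [:: t] =
  poly_val E t.1 *: e (exps_add k t.2.1, t.2.2).
Proof. by rewrite vec_val_cons vec_val_nil addr0. Qed.

Lemma vec_val_term E k c x v : vec_val E k (vterm_add c x v) =
  poly_val E c *: e (exps_add k x.1, x.2) + vec_val E k v.
Proof.
elim: v => [|[c' x'] v IH] /=.
  by case: nilP => [->|_]; rewrite ?vec_val_cons vec_val_nil // poly_val_nil scale0r add0r.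
case: eqP => [<-|_]; last by rewrite !vec_val_cons IH addrCA.
rewrite vec_val_cons /= addrA -scalerDl -poly_valD.
by case: nilP => [->|_]; rewrite ?vec_val_cons // poly_val_nil scale0r add0r.
Qed.

Lemma vec_valD E k v w : vec_val E k (vec_add v w) = vec_val E k v + vec_val E k w.
Proof.
elim: v => [|t v IH] /=; first by rewrite vec_val_nil add0r.
by rewrite vec_val_term IH vec_val_cons addrA.
Qed.

Lemma vec_valZ E k c v :
  vec_val E k (vec_scale c v) = poly_val E c *: vec_val E k v.
Proof.
rewrite /vec_val big_map scaler_sumr; apply: eq_bigr => t _ /=.
by rewrite poly_valM scalerA.
Qed.

Lemma vec_val_sum E k vs : vec_val E k (vec_sum vs) = \sum_(v <- vs) vec_val E k v.
Proof.
elim: vs => [|v vs IH] /=; first by rewrite vec_val_nil big_nil.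
by rewrite vec_valD IH big_cons.
Qed.

Lemma exps_addA k d d' : exps_add (exps_add k d) d' = exps_add k (exps_add d d').
Proof. by rewrite /exps_add /= !addrA. Qed.

Lemma exps_add0 k : exps_add k 0 = k.
Proof. by case: k => [[a b] c]; rewrite /exps_add /= !addr0. Qed.

Lemma vec_val_unit E k d S : vec_val E k (unit_vec (d, S)) = e (exps_add k d, S).
Proof. by rewrite vec_val_seq1 poly_val1 scale1r. Qed.

Definition straightens (b : gbasis) (op : V -> V) :=
  forall x, op (e x) = vec_val (point x.1) x.1 (act_table b x.2).

(** A substitution [s] whose value is the point of [k] makes the symbolic action
    on vectors based at [k] compute the action. *)
Lemma vec_actE (op : {linear V -> V}) E s k b v :
  straightens b op -> [seq poly_val E p | p <- s] = point k ->
  vec_val E k (vec_act s b v) = op (vec_val E k v).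
Proof.
move=> opb sE; rewrite vec_val_sum big_map [in RHS]/vec_val.
rewrite linear_sum; apply: eq_bigr => t _ /=.
rewrite linearZ opb /= /vec_val big_map scaler_sumr.
apply: eq_bigr => u _ /=.
rewrite poly_valM poly_val_subst scalerA exps_addA; congr (_ * poly_val _ _ *: _).
move: sE; rewrite /env_shift /point.
case: s => [|z [|k0 [|k1 [|k2 m]]]] //= [-> e0 e1 e2 ->].
by rewrite !poly_valD !poly_val_int e0 e1 e2 /= !intrD.
Qed.

Lemma generic_point k : [seq poly_val (point k) p | p <- generic] = point k.
Proof.
rewrite /point /generic /= /poly_var /=.
by rewrite !poly_val_cons !poly_val_nil /= !expr0 !expr1 !mul1r !mulr1 !addr0.
Qed.

End Straightened.

(** * The model of the Verma modules *)

Section ModuleOfOperators.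
Variables (K : fieldType) (zeta : K) (V : lmodType K).
Variable op : gbasis -> {linear V -> V}.
Hypothesis op_bracket : forall a b v,
  op a (op b v) - (-1) ^+ (bparity a && bparity b) *: op b (op a v) =
    \sum_(t <- bracket_table a b) coef zeta t.1 *: op t.2 v.

Definition op_act (x : D21 zeta) (v : V) : V := \sum_b (x : D21_space K) b *: op b v.

Lemma op_act_linearl v : linear (op_act^~ v).
Proof.
move=> c x y; rewrite /op_act scaler_sumr -big_split; apply: eq_bigr => b _ /=.
by rewrite !ffunE scalerDl scalerA.
Qed.

Lemma op_act_linearr x : linear (op_act x).
Proof.
move=> c u v; rewrite /op_act scaler_sumr -big_split; apply: eq_bigr => b _ /=.
by rewrite linearP scalerDr !scalerA mulrC.
Qed.

Lemma op_act_gvec b v : op_act (gvec K b : D21 zeta) v = op b v.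
Proof.
rewrite /op_act (bigD1 b) //= big1 ?addr0 => [|c /negbTE cb].
  by rewrite ffunE eqxx scale1r.
by rewrite ffunE eq_sym cb scale0r.
Qed.

Definition op_actl v : {linear D21 zeta -> V} := HB.pack (op_act^~ v)
  (GRing.isLinear.Build K (D21 zeta) V *:%R (op_act^~ v) (op_act_linearl v)).

Lemma op_act_br p q (x y : D21 zeta) v :
  x \in lie_part (D21 zeta) p -> y \in lie_part (D21 zeta) q ->
  op_act (lie_br x y) v =
    op_act x (op_act y v) - (-1) ^+ (p && q) *: op_act y (op_act x v).
Proof.
have actE (P : pred gbasis) (h : gbasis -> K) u :
    op_act (\sum_(c | P c) h c *: gvec K c) u = \sum_(c | P c) h c *: op c u.
  rewrite -[LHS]/(op_actl u _) linear_sum; apply: eq_bigr => c _.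
  by rewrite linearZ /= op_act_gvec.
have act2 (P Q : pred gbasis) (h k : gbasis -> K) : op_act (\sum_(c | P c) h c *: gvec K c)
    (op_act (\sum_(d | Q d) k d *: gvec K d) v) =
    \sum_(c | P c) \sum_(d | Q d) (h c * k d) *: op c (op d v).
  rewrite !actE; apply: eq_bigr => c _.
  rewrite linear_sum scaler_sumr; apply: eq_bigr => d _.
  by rewrite linearZ scalerA.
move=> /D21_part_sumE -> /D21_part_sumE ->.
rewrite !act2 [X in _ - _ *: X]exchange_big scaler_sumr -sumrB.
rewrite -[lie_br _ _]/(D21_br zeta _ _) D21_br_sum2.
rewrite -[LHS]/(op_actl v _) linear_sum; apply: eq_bigr => c /eqP cp.
rewrite linear_sum scaler_sumr -sumrB; apply: eq_bigr => d /eqP dq.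
rewrite linearZ /= D21_br_gvec.
have -> : op_act (\sum_(t <- bracket_table c d) coef zeta t.1 *: gvec K t.2) v =
    \sum_(t <- bracket_table c d) coef zeta t.1 *: op t.2 v.
  rewrite -[LHS]/(op_actl v _) linear_sum; apply: eq_bigr => t _.
  by rewrite linearZ /= op_act_gvec.
rewrite -op_bracket cp dq scalerBr !scalerA; congr (_ - _ *: _).
have mulC (r s t : K) : r * s * t = t * (s * r) by rewrite [RHS]mulrC [s * r]mulrC.
exact: mulC.
Qed.

Definition module_of_operators : lieModule (D21 zeta) :=
  LieModule op_act_linearl op_act_linearr op_act_br.

End ModuleOfOperators.

Section Model.
Variables (K : fieldType) (zeta : K) (mu : weight).

(** The basis contains symbols with negative exponents, and lists that are not
    increasing products.  The former do no harm because the rules are polynomial in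
    the exponents; all operators kill the latter.  The Verma module is mapped into
    the span of the other symbols. *)
Definition model_space : lmodType K := {malg K[pbw_index]}.
Definition pbw (x : pbw_index) : model_space := << x >>.

Definition model_op (b : gbasis) : {linear model_space -> model_space} :=
  malg_lift (V := model_space)
    (fun x => vec_val pbw (point zeta mu x.1) x.1 (act_table b x.2)).

Lemma model_straightens b : straightens zeta mu pbw b (model_op b).
Proof. by move=> x; rewrite /model_op /= malg_liftU scale1r. Qed.

Lemma act_table_out b S : S \notin odd_subsets -> act_table b S = [::].
Proof.
move=> hS; have bn : (index b all_gbasis < size all_gbasis)%N.
  by rewrite index_mem mem_all_gbasis.
have := all_nthP [::] (isT : all (fun r => size r == size odd_subsets) pbw_table) _ bn.
by move/eqP => sz; rewrite /act_table nth_default // sz leqNgt index_mem.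
Qed.

Lemma model_ext (f g : model_space -> model_space) : linear f -> linear g ->
  (forall x, f (pbw x) = g (pbw x)) -> f =1 g.
Proof.
move=> lf lg fg v.
pose f' : {linear model_space -> model_space} :=
  HB.pack f (GRing.isLinear.Build K model_space model_space *:%R f lf).
pose g' : {linear model_space -> model_space} :=
  HB.pack g (GRing.isLinear.Build K model_space model_space *:%R g lg).
rewrite -[f v]/(f' v) -[g v]/(g' v) [v](malg_sum (v : {malg K[pbw_index]})).
rewrite (linear_sum f') (linear_sum g').
by apply: eq_bigr => x _; rewrite !linearZ /= fg.
Qed.

Lemma defect0 a b S : S \in odd_subsets -> bracket_defect a b S = [::].
Proof.
move=> hS; apply/nilP; have /allP/(_ a (mem_all_gbasis a)) := bracket_defect0.
by move/allP/(_ b (mem_all_gbasis b))/allP/(_ S hS).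
Qed.

(** On a symbol with exponents [k] the relation is the value of [bracket_defect0]
    at [k], [zeta] and [mu]. *)
Lemma model_bracket a b v :
  model_op a (model_op b v) -
    (-1) ^+ (bparity a && bparity b) *: model_op b (model_op a v) =
  \sum_(t <- bracket_table a b) coef zeta t.1 *: model_op t.2 v.
Proof.
set s := (-1) ^+ _; move: v; apply: model_ext => [c u w|c u w|x].
- by rewrite !linearP /= addrACA scalerBr scalerN.
- rewrite scaler_sumr -big_split; apply: eq_bigr => t _ /=.
  by rewrite linearP scalerDr !scalerA mulrC.
case: x => k S; have [hS|hS] := boolP (S \in odd_subsets); last first.
  have op0 d : model_op d (pbw (k, S)) = 0.
    by rewrite model_straightens act_table_out // vec_val_nil.
  rewrite !op0 (linear0 (model_op a)) (linear0 (model_op b)) scaler0 subr0 big1 // => t _.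
  by rewrite op0 scaler0.
have gen := generic_point zeta mu k.
have := congr1 (vec_val pbw (point zeta mu k) k) (defect0 a b hS).
rewrite vec_val_nil /bracket_defect !vec_valD vec_valZ vec_val_sum big_map.
rewrite !(vec_actE _ (model_straightens _) gen) vec_val_unit exps_add0 big_map.
rewrite poly_val_int addrA => /eqP; rewrite addr_eq0 => /eqP e0.
transitivity (model_op a (model_op b (pbw (k, S))) +
  (if bparity a && bparity b then 1 else -1)%:~R *: model_op b (model_op a (pbw (k, S)))).
  by rewrite /s; case: (_ && _); rewrite ?scaleN1r ?scale1r // opprK.
rewrite e0 -sumrN; apply: eq_bigr => t _ /=.
rewrite vec_valZ poly_valN poly_val_coef (vec_actE _ (model_straightens _) gen).
by rewrite vec_val_unit exps_add0 scaleNr opprK.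
Qed.

Definition model : lieModule (D21 zeta) := module_of_operators model_bracket.

Lemma model_act b v : act (gvec K b : D21 zeta) (v : model) = model_op b v.
Proof. exact: op_act_gvec. Qed.

Lemma pbw_coef x y : mcoeff y (pbw x) = (x == y)%:R.
Proof. by rewrite /pbw mcoeffU. Qed.

End Model.

#[global] Opaque pbw.

(** * Words in the root vectors *)

Definition raising (b : gbasis) : bool :=
  match b with
  | inl (inl _) => false
  | inl (inr (_, e)) => e
  | inr (e, _, _) => e
  end.

Lemma wt_inj x y z x' y' z' : wt x y z = wt x' y' z' -> [/\ x = x', y = y' & z = z'].
Proof.
by move/rowP => h; have := h 0; have := h 1; have := h 2; rewrite !mxE /= => -> -> ->.
Qed.

Lemma wt_eta (mu : weight) : mu = wt (mu 0 0) (mu 0 1) (mu 0 2).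
Proof.
by apply/rowP; apply: (@ord3P (fun i => mu 0 i = wt _ _ _ 0 i)); rewrite mxE.
Qed.

Lemma raisingP b : (bweight b \in positive_roots) = raising b.
Proof.
have pos : positive_roots = [seq wt t.1.1 t.1.2 t.2 | t <-
  [:: (2 : int, 0 : int, 0 : int); (0, 2, 0); (0, 0, 2); (1, 1, 1); (1, 1, -1); (1, -1, 1); (1, -1, -1)]] by [].
have winj : injective (fun t : int * int * int => wt t.1.1 t.1.2 t.2).
  by move=> [[? ?] ?] [[? ?] ?] /= /wt_inj[-> -> ->].
rewrite [bweight b]wt_eta pos.
rewrite -[wt _ _ _]/((fun t : int * int * int => wt t.1.1 t.1.2 t.2)
  (bweight b 0 0, bweight b 0 1, bweight b 0 2)) (mem_map winj).
by case: b => [[i|[i []]]|[[[] []] []]]; rewrite !mxE //;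
   move: i; apply: ord3P.
Qed.

Section Words.
Variables (K : fieldType) (zeta : K) (M : lieModule (D21 zeta)).
Implicit Types (m : M) (w : seq gbasis) (b : gbasis).

Definition gact b m : M := act (gvec K b : D21 zeta) m.
HB.instance Definition _ b := GRing.isLinear.Build K M M *:%R (gact b)
  (act_linearr (gvec K b : D21 zeta)).

Definition word_act w m : M := foldr gact m w.

Lemma word_act_linear w : linear (word_act w).
Proof. by elim: w => [|b w IH] c u v //=; rewrite IH linearP. Qed.
HB.instance Definition _ w := GRing.isLinear.Build K M M *:%R (word_act w)
  (word_act_linear w).

Lemma word_act_cat w w' m : word_act (w ++ w') m = word_act w (word_act w' m).
Proof. exact: foldr_cat. Qed.

Lemma act_sum I (r : seq I) (P : pred I) (F : I -> K) (G : I -> D21 zeta) m :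
  act (\sum_(i <- r | P i) F i *: G i) m = \sum_(i <- r | P i) F i *: act (G i) m.
Proof.
pose f : {linear D21 zeta -> M} := HB.pack ((@act _ _ M)^~ m)
  (GRing.isLinear.Build K (D21 zeta) M *:%R _ (act_linearl m)).
rewrite -[LHS]/(f _) linear_sum; apply: eq_bigr => i _; exact: linearZ.
Qed.

Lemma act_gvec_sum (x : D21 zeta) m :
  act x m = \sum_b (x : D21_space K) b *: gact b m.
Proof. by rewrite {1}[x](gvec_sum (x : D21_space K)) act_sum. Qed.

Lemma gact_bracket a b m :
  gact a (gact b m) - (-1) ^+ (bparity a && bparity b) *: gact b (gact a m) =
  \sum_(t <- bracket_table a b) coef zeta t.1 *: gact t.2 m.
Proof.
have part d : (gvec K d : D21 zeta) \in lie_part (D21 zeta) (bparity d) := gvec_part K d.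
rewrite /gact -(act_br _ (part a) (part b)).
rewrite -[lie_br _ _]/(D21_br zeta _ _) D21_br_gvec.
exact: act_sum.
Qed.

Lemma act_n_plus (B : {pred M}) m : submod_closed B ->
  (forall x, x \in n_plus zeta -> act x m \in B) <->
  (forall b, raising b -> gact b m \in B).
Proof.
move=> [B0 Bl]; split=> [h b br|h x].
  by apply: h; rewrite /n_plus memv_span // image_f // inE raisingP.
set s := [seq gvec K b | b in [pred c | bweight c \in positive_roots]] => xs.
rewrite (coord_span (X := in_tuple s) xs) act_sum.
elim/big_ind: _ => // [u v Bu Bv|i _]; first by rewrite -[u]scale1r Bl.
rewrite -[_ *: _]addr0; apply: Bl => //.
have /mapP[b] := mem_nth 0 (ltn_ord i : (i < size (in_tuple s))%N).
by rewrite mem_enum inE raisingP => /h hb ->.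
Qed.

End Words.

(** * Straightening words *)

Definition lows : seq gbasis := low0 :: map lower_odd all_odd ++ [:: bE 1 false; bE 2 false].

Definition opposite (b : gbasis) : gbasis :=
  match b with
  | inl (inl i) => bH i
  | inl (inr (i, e)) => bE i (~~ e)
  | inr (x, y, z) => bO (~~ x, ~~ y, ~~ z)
  end.

Definition pbw_order : seq gbasis :=
  lows ++ [:: bH 0; bH 1; bH 2] ++ map opposite lows.
Definition rank (b : gbasis) : nat := index b pbw_order.

Lemma mem_pbw_order b : b \in pbw_order.
Proof.
by case: b => [[[[|[|[|]]]]|[[[|[|[|]]]] ? []]]|[[[] []] []]].
Qed.

Definition pbw_step (a b : gbasis) : bool :=
  (rank a < rank b)%N || ((a == b) && ~~ bparity a).

Section Closure.
Variables (K : fieldType) (zeta : K) (M : lieModule (D21 zeta)).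
Hypothesis two_neq0 : 2%:R != 0 :> K.
Variables (Q : M -> Prop) (m : M).
Hypothesis Q0 : Q 0.
Hypothesis Ql : forall c u v, Q u -> Q v -> Q (c *: u + v).

Lemma closed_scale c u : Q u -> Q (c *: u).
Proof. by move=> Qu; rewrite -[_ *: _]addr0; apply: Ql. Qed.

Lemma closed_add u v : Q u -> Q v -> Q (u + v).
Proof. by move=> Qu Qv; rewrite -[u]scale1r; apply: Ql. Qed.

Lemma closed_sum I (r : seq I) (F : I -> M) : (forall i, Q (F i)) -> Q (\sum_(i <- r) F i).
Proof. by move=> h; apply: big_ind => // ? ?; apply: closed_add. Qed.

Section Shorter.
Variable n : nat.
Hypothesis shorter : forall w, (size w < n)%N -> Q (word_act w m).

Lemma closed_swap p a b w : size (p ++ a :: b :: w) = n ->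
  Q (word_act (p ++ a :: b :: w) m) -> Q (word_act (p ++ b :: a :: w) m).
Proof.
move=> sz Qab; have := gact_bracket b a (word_act w m).
move/(canRL (subrK _)) => /= e.
rewrite word_act_cat /= e linearD linear_sum linearZ /=.
apply: closed_add; last by apply: closed_scale; rewrite word_act_cat in Qab.
apply: closed_sum => t; rewrite linearZ /=; apply: closed_scale.
rewrite -[gact _ _]/(word_act (t.2 :: w) m) -word_act_cat; apply: shorter.
by rewrite -sz !size_cat /= !addnS.
Qed.

Lemma closed_front p u a v : size (p ++ u ++ a :: v) = n ->
  Q (word_act (p ++ u ++ a :: v) m) -> Q (word_act (p ++ a :: u ++ v) m).
Proof.
elim: u p => [|c u IH] p //= sz Quv; apply: closed_swap.
  by rewrite -sz !size_cat /= !size_cat /= !addnS.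
by rewrite -cat_rcons; apply: IH; rewrite cat_rcons.
Qed.

Lemma closed_perm p w w' : size (p ++ w) = n -> perm_eq w w' ->
  Q (word_act (p ++ w) m) -> Q (word_act (p ++ w') m).
Proof.
elim: w' w p => [|a w' IHw] w p sz ww'; first by rewrite (perm_nilP ww').
have aw : a \in w by rewrite (perm_mem ww') mem_head.
case/splitPr: aw sz ww' => [u v] sz ww' /(closed_front sz).
rewrite -!cat_rcons; apply: IHw.
  by rewrite -sz cat_rcons !size_cat /= !size_cat /= !addnS.
by rewrite -(perm_cons a) -(permPr ww') -cat1s -[_ :: v]cat1s perm_catCA.
Qed.

Lemma closed_square p a w : bparity a -> (size (p ++ a :: a :: w) <= n)%N ->
  Q (word_act (p ++ a :: a :: w) m).
Proof.
move=> ap sz; have := gact_bracket a a (word_act w m).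
rewrite ap /= expr1 scaleN1r opprK -mulr2n -scaler_nat => e.
have {}e : gact a (gact a (word_act w m)) = 2^-1 *:
    \sum_(t <- bracket_table a a) coef zeta t.1 *: gact t.2 (word_act w m).
  by rewrite -e scalerA mulVf // scale1r.
rewrite word_act_cat /= e linearZ linear_sum /=; apply: closed_scale.
apply: closed_sum => t; rewrite linearZ /=; apply: closed_scale.
rewrite -[gact _ _]/(word_act (t.2 :: w) m) -word_act_cat; apply: shorter.
by apply: leq_trans sz; rewrite !size_cat /= !addnS.
Qed.

End Shorter.

(** Modulo shorter words the letters of a word may be permuted, and two equal
    odd letters side by side are half of a bracket. *)
Lemma pbw_closed : (forall w, sorted pbw_step w -> Q (word_act w m)) ->
  forall w, Q (word_act w m).
Proof.
move=> std w; have [n] := ubnP (size w); elim: n w => // n IH w szw.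
pose leb a b := (rank a <= rank b)%N.
apply: (@closed_perm (size w) _ [::] (sort leb w) w) => //=.
- by move=> w' lw; apply: IH; apply: leq_trans lw _.
- by rewrite size_sort.
- by rewrite perm_sort.
have : sorted leb (sort leb w) by apply: sort_sorted => a b; apply: leq_total.
have : (size (sort leb w) <= n)%N by rewrite size_sort.
move: (sort leb w) {szw} => {}w szw sw.
have [/std //|] := boolP (sorted pbw_step w).
have : exists p a v, [/\ bparity a & w = p ++ a :: a :: v] \/ sorted pbw_step w.
  case: w sw szw => [|a w] /=; first by exists [::], (bE 0 true), [::]; right.
  elim: w a => [|b w IHw] a /=; first by exists [::], a, [::]; right.
  move=> /andP[ab bw] szw.
  have [p [c [v [[cp e]|st]]]] := IHw b bw (ltnW szw).
    by exists (a :: p), c, v; left; split; rewrite // e.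
  have [stp|] := boolP (pbw_step a b); first by exists [::], a, [::]; right.
  rewrite negb_or negb_and negbK -leqNgt => /andP[ba].
  have -> : a = b.
    have : rank a = rank b by apply/eqP; rewrite eqn_leq [(_ <= _)%N]ab ba.
    by move/(congr1 (nth a pbw_order)); rewrite !nth_index ?mem_pbw_order.
  by rewrite eqxx => ap; exists [::], b, w; left.
case=> p [a [v [[ap wE]|->]]] // _.
rewrite wE in szw *; apply: (@closed_square (size (p ++ a :: a :: v))) => // w' lw.
by apply: IH; apply: leq_trans lw szw.
Qed.

End Closure.

(** * Standard words *)

Definition cartan (b : gbasis) : bool := if b is inl (inl _) then true else false.

Lemma all_pbw_order (P : pred gbasis) : all P pbw_order -> forall b, P b.
Proof. by move=> /allP h b; apply: h; apply: mem_pbw_order. Qed.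

Lemma pbw_stepW a b : pbw_step a b -> (rank a <= rank b)%N.
Proof. by case/orP => [/ltnW //|/andP[/eqP->]]. Qed.

Lemma rank_low b : (b \in lows) = (rank b < 7)%N.
Proof. by apply/eqP; move: b; apply: all_pbw_order. Qed.

Lemma rank_cartan b : cartan b = (7 <= rank b < 10)%N.
Proof. by apply/eqP; move: b; apply: all_pbw_order. Qed.

Lemma rank_raising b : raising b = (10 <= rank b)%N.
Proof. by apply/eqP; move: b; apply: all_pbw_order. Qed.

Lemma raising_opposite b : raising b = (opposite b \in lows).
Proof. by apply/eqP; move: b; apply: all_pbw_order. Qed.

Lemma opposite_step a b : raising a -> raising b ->
  pbw_step a b = pbw_step (opposite a) (opposite b).
Proof.
have h : all (fun a => all (fun b => raising a ==> raising b ==>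
    (pbw_step a b == pbw_step (opposite a) (opposite b))) pbw_order) pbw_order by [].
move=> ar br; have /all_pbw_order/(_ b) := all_pbw_order h a.
by rewrite ar br => /eqP.
Qed.

Lemma standard_split w : sorted pbw_step w ->
  exists wl wh wr, [/\ w = wl ++ wh ++ wr, all (mem lows) wl, all cartan wh,
    all raising wr & sorted pbw_step wl /\ sorted pbw_step wr].
Proof.
elim: w => [|a w IH] /= sw; first by exists [::], [::], [::].
have [wl [wh [wr [wE lo ca ra [sl sr]]]]] := IH (path_sorted sw).
have cmp b w' : w = b :: w' -> (rank a <= rank b)%N.
  by move=> e; move: sw; rewrite e /= => /andP[/pbw_stepW].
have [al|] := boolP (a \in lows).
  exists (a :: wl), wh, wr; split; rewrite /= ?wE ?al //; split=> //.
  by case: (wl) sw wE sl => //= b v sw e -> ; move: sw; rewrite e /= => /andP[->].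
rewrite rank_low -leqNgt => a7.
case: wl wE lo sl => [|b wl] wE lo sl; last first.
  by move: (leq_trans a7 (cmp _ _ wE)) lo; rewrite /= rank_low => ? /andP[]; lia.
have [ah|ah] := boolP (cartan a).
  by exists [::], (a :: wh), wr; split; rewrite /= ?wE ?ah.
rewrite rank_cartan a7 /= -leqNgt in ah.
case: wh wE ca => [|b wh] wE ca; last first.
  by move: (leq_trans ah (cmp _ _ wE)) ca; rewrite /= rank_cartan => ? /andP[]; lia.
exists [::], [::], (a :: wr); split; rewrite /= ?wE ?rank_raising ?ah //; split=> //.
by rewrite wE /= in sw.
Qed.

Definition low_index := ((nat * nat * nat) * seq (bool * bool))%type.

Definition low_word (x : low_index) : seq gbasis :=
  nseq x.1.1.1 low0 ++ map lower_odd x.2 ++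
  nseq x.1.1.2 (bE 1 false) ++ nseq x.1.2 (bE 2 false).

(** An odd letter cannot be repeated in a standard word. *)
Lemma low_wordP w : sorted pbw_step w -> all (mem lows) w ->
  exists2 x, x.2 \in odd_subsets & w = low_word x.
Proof.
elim: w => [|b w IH] /= sw; first by exists (0%N, 0%N, 0%N, [::]).
case/andP => bl /(IH (path_sorted sw))[[[[k0 k1] k2] S] /= hS wE].
have {}sw c w' : w = c :: w' -> pbw_step b c by move=> e; move: sw; rewrite e /= => /andP[].
move: bl; rewrite !inE => /orP[/eqP->|].
  by exists (k0.+1, k1, k2, S); rewrite // wE.
move=> bl; have k00 : k0 = 0%N.
  case: k0 wE => // k0 /sw; rewrite /pbw_step.
  by move: bl => /orP[|/orP[|/orP[|/orP[|/orP[|]]]]] /eqP ->.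
subst k0; have [bo|be] := boolP (bparity b).
  have [a ab] : exists a, b = lower_odd a.
    by move: bl bo => /orP[|/orP[|/orP[|/orP[|/orP[|]]]]] /eqP -> // _;
      [exists (true, true) | exists (true, false) | exists (false, true) | exists (false, false)].
  exists (0%N, k1, k2, a :: S); last by rewrite wE ab.
  have {sw} : (if S is c :: _ then pbw_step (lower_odd a) (lower_odd c) else true) = true.
    by case: S wE {hS} => // c S /sw; rewrite ab.
  have h : all (fun S => all (fun a => (if S is c :: _ then pbw_step (lower_odd a) (lower_odd c)
    else true) ==> (a :: S \in odd_subsets)) all_odd) odd_subsets by [].
  have ain : a \in all_odd by case: (a) => [[] []].
  by move/implyP: (allP (allP h S hS) a ain); apply.
have S0 : S = [::].
  case: S wE {hS} => // c S /sw; rewrite /pbw_step.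
  by move: bl be => /orP[|/orP[|/orP[|/orP[|/orP[|]]]]] /eqP -> //= _;
    case: c => [[] []].
subst S; have /orP[/eqP be1|/eqP be2] : (b == bE 1 false) || (b == bE 2 false).
  by move: bl be => /orP[|/orP[|/orP[|/orP[|/orP[|]]]]] /eqP -> //=.
  by exists (0%N, k1.+1, k2, [::]); rewrite // wE be1.
exists (0%N, 0%N, k2.+1, [::]); rewrite // wE be2.
by case: k1 wE => // k1 /sw; rewrite be2.
Qed.

(** * The universal property of Verma modules *)

Section TensorAction.
Variables (K : fieldType) (zeta : K) (M : lieModule (D21 zeta)).
Local Notation T := (tensor_algebra K).

Definition tensor_act (m : M) : T -> M :=
  locked (malg_lift (fun w : {fmonom gbasis} => word_act w m)).

Lemma tensor_act_linear m : linear (tensor_act m).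
Proof. rewrite /tensor_act -lock; exact: malg_lift_linear. Qed.

HB.instance Definition _ m := GRing.isLinear.Build K T M *:%R (tensor_act m)
  (tensor_act_linear m).

Lemma tensor_act0 m : tensor_act m 0 = 0.
Proof. exact: linear0. Qed.

Lemma tensor_actB m s t : tensor_act m (s - t) = tensor_act m s - tensor_act m t.
Proof. exact: linearB. Qed.

Lemma tensor_actZ m c t : tensor_act m (c *: t) = c *: tensor_act m t.
Proof. exact: linearZ_LR. Qed.

Lemma tensor_act_sum m I (r : seq I) (F : I -> T) :
  tensor_act m (\sum_(i <- r) F i) = \sum_(i <- r) tensor_act m (F i).
Proof. exact: linear_sum. Qed.

Lemma tensor_actE m t : tensor_act m t = \sum_(w <- msupp t) t@_w *: word_act w m.
Proof. by rewrite /tensor_act -lock. Qed.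

Lemma tensor_actU m w c : tensor_act m << c *g w >> = c *: word_act w m.
Proof. by rewrite /tensor_act -lock malg_liftU. Qed.

Lemma tensor_act1 m : tensor_act m 1 = m.
Proof. by rewrite -mpolyC1E tensor_actU scale1r fm1. Qed.

Lemma tensor_actM m s t : tensor_act m (s * t) = tensor_act (tensor_act m t) s.
Proof.
rewrite malgME tensor_act_sum [RHS]tensor_actE; apply: eq_bigr => v _.
rewrite tensor_act_sum (tensor_actE m t) linear_sum scaler_sumr.
apply: eq_bigr => w _; rewrite tensor_actU linearZ /= scalerA; congr (_ *: _).
by rewrite fmM word_act_cat.
Qed.

Lemma tensor_act_gen m (x : D21 zeta) : tensor_act m (tensor_gen x) = act x m.
Proof.
rewrite tensor_act_sum act_gvec_sum; apply: eq_bigr => b _.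
by rewrite tensor_actU fmuE.
Qed.

Lemma tensor_act_bracket m (c : K) (x y z : D21 zeta) :
  tensor_act m (tensor_gen x * tensor_gen y - c *: (tensor_gen y * tensor_gen x)
    - tensor_gen z) = act x (act y m) - c *: act y (act x m) - act z m.
Proof.
have comb (r s t : T) : tensor_act m (r - c *: s - t) =
    tensor_act m r - c *: tensor_act m s - tensor_act m t.
  by rewrite !tensor_actB tensor_actZ.
have gen2 (u v : D21 zeta) : tensor_act m (tensor_gen u * tensor_gen v) = act u (act v m).
  rewrite tensor_actM; etransitivity; first exact: tensor_act_gen.
  by congr (act u _); exact: tensor_act_gen.
etransitivity; first exact: comb.
by congr (_ - _ *: _ - _); [exact: gen2|exact: gen2|exact: tensor_act_gen].
Qed.

Variables (B : {pred M}) (mu : weight) (m : M).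
Hypothesis BN : is_submodule B.

Lemma submod_word w u : u \in B -> word_act w u \in B.
Proof. by move=> Bu; elim: w => //= b w; apply: BN.2. Qed.

Lemma submod_tensor t u : u \in B -> tensor_act u t \in B.
Proof.
move=> Bu; have [[B0 Bl] _] := BN; rewrite tensor_actE.
elim/big_ind: _ => // [v w Bv Bw|w _]; first by rewrite -[v]scale1r Bl.
by rewrite -[_ *: _]addr0; apply: Bl => //; apply: submod_word.
Qed.

(** A highest weight vector of the quotient by [B]. *)
Definition singular_mod :=
  (forall x, x \in n_plus zeta -> act x m \in B) /\
  (forall i, gact (bH i) m - (mu 0 i)%:~R *: m \in B).

(** By induction on the relation: this is why a highest weight vector generates a
    quotient of a Verma module. *)
Lemma verma_relation_mod t : singular_mod -> verma_relation zeta mu t ->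
  tensor_act m t \in B.
Proof.
case=> mn mh; have [[B0 Bl] _] := BN.
elim=> {t} [|c s t _ Bs _ Bt|p q x y s t xp yq|s x xn|s i].
- by rewrite tensor_act0.
- by rewrite tensor_act_linear; apply: Bl.
- rewrite (tensor_actM m _ t) (tensor_actM _ s).
  move: (tensor_act m t) => u.
  suff -> : tensor_act u (tensor_gen x * tensor_gen y -
      (-1) ^+ (p && q) *: (tensor_gen y * tensor_gen x) - tensor_gen (lie_br x y)) = 0.
    exact: submod_tensor.
  etransitivity; first exact: tensor_act_bracket.
  by rewrite (act_br _ xp yq) subrr.
- by rewrite (tensor_actM _ s) tensor_act_gen; apply: submod_tensor; apply: mn.
- rewrite (tensor_actM _ s) tensor_actB tensor_actZ tensor_act_gen tensor_act1.
  by apply: submod_tensor; apply: mh.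
Qed.

End TensorAction.

Section VermaGenerator.
Variables (K : fieldType) (zeta : K) (mu : weight).
Local Notation V := (verma_module zeta mu).
Local Notation Q := (quot (verma_subspace zeta mu)).

Definition verma_gen : V := \pi_Q 1.

Lemma verma_act_pi (x : D21 zeta) (t : tensor_algebra K) :
  act x (\pi_Q t : V) = \pi_Q (tensor_gen x * t) :> V.
Proof.
exact: (quot_opE (@tensor_op_linearr K zeta) (@tensor_op_stable K zeta mu)).
Qed.

Lemma tensor_gen_gvec b : tensor_gen (gvec K b : D21 zeta) = << fmu b >>.
Proof.
rewrite /tensor_gen (bigD1 b) //= big1 => [|c /negbTE cb].
  by rewrite addr0 ffunE eqxx.
by rewrite ffunE eq_sym cb monalgU0.
Qed.

Lemma verma_pi_word (w : seq gbasis) :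
  \pi_Q << FMonom w >> = word_act w verma_gen :> V.
Proof.
elim: w => [|b w IH] /=.
  rewrite /verma_gen -mpolyC1E; congr (\pi_Q << _ >>).
  by apply: val_inj; rewrite /= fm1.
rewrite /gact -IH; transitivity (\pi_Q (tensor_gen (gvec K b : D21 zeta) * << FMonom w >>) : V);
  last exact: esym (verma_act_pi _ _).
rewrite tensor_gen_gvec malgM_def fgmulUU mulr1.
by congr (\pi_Q << _ >>); apply: val_inj; rewrite /= fmM fmuE.
Qed.

Lemma verma_pi (t : tensor_algebra K) : \pi_Q t = tensor_act verma_gen t :> V.
Proof.
rewrite {1}[t](malg_sum t) tensor_actE.
have pi0 : \pi_Q 0 = 0 :> Q by apply: (addrI (\pi_Q 0)); rewrite -quot_piD !addr0.
rewrite (big_morph (fun t => \pi_Q t : Q) (id1 := 0) (op1 := +%R) _ pi0); last first.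
  by move=> s u; apply: quot_piD.
apply: eq_bigr => w _; rewrite quot_piZ; congr (_ *: _).
by rewrite -verma_pi_word; congr (\pi_Q << _ >>); apply: val_inj.
Qed.

Lemma verma_tensor (v : V) : exists t, v = tensor_act verma_gen t.
Proof. by exists (repr v); rewrite -verma_pi reprK. Qed.

Lemma verma_pi0 t : (tensor_act verma_gen t = 0) <-> verma_relation zeta mu t.
Proof.
rewrite -verma_pi; have -> : (0 : V) = \pi_Q 0 by rewrite verma_pi tensor_act0.
split => [/quot_piP|h]; first by rewrite subr0 => /asboolP.
by apply/quot_piP; rewrite subr0; apply/asboolP.
Qed.

Lemma verma_gen_singular : singular_mod (pred1 0) mu verma_gen.
Proof.
split=> [x xn|i]; rewrite inE.
  rewrite -tensor_act_gen; apply/eqP/verma_pi0.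
  by rewrite -[tensor_gen x]mul1r; apply: VermaNilpotent.
apply/eqP; have := VermaCartan zeta mu 1 i; rewrite mul1r => /verma_pi0.
by rewrite tensor_actB tensor_act_gen tensor_actZ tensor_act1.
Qed.

(** This does not depend on the representative if [m] is a highest weight vector of
    weight [mu]. *)
Definition verma_lift (M : lieModule (D21 zeta)) (m : M) (v : V) : M :=
  tensor_act m (repr v).

End VermaGenerator.

Section VermaLift.
Variables (K : fieldType) (zeta : K) (mu : weight) (M : lieModule (D21 zeta)) (m : M).
Hypothesis m_singular : singular_mod (pred1 0) mu m.
Local Notation lift := (@verma_lift K zeta mu M m).

Lemma zero_submodule : is_submodule (pred1 (0 : M)).
Proof.
split=> [|x v]; first split=> [|c u v]; rewrite !inE //.
  by move=> /eqP-> /eqP->; rewrite scaler0 addr0.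
move=> /eqP->; have := act_linearr (l := M) x (-1) 0 0.
by rewrite scaler0 addr0 scaleN1r addNr => ->.
Qed.

Lemma verma_liftE t : lift (tensor_act (verma_gen zeta mu) t) = tensor_act m t.
Proof.
apply/eqP; rewrite -subr_eq0 -tensor_actB.
have := verma_relation_mod zero_submodule m_singular (t := repr (tensor_act (verma_gen zeta mu) t) - t).
apply; apply/verma_pi0; rewrite tensor_actB -verma_pi reprK.
by rewrite subrr.
Qed.

Lemma verma_lift_linear : linear lift.
Proof.
move=> c u v; have [s ->] := verma_tensor u; have [t ->] := verma_tensor v.
by rewrite -tensor_act_linear !verma_liftE tensor_act_linear.
Qed.

Lemma verma_lift_gen : lift (verma_gen zeta mu) = m.
Proof. by have := verma_liftE 1; rewrite !tensor_act1. Qed.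

Lemma verma_lift_act x v : lift (act x v) = act x (lift v).
Proof.
have [t ->] := verma_tensor v.
by rewrite -tensor_act_gen -tensor_actM !verma_liftE tensor_actM tensor_act_gen.
Qed.

End VermaLift.

(** * Weights and the straightened basis *)

Section Weights.
Variables (K : fieldType) (zeta : K) (M : lieModule (D21 zeta)).
Implicit Types (m : M) (nu : weight).

Definition word_weight (w : seq gbasis) : weight := \sum_(b <- w) bweight b.

Lemma word_weight_cons b w : word_weight (b :: w) = bweight b + word_weight w.
Proof. exact: big_cons. Qed.

Lemma actZl c (x : D21 zeta) m : act (c *: x) m = c *: act x m.
Proof.
have := act_sum [:: tt] xpredT (fun _ => c) (fun _ => x) m.
by rewrite !big_seq1.
Qed.

Lemma weight_vector_gact nu b m : weight_vector nu m ->
  weight_vector (bweight b + nu) (gact b m).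
Proof.
move=> mnu i.
have part c : (gvec K c : D21 zeta) \in lie_part (D21 zeta) (bparity c) := gvec_part K c.
have := act_br m (part (bH i)) (part b); rewrite /= expr0 scale1r.
rewrite gvec_weight actZl => /eqP.
rewrite eq_sym subr_eq => /eqP e; rewrite /gact e mnu !mxE intrD scalerDl.
by congr (_ + _); rewrite -[act _ _]/(gact b _) linearZ.
Qed.

Lemma weight_vector_word nu w m : weight_vector nu m ->
  weight_vector (word_weight w + nu) (word_act w m).
Proof.
move=> mnu; elim: w => [|b w IH] /=; first by rewrite /word_weight big_nil add0r.
by rewrite word_weight_cons -addrA; apply: weight_vector_gact.
Qed.

Lemma weight_vector_linear nu c u v : weight_vector nu u -> weight_vector nu v ->
  weight_vector nu (c *: u + v : M).
Proof.
by move=> hu hv i; rewrite act_linearr hu hv scalerDr !scalerA mulrC.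
Qed.

End Weights.

Section ModelGenerator.
Variables (K : fieldType) (zeta : K) (mu : weight).
Local Notation model := (model zeta mu).

(** The exponents vanish at the highest weight vector; the weight stays symbolic. *)
Definition origin : seq zpoly :=
  [:: pzeta; [::]; [::]; [::]; pmu 0; pmu 1; pmu 2].

Lemma origin_point : [seq poly_val (point zeta mu 0) p | p <- origin] = point zeta mu 0.
Proof.
rewrite /point /origin /pzeta /pmu /poly_var /= !poly_val_cons !poly_val_nil /=.
by rewrite !expr0 !expr1 !mul1r !mulr1 !addr0.
Qed.

Lemma model_gact b v : gact b (v : model) = model_op zeta mu b v.
Proof. exact: model_act. Qed.

Lemma model_raising0 b : raising b -> gact b (pbw K (0, [::]) : model) = 0.
Proof.
have h : all (fun b => raising b ==> nilp (vec_act origin b (unit_vec (0, [::])))) pbw_order.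
  by vm_compute.
move=> br; have /implyP/(_ br)/nilP e := all_pbw_order h b.
have := vec_actE (unit_vec (0, [::])) (model_straightens zeta mu b) origin_point.
by rewrite e vec_val_nil vec_val_unit exps_add0 model_gact => <-.
Qed.

Lemma model_op_cartan0 i :
  model_op zeta mu (bH i) (pbw K (0, [::])) = (mu 0 i)%:~R *: pbw K (0, [::]).
Proof.
have := vec_actE (unit_vec (0, [::])) (model_straightens zeta mu (bH i)) origin_point.
rewrite vec_val_unit exps_add0 => <-.
have -> : vec_act origin (bH i) (unit_vec (0, [::])) = [:: (pmu i, (0, [::]))].
  by move: i; apply: ord3P; vm_compute.
have -> : (mu 0 i)%:~R = poly_val (point zeta mu 0) (pmu i).
  by move: i; apply: ord3P; rewrite poly_val_cons poly_val_nil /=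
    !expr0 !expr1 !mul1r !mulr1 addr0.
by rewrite vec_val_seq1 exps_add0.
Qed.

Lemma model_cartan0 i :
  gact (bH i) (pbw K (0, [::]) : model) = (mu 0 i)%:~R *: pbw K (0, [::]).
Proof. by rewrite model_gact model_op_cartan0. Qed.

Lemma model_singular : singular_mod (pred1 0) mu (pbw K (0, [::]) : model).
Proof.
split=> [|i]; last by rewrite model_cartan0 subrr inE.
have [B0 _] := zero_submodule model.
by apply/(act_n_plus _ B0) => b /model_raising0 ->; rewrite inE.
Qed.

Definition embed_index (x : low_index) : pbw_index :=
  ((x.1.1.1%:Z, x.1.1.2%:Z, x.1.2%:Z), x.2).

Lemma model_unit b S d T k : act_table b S = unit_vec (d, T) ->
  gact b (pbw K (k, S) : model) = pbw K (exps_add k d, T).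
Proof. by move=> e; rewrite model_gact model_straightens e vec_val_unit. Qed.

(** Lowering words in standard order act without corrections, so their values at
    the generator are distinct basis vectors. *)
Lemma model_low_word x : x.2 \in odd_subsets ->
  word_act (low_word x) (pbw K (0, [::]) : model) = pbw K (embed_index x).
Proof.
have f1 : act_table (bE 1 false) [::] = unit_vec ((0, 1, 0), [::]) by vm_compute.
have f2 : act_table (bE 2 false) [::] = unit_vec ((0, 0, 1), [::]) by vm_compute.
have -> : (0 : int * int * int) = (0%:Z, 0%:Z, 0%:Z) by [].
case: x => [[[k0 k1] k2] S] /= hS; rewrite /low_word /embed_index /= !word_act_cat.
have -> : word_act (nseq k2 (bE 2 false)) (pbw K ((0%:Z, 0%:Z, 0%:Z), [::]) : model) =
    pbw K ((0%:Z, 0%:Z, k2%:Z), [::]).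
  elim: k2 => [|k IH]; first reflexivity.
  etransitivity; first exact: (congr1 (gact _) IH).
  rewrite (model_unit _ f2) /exps_add /= !addr0 -PoszD addn1; reflexivity.
have -> : word_act (nseq k1 (bE 1 false)) (pbw K ((0%:Z, 0%:Z, k2%:Z), [::]) : model) =
    pbw K ((0%:Z, k1%:Z, k2%:Z), [::]).
  elim: k1 => [|k IH]; first reflexivity.
  etransitivity; first exact: (congr1 (gact _) IH).
  rewrite (model_unit _ f1) /exps_add /= !addr0 -PoszD addn1; reflexivity.
have -> : word_act (map lower_odd S) (pbw K ((0%:Z, k1%:Z, k2%:Z), [::]) : model) =
    pbw K ((0%:Z, k1%:Z, k2%:Z), S).
  elim: S hS => [|a S IH] hS; first reflexivity.
  have h : all (fun S => if S is a :: S' then (S' \in odd_subsets) &&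
     (act_table (lower_odd a) S' == unit_vec (0, S)) else true) odd_subsets by vm_compute.
  have /andP[S'h /eqP t] := allP h _ hS.
  etransitivity; first exact: (congr1 (gact _) (IH S'h)).
  rewrite (model_unit _ t) exps_add0; reflexivity.
have h : all (fun S => act_table low0 S == unit_vec ((1, 0, 0), S)) odd_subsets by vm_compute.
have /eqP f0 := allP h _ hS.
elim: k0 => [|k IH]; first reflexivity.
rewrite -[LHS]/(gact low0 (word_act (nseq k low0) (pbw K ((0%:Z, k1%:Z, k2%:Z), S) : model))) IH.
rewrite (model_unit _ f0) /exps_add /= !addr0 -PoszD addn1; reflexivity.
Qed.

End ModelGenerator.

(** * Highest weight vectors *)

Section Singular.
Variables (K : fieldType) (zeta : K) (M : lieModule (D21 zeta)).
Hypothesis two_neq0 : 2%:R != 0 :> K.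
Variables (B : {pred M}) (mu : weight) (m : M).
Hypothesis BN : is_submodule B.
Hypothesis m_singular : singular_mod B mu m.

Lemma singular_word w : all (fun b => cartan b || raising b) w ->
  exists c, word_act w m - c *: m \in B.
Proof.
have [[B0 Bl] _] := BN; elim: w => [|b w IH] /=.
  by exists 1; rewrite scale1r subrr.
case/andP => bh /IH[c wm]; have := BN.2 (gvec K b : D21 zeta) _ wm.
rewrite -[act _ _]/(gact b _) linearB linearZ /= => bwm.
have [d bm] : exists d, gact b m - d *: m \in B.
  case/orP: bh => [|br].
    by case: b {bwm} => [[i|[]]|[[]]] //= _; exists (mu 0 i)%:~R; apply: m_singular.2.
  exists 0; rewrite scale0r subr0.
  by apply: (act_n_plus m (conj B0 Bl)).1 => //; exact: m_singular.1.
exists (c * d); have := Bl 1 _ _ bwm (Bl c _ _ bm B0).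
by rewrite scale1r addr0 scalerBr scalerA addrA subrK.
Qed.

(** Raising letters kill [m] and Cartan letters scale it, so that only the lowering
    part of a standard word survives. *)
Lemma singular_span (Q : M -> Prop) :
  (forall c u v, Q u -> Q v -> Q (c *: u + v)) -> (forall u, u \in B -> Q u) ->
  (forall x, x.2 \in odd_subsets -> Q (word_act (low_word x) m)) ->
  forall w, Q (word_act w m).
Proof.
move=> Ql BQ lowQ; have Q0 : Q 0 by apply: BQ; have [[]] := BN.
apply: (pbw_closed two_neq0 Q0 Ql) => w /standard_split.
case=> wl [wh [wr [-> lo ca ra [/low_wordP/(_ lo)[x hx ->] _]]]].
have [|c cB] := singular_word (w := wh ++ wr).
  by rewrite all_cat; apply/andP; split; [apply: sub_all ca|apply: sub_all ra] => b ->;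
    rewrite ?orbT.
rewrite word_act_cat -[word_act (wh ++ wr) m](subrK (c *: m)) addrC linearP.
by apply: Ql; [apply: lowQ|apply: BQ; apply: submod_word].
Qed.

End Singular.

(** * The straightened basis of a Verma module *)

Definition odd_drop (S : seq (bool * bool)) : int * int * int :=
  ((size S)%:Z, foldr (fun a n => n - sgn a.1) 0 S, foldr (fun a n => n - sgn a.2) 0 S).

Definition index_drop (x : low_index) : int * int * int :=
  exps_add (odd_drop x.2) (x.1.1.1.*2%:Z, x.1.1.2.*2%:Z, x.1.2.*2%:Z).

Definition wt3 (d : int * int * int) : weight := wt d.1.1 d.1.2 d.2.

Lemma wt3_inj : injective wt3.
Proof. by move=> [[? ?] ?] [[? ?] ?] /wt_inj[/= -> -> ->]. Qed.

Lemma wt3_eta (nu : weight) : nu = wt3 (nu 0 0, nu 0 1, nu 0 2).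
Proof. exact: wt_eta. Qed.

Lemma low_word_weight x : word_weight (low_word x) = - wt3 (index_drop x).
Proof.
have nseqE n b : word_weight (nseq n b) = bweight b *+ n.
  by elim: n => [|n IH]; rewrite /word_weight ?big_nil ?mulr0n //= big_cons mulrS -IH.
have catE u w : word_weight (u ++ w) = word_weight u + word_weight w by exact: big_cat.
case: x => [[[k0 k1] k2] S]; rewrite /low_word /= !catE !nseqE.
have -> : word_weight (map lower_odd S) = - wt3 (odd_drop S).
  elim: S => [|a S IH].
    rewrite /word_weight /odd_drop big_nil; apply/rowP.
    by apply: (@ord3P (fun i => _ 0 i = _ 0 i)); rewrite !mxE.
  rewrite /= word_weight_cons IH /odd_drop /=; apply/rowP.
  by apply: (@ord3P (fun i => _ 0 i = _ 0 i)); rewrite !mxE /= /sg /=; lia.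
apply/rowP; apply: (@ord3P (fun i => _ 0 i = _ 0 i));
  by rewrite !(mxE, mulmxnE) /=; lia.
Qed.

Definition half (n : int) : nat := if n is Posz m then m./2 else 0%N.

(** The odd part determines the exponents, which leaves one candidate for each of
    the sixteen odd monomials. *)
Definition low_indices (d : int * int * int) : seq low_index :=
  [seq x <- [seq (half (d.1.1 - (odd_drop T).1.1), half (d.1.2 - (odd_drop T).1.2),
                  half (d.2 - (odd_drop T).2), T) | T <- odd_subsets] | index_drop x == d].

Lemma mem_low_indices d x :
  (x \in low_indices d) = (x.2 \in odd_subsets) && (index_drop x == d).
Proof.
rewrite mem_filter andbC; case: eqP => [xd|_]; rewrite ?andbF // !andbT.
apply/mapP/idP => [[T TS ->] //|xS]; exists x.2 => //.
have halfK (n : nat) (a : int) : half (a + n.*2%:Z - a) = n.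
  by rewrite addrAC subrr add0r /= doubleK.
by rewrite -xd /index_drop /= !halfK; case: (x) => [[[? ?] ?] ?].
Qed.

Lemma low_indices_uniq d : uniq (low_indices d).
Proof.
by apply: filter_uniq; rewrite map_inj_uniq // => S T [].
Qed.

(** The properties by which Verma modules enter the rest of the argument: they are
    cyclic and free on a highest weight vector, and map to the model, in which the
    lowering words are linearly independent. *)
Record verma_like (K : fieldType) (zeta : K) (mu : weight) (V : lieModule (D21 zeta)) :=
  VermaLike {
    hw_gen : V;
    hw_singular : singular_mod (pred1 0) mu hw_gen;
    hw_generates : forall y, exists t, y = tensor_act hw_gen t;
    hw_free : forall t, tensor_act hw_gen t = 0 -> verma_relation zeta mu t;
    to_model : V -> model zeta mu;
    to_model_linear : linear to_model;
    to_model_gact : forall b y, to_model (gact b y) = gact b (to_model y);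
    to_model_gen : to_model hw_gen = pbw K (0, [::])
  }.

Definition verma_module_like (K : fieldType) (zeta : K) (mu : weight) :
    verma_like mu (verma_module zeta mu) :=
  VermaLike (verma_gen_singular zeta mu) (@verma_tensor K zeta mu)
    (fun t => (verma_pi0 zeta mu t).1) (verma_lift_linear (model_singular zeta mu))
    (fun b y => verma_lift_act (model_singular zeta mu) (gvec K b : D21 zeta) y)
    (verma_lift_gen (model_singular zeta mu)).

Section VermaLike.
Variables (K : fieldType) (zeta : K) (mu : weight) (V : lieModule (D21 zeta)).
Hypothesis int_neq0 : forall n : int, n != 0 -> n%:~R != 0 :> K.
Variable vl : verma_like mu V.
Local Notation v := (hw_gen vl).

Definition low_vec (x : low_index) : V := word_act (low_word x) v.

(** The coordinates of the model, restricted to nonnegative exponents. *)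
Definition vcoord (x : low_index) (y : V) : K := mcoeff (embed_index x) (to_model vl y).

Lemma vcoord_linear x : linear_for *%R (vcoord x).
Proof.
move=> c y z; rewrite /vcoord to_model_linear.
exact: etrans (mcoeffD _ _ _) (congr1 (fun r => r + _) (mcoeffZ _ _ _)).
Qed.
HB.instance Definition _ x := GRing.isLinear.Build K V K *%R (vcoord x) (vcoord_linear x).

Lemma embed_index_inj : injective embed_index.
Proof. by move=> [[[? ?] ?] ?] [[[? ?] ?] ?] [-> -> -> ->]. Qed.

Lemma to_model_word w y : to_model vl (word_act w y) = word_act w (to_model vl y).
Proof. by elim: w => //= b w IH; rewrite to_model_gact IH. Qed.

Lemma to_model_low y : y.2 \in odd_subsets ->
  to_model vl (low_vec y) = pbw K (embed_index y).
Proof. by move=> hy; rewrite to_model_word to_model_gen model_low_word. Qed.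

Lemma vcoord_low x y : y.2 \in odd_subsets -> vcoord x (low_vec y) = (x == y)%:R.
Proof.
by move=> hy; rewrite /vcoord to_model_low // pbw_coef (inj_eq embed_index_inj) eq_sym.
Qed.

(** The lowering words span by [singular_span]. *)
Lemma verma_ind (Q : V -> Prop) : (forall c y z, Q y -> Q z -> Q (c *: y + z)) -> Q 0 ->
  (forall x, x.2 \in odd_subsets -> Q (low_vec x)) -> forall y, Q y.
Proof.
move=> Ql Q0 lowQ y; have [t ->] := hw_generates vl y; rewrite tensor_actE.
have QD a b : Q a -> Q b -> Q (a + b) by move=> Qa; rewrite -[a]scale1r; apply: Ql.
apply: big_ind => // w _; rewrite -[_ *: _]addr0; apply: (Ql) => //.
apply: (singular_span (int_neq0 (n := 2) isT) (zero_submodule V)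
  (hw_singular vl) Ql _ lowQ).
by move=> u /eqP->.
Qed.

Lemma low_vec_weight x : weight_vector (mu - wt3 (index_drop x)) (low_vec x).
Proof.
rewrite addrC -low_word_weight; apply: weight_vector_word => i.
by have [_ /(_ i)/eqP/subr0_eq] := hw_singular vl.
Qed.

(** The list of indices may be enlarged, so that vectors can be expanded over a
    common list. *)
Lemma verma_expand (y : V) : exists2 s : seq low_index,
  uniq s /\ (forall x, x \in s -> x.2 \in odd_subsets) &
  forall s', uniq s' -> {subset s <= s'} -> (forall x, x \in s' -> x.2 \in odd_subsets) ->
    y = \sum_(x <- s') vcoord x y *: low_vec x.
Proof.
elim/verma_ind: y => [c y z [s [us hs] ys] [s' [us' hs'] zs']||x hx].
- exists (undup (s ++ s')); first by split; rewrite ?undup_uniq // => x;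
    rewrite mem_undup mem_cat => /orP[/hs|/hs'].
  move=> s2 us2 sub hs2.
  have sub1 : {subset s <= s2} by move=> x xs; apply: sub; rewrite mem_undup mem_cat xs.
  have sub2 : {subset s' <= s2}.
    by move=> x xs; apply: sub; rewrite mem_undup mem_cat xs orbT.
  transitivity (c *: (\sum_(x <- s2) vcoord x y *: low_vec x) +
      \sum_(x <- s2) vcoord x z *: low_vec x).
    by congr (_ *: _ + _); [apply: ys|apply: zs'].
  rewrite scaler_sumr -big_split; apply: eq_bigr => x _ /=.
  by rewrite vcoord_linear scalerDl scalerA.
- exists [::] => // s' _ _ _; rewrite big1 // => x _.
  by rewrite linear0 scale0r.
exists [:: x]; first by split=> // z; rewrite inE => /eqP->.
move=> s' us' sub hs'; rewrite (bigD1_seq x) //=; last by apply: sub; rewrite mem_head.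
rewrite vcoord_low // eqxx scale1r big1 ?addr0 // => z /negbTE zx.
by rewrite vcoord_low // zx scale0r.
Qed.

Lemma vcoord_ext (y z : V) : (forall x, vcoord x y = vcoord x z) -> y = z.
Proof.
move=> h; apply/eqP; rewrite -subr_eq0; apply/eqP.
have [s [us hs] ys] := verma_expand (y - z).
by rewrite (ys s) // big1 // => x _; rewrite linearB /= h subrr scale0r.
Qed.

End VermaLike.

Arguments verma_ind [K zeta mu V] int_neq0 vl Q.
Arguments verma_expand [K zeta mu V] int_neq0 vl y.

(** * Weight components of submodules *)

Section WeightComponents.
Variables (K : fieldType) (zeta : K) (M : lieModule (D21 zeta)).
Hypothesis int_neq0 : forall n : int, n != 0 -> n%:~R != 0 :> K.
Variable N : {pred M}.
Hypothesis NN : is_submodule N.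

(** For distinct weights, a combination of the identity and a Cartan element that
    is 1 on the weight [nu] and 0 on the weight [nu']. *)
Definition kill_weight (nu nu' : weight) (m : M) : M :=
  if [pick i | nu 0 i != nu' 0 i] is Some i then
    (nu 0 i - nu' 0 i)%:~R^-1 *: (gact (bH i) m - (nu' 0 i)%:~R *: m) else m.

Lemma kill_weight_linear nu nu' : linear (kill_weight nu nu').
Proof.
move=> c u v; rewrite /kill_weight; case: pickP => // i _.
rewrite linearP; set n := (nu' 0 i)%:~R.
have -> : c *: gact (bH i) u + gact (bH i) v - n *: (c *: u + v) =
    c *: (gact (bH i) u - n *: u) + (gact (bH i) v - n *: v).
  by rewrite scalerDr opprD addrACA scalerBr !scalerA [n * c]mulrC.
by rewrite scalerDr !scalerA mulrC.
Qed.

HB.instance Definition _ nu nu' := GRing.isLinear.Build K M M *:%R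
  (kill_weight nu nu') (kill_weight_linear nu nu').

Lemma kill_weight_submod nu nu' m : m \in N -> kill_weight nu nu' m \in N.
Proof.
have [[N0 Nl] Na] := NN => Nm; rewrite /kill_weight; case: pickP => // i _.
rewrite -[_ *: _]addr0; apply: (Nl) => //; rewrite addrC -scaleNr.
by apply: (Nl) => //; apply: Na.
Qed.

Lemma kill_weightE nu nu' m : weight_vector nu m -> nu != nu' -> kill_weight nu nu' m = m.
Proof.
move=> hm neq; rewrite /kill_weight; case: pickP => [i ni|same]; last first.
  by case/eqP: neq; apply/rowP => i; apply/eqP; rewrite -[_ == _]negbK same.
by rewrite /gact hm -scalerBl scalerA -intrB mulVf ?scale1r // int_neq0 // subr_eq0.
Qed.

Lemma kill_weight_scale nu nu' e m : weight_vector e m ->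
  exists c, kill_weight nu nu' m = c *: m.
Proof.
move=> hm; rewrite /kill_weight; case: pickP => [i ni|_]; last first.
  by exists 1; rewrite scale1r.
by rewrite /gact hm -scalerBl scalerA; eexists.
Qed.

Lemma kill_weight0 nu nu' m : weight_vector nu' m -> nu != nu' -> kill_weight nu nu' m = 0.
Proof.
move=> hm neq; rewrite /kill_weight; case: pickP => [i ni|same]; last first.
  by case/eqP: neq; apply/rowP => i; apply/eqP; rewrite -[_ == _]negbK same.
by rewrite /gact hm subrr scaler0.
Qed.

(** A product of operators [kill_weight] projects the sum to the component. *)
Lemma weight_component (s : seq weight) (f : weight -> M) nu : uniq s ->
  (forall e, weight_vector e (f e)) -> \sum_(e <- s) f e \in N -> nu \in s -> f nu \in N.
Proof.
move=> us fw sN nus.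
pose kill m := foldr (fun e m => kill_weight nu e m) m (rem nu s).
have killE (r : seq weight) : nu \notin r ->
    exists g : {linear M -> M}, [/\ g (f nu) = f nu,
      (forall e, e \in r -> g (f e) = 0),
      (forall e, exists c, g (f e) = c *: f e) & forall m, m \in N -> g m \in N].
  elim: r => [|e r IH].
    by exists idfun; split=> // e; exists 1; rewrite scale1r.
  rewrite inE negb_or => /andP[nue /IH[g [g1 g0 gc gN]]].
  exists (kill_weight nu e \o g); split => /=.
  - by rewrite g1 kill_weightE.
  - move=> e'; rewrite inE => /orP[/eqP->|/g0->]; last exact: linear0.
    have [c ->] := gc e; rewrite linearZ /= kill_weight0 ?scaler0 //.
  - move=> e'; have [c ->] := gc e'; have [c' h] := kill_weight_scale nu e (fw e').
    by exists (c * c'); rewrite linearZ /= h scalerA.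
  - by move=> m /gN; apply: kill_weight_submod.
have [|g [g1 g0 _ gN]] := killE (rem nu s); first by rewrite mem_rem_uniqF.
have := gN _ sN; rewrite linear_sum (perm_big _ (perm_to_rem nus)) big_cons g1.
have -> : \sum_(e <- rem nu s) g (f e) = 0 by rewrite big_seq big1.
by rewrite /= addr0.
Qed.

End WeightComponents.

Section VermaWeights.
Variables (K : fieldType) (zeta : K) (mu : weight) (V : lieModule (D21 zeta)).
Hypothesis int_neq0 : forall n : int, n != 0 -> n%:~R != 0 :> K.
Variable vl : verma_like mu V.
Local Notation low_vec := (low_vec vl).
Local Notation vcoord := (vcoord vl).

Lemma vcoord_cartan x i y : vcoord x (gact (bH i) y) =
  ((mu - wt3 (index_drop x)) 0 i)%:~R * vcoord x y.
Proof.
elim/(verma_ind int_neq0 vl): y => [c y z hy hz||z hz].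
- by rewrite linearP !(vcoord_linear vl x) hy hz mulrDr mulrCA.
- by rewrite !linear0 mulr0.
rewrite /gact (low_vec_weight vl z i) linearZ /= vcoord_low //.
by case: eqP => [->|]; rewrite ?mulr0.
Qed.

Lemma vcoord_weight x nu y : weight_vector nu y -> vcoord x y != 0 ->
  mu - wt3 (index_drop x) = nu.
Proof.
move=> hy xy; apply/rowP => i; have := vcoord_cartan x i y.
rewrite /gact hy linearZ /= => /(mulIf xy) /eqP; rewrite eq_sym -subr_eq0 -intrB => e.
apply/eqP; rewrite -subr_eq0; apply/negPn/negP => /int_neq0; by rewrite e.
Qed.

Definition weight_part (d : int * int * int) (y : V) : V :=
  \sum_(x <- low_indices d) vcoord x y *: low_vec x.

Lemma weight_part_weight d y : weight_vector (mu - wt3 d) (weight_part d y).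
Proof.
rewrite /weight_part big_seq; elim/big_ind: _ => [i|u w hu hw|x].
- by rewrite -[LHS]/(gact _ 0) linear0 scaler0.
- by rewrite -[u]scale1r; apply: weight_vector_linear.
rewrite mem_low_indices => /andP[_ /eqP <-]; rewrite -[_ *: _]addr0.
by apply: weight_vector_linear; [exact: low_vec_weight|
  move=> i; rewrite -[LHS]/(gact _ 0) linear0 scaler0].
Qed.

Lemma verma_weight_sum d y :
  exists s, [/\ uniq s, d \in s & y = \sum_(e <- s) weight_part e y].
Proof.
have [s [us hs] ys] := verma_expand int_neq0 vl y.
exists (undup (d :: map index_drop s)); split; first exact: undup_uniq.
  by rewrite mem_undup mem_head.
rewrite /weight_part -(big_map low_indices xpredT (fun r => \sum_(x <- r) vcoord x y *: low_vec x)).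
rewrite -big_flatten; apply: ys.
- elim: (undup _) (undup_uniq (d :: map index_drop s)) => //= {}d r IH /andP[dr /IH ur].
  rewrite cat_uniq low_indices_uniq ur andbT /=; apply/hasPn => x /flatten_mapP[e er].
  rewrite !mem_low_indices => /andP[_ /eqP ->]; rewrite negb_and; apply/orP; right.
  by apply: contra dr => /eqP <-.
- move=> x xs; apply/flatten_mapP; exists (index_drop x).
    by rewrite mem_undup inE map_f ?orbT.
  by rewrite mem_low_indices hs // eqxx.
by move=> x /flatten_mapP[e _]; rewrite mem_low_indices => /andP[].
Qed.

Lemma weight_part_id d y : weight_vector (mu - wt3 d) y -> weight_part d y = y.
Proof.
move=> hy; have [s [us hs] ys] := verma_expand int_neq0 vl y.
rewrite [RHS](ys (undup (s ++ low_indices d))) ?undup_uniq //; last 2 first.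
- by move=> x xs; rewrite mem_undup mem_cat xs.
- by move=> x; rewrite mem_undup mem_cat mem_low_indices => /orP[/hs|/andP[]].
rewrite [RHS](bigID (fun x => x \in low_indices d)) /= [X in _ + X]big_seq_cond.
rewrite [X in _ + X]big1 ?addr0 => [|x /andP[xs]]; last first.
  rewrite mem_low_indices; have -> : x.2 \in odd_subsets.
    by move: xs; rewrite mem_undup mem_cat mem_low_indices => /orP[/hs|/andP[]].
  move=> /= xd; case: (eqVneq (vcoord x y) 0) => [->|/(vcoord_weight hy)]; first by rewrite scale0r.
  by move/addrI/oppr_inj/wt3_inj => e; rewrite e eqxx in xd.
rewrite -big_filter; apply: perm_big; apply: uniq_perm.
- exact: low_indices_uniq.
- by rewrite filter_uniq // undup_uniq.
by move=> x; rewrite [in RHS]mem_filter mem_undup mem_cat; case: (x \in low_indices d); rewrite ?orbT.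
Qed.

Lemma weight_part_submod (N : {pred V}) d y : is_submodule N -> y \in N ->
  weight_part d y \in N.
Proof.
move=> NN Ny; have [[N0 Nl] _] := NN.
have [s [us ds ys]] := verma_weight_sum d y.
have inj : injective (fun e => mu - wt3 e) by move=> e e' /addrI/oppr_inj/wt3_inj.
pose f (nu : weight) := weight_part (mu 0 0 - nu 0 0, mu 0 1 - nu 0 1, mu 0 2 - nu 0 2) y.
have fE e : f (mu - wt3 e) = weight_part e y.
  rewrite /f; congr weight_part; case: e => [[? ?] ?]; rewrite !mxE /=.
  by congr (_, _, _); rewrite opprB addrC subrK.
rewrite -fE; apply: (weight_component int_neq0 NN (s := [seq mu - wt3 e | e <- s])).
- by rewrite map_inj_uniq.
- move=> nu; have {1}-> : nu = mu - wt3 (mu 0 0 - nu 0 0, mu 0 1 - nu 0 1, mu 0 2 - nu 0 2).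
    rewrite [LHS]wt3_eta [RHS]wt3_eta !mxE /=; congr wt3.
    by congr (_, _, _); rewrite opprB addrC subrK.
  exact: weight_part_weight.
- by rewrite big_map; under eq_bigr do rewrite fE; rewrite -ys.
exact: (map_f (fun e => mu - wt3 e)) ds.
Qed.

(** A linear form that is positive on the positive roots, to measure how far a
    weight is below the highest one. *)
Definition height (nu : weight) : int := 3 * nu 0 0 + nu 0 1 + nu 0 2.

Lemma heightB nu nu' : height (nu - nu') = height nu - height nu'.
Proof. by rewrite /height !mxE; ring. Qed.

Lemma height_raising b : raising b -> 0 < height (bweight b).
Proof.
have h : all (fun b => raising b ==> (0 < height (bweight b))) pbw_order.
  by rewrite /height /=; rewrite !mxE.
by move=> br; have /implyP := all_pbw_order h b; apply.
Qed.

Lemma height_drop x : 0 <= height (wt3 (index_drop x)).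
Proof.
case: x => [[[k0 k1] k2] S]; rewrite /height !mxE /index_drop /odd_drop /=.
elim: S => [|a S IH] /=; first lia.
by move: IH; case: a => [[] []]; rewrite /sgn /=; lia.
Qed.

Lemma weight_vector_height nu y : weight_vector nu y -> y != 0 :> V ->
  0 <= height (mu - nu).
Proof.
move=> hy y0; have [s [us hs] ys] := verma_expand int_neq0 vl y.
have [x xs] : exists x, vcoord x y != 0.
  apply/not_existsP => h; case/eqP: y0; rewrite (ys s) // big1 // => x _.
  by have /negP/negPn/eqP -> := h x; rewrite scale0r.
by rewrite -(vcoord_weight hy xs) opprB addrC subrK height_drop.
Qed.

(** A weight vector in the difference whose weight is as high as possible is a
    highest weight vector modulo [B]. *)
Lemma exists_singular (A B : {pred V}) : is_submodule A -> is_submodule B ->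
  (exists2 y, y \in A & y \notin B) ->
  exists nu m, [/\ m \in A, m \notin B, weight_vector nu m &
    forall b, raising b -> gact b m \in B].
Proof.
move=> AN BN [y Ay By]; have [[B0 Bl] Bact] := BN.
have [s [us _ ys]] := verma_weight_sum 0 y.
have [e Be] : exists e, weight_part e y \notin B.
  apply/not_existsP => h; case/negP: By; rewrite ys.
  elim/big_ind: _ => // [u w Bu Bw|e _]; first by rewrite -[u]scale1r; apply: (Bl).
  exact/negPn/negP/h.
have : exists nu m, [/\ m \in A, m \notin B & weight_vector nu m].
  exists (mu - wt3 e), (weight_part e y); split=> //; first exact: weight_part_submod.
  exact: weight_part_weight.
case=> nu [m [Am Bm hm]].
(* A raising operator that leaves [B] gives a vector closer to the highest weight. *)
have [n] := ubnP (absz (height (mu - nu))); elim: n nu m Am Bm hm => // n IH nu m Am Bm hm szn.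
have [sing|nsing] := pselect (forall b, raising b -> gact b m \in B).
  by exists nu, m.
have [b /not_implyP[br nBbm]] : exists b, ~ (raising b -> gact b m \in B) by exact/existsNP.
have Bbm : gact b m \notin B by apply/negP.
apply: (IH (bweight b + nu) (gact b m)) => //.
- exact: AN.2.
- exact: weight_vector_gact.
have b0 : gact b m != 0 by apply: contraNneq Bbm => ->.
have := weight_vector_height (weight_vector_gact b hm) b0.
have -> : mu - (bweight b + nu) = mu - nu - bweight b by rewrite opprD addrA addrAC.
move: szn (height_raising br); rewrite !(heightB (mu - nu) (bweight b)).
by move: (height (mu - nu)) (height (bweight b)) => h hb; clear; lia.
Qed.

End VermaWeights.

(** * The largest proper submodule *)

Definition top_index : low_index := ((0%N, 0%N, 0%N), [::]).
Definition up_word (x : low_index) : seq gbasis := map opposite (low_word x).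

Lemma opposite_weight b : bweight (opposite b) = - bweight b.
Proof.
apply/rowP => i; case: b => [[j|[j e]]|[[x y] z]] /=; rewrite !mxE ?oppr0 //.
  by case: e => /=; ring.
by move: i; apply: ord3P; case: x; case: y; case: z.
Qed.

Lemma up_word_weight x : word_weight (up_word x) = wt3 (index_drop x).
Proof.
rewrite -[RHS]opprK -low_word_weight /word_weight big_map -sumrN.
by apply: eq_bigr => b _; apply: opposite_weight.
Qed.

Lemma oppositeK : involutive opposite.
Proof. by move=> b; apply/eqP; move: b; apply: all_pbw_order. Qed.

Lemma up_wordP w : sorted pbw_step w -> all raising w ->
  exists2 x, x.2 \in odd_subsets & w = up_word x.
Proof.
move=> sw rw; have [||x hx e] := @low_wordP (map opposite w).
- case: w sw rw => //= b w; elim: w b => //= c w IH b /andP[bc cw] /and3P[rb rc rw].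
  by rewrite -opposite_step // bc IH //= rc.
- by rewrite all_map; apply: sub_all rw => b; rewrite /= raising_opposite.
by exists x => //; rewrite /up_word -e mapK //; apply: oppositeK.
Qed.

Lemma height_low b : b \in lows -> height (bweight b) < 0.
Proof.
move=> bl; have := @height_raising (opposite b).
rewrite raising_opposite oppositeK bl opposite_weight -[- _]add0r heightB => /(_ isT).
by rewrite {1}/height !mxE !addr0 mulr0 add0r oppr_gt0.
Qed.

Section MaximalSubmodule.
Variables (K : fieldType) (zeta : K) (mu : weight) (V : lieModule (D21 zeta)).
Hypothesis int_neq0 : forall n : int, n != 0 -> n%:~R != 0 :> K.
Variable vl : verma_like mu V.
Local Notation v := (hw_gen vl).
Local Notation low_vec := (low_vec vl).
Local Notation top := (vcoord vl top_index).

Lemma low_vec_top : low_vec top_index = v.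
Proof. by []. Qed.

Lemma top_gen : top v = 1.
Proof. by rewrite -low_vec_top vcoord_low. Qed.

(** A vector with a component at the top generates the highest weight vector. *)
Lemma proper_top (N : {pred V}) y : is_submodule N -> (exists u, u \notin N) ->
  y \in N -> top y = 0.
Proof.
move=> NN [u Nu] Ny; apply/eqP/negPn/negP => y0; case/negP: Nu.
have := weight_part_submod int_neq0 vl (0, 0, 0) NN Ny.
rewrite /weight_part (_ : low_indices _ = [:: top_index]); last by vm_compute.
rewrite big_seq1 low_vec_top => /(NN.1.2 (top y)^-1 _ 0)/(_ NN.1.1).
rewrite addr0 scalerA mulVf // scale1r => Nv.
by have [t ->] := hw_generates vl u; apply: submod_tensor.
Qed.

(** The vectors that no word brings back to the top form a proper submodule, and
    they contain every proper submodule by [proper_top]. *)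
Lemma maximal_sumP y : y \in maximal_sum V <-> forall w, top (word_act w y) = 0.
Proof.
split=> [/asboolP[s -> sN] w|h].
  rewrite !linear_sum big_seq big1 // => u /sN[N [NN Nu uN]].
  by apply: (proper_top NN) => //; apply: submod_word.
apply/asboolP; exists [:: y]; first by rewrite big_seq1.
move=> u; rewrite inE => /eqP -> {u}.
pose N : {pred V} := fun u => `[<forall w, top (word_act w u) = 0>].
exists N; split; last exact/asboolP.
  split=> [|x u /asboolP Nu]; first split=> [|c u u' /asboolP Nu /asboolP Nu'].
  - by apply/asboolP => w; rewrite !linear0.
  - by apply/asboolP => w; rewrite !linearP /= Nu Nu' mulr0 addr0.
  apply/asboolP => w; rewrite act_gvec_sum !linear_sum big1 // => b _.
  rewrite !linearZ /= -[gact b u]/(word_act [:: b] u) -word_act_cat Nu.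
  exact: mulr0.
exists v; apply/asboolP => /(_ [::]) /=; rewrite top_gen.
by apply/eqP; apply: oner_neq0.
Qed.

Lemma top_low b y : b \in lows -> top (gact b y) = 0.
Proof.
move=> bl; elim/(verma_ind int_neq0 vl): y => [c y z hy hz||x hx].
- by rewrite !linearP /= hy hz mulr0 addr0.
- by rewrite !linear0.
apply/eqP/negPn/negP => /(vcoord_weight int_neq0).
move=> /(_ _ (weight_vector_gact b (low_vec_weight vl x))).
rewrite (_ : wt3 _ = 0) ?subr0; last first.
  by rewrite (_ : index_drop _ = (0, 0, 0)) //; apply/rowP; apply: ord3P; rewrite !mxE.
move=> e; have eb : bweight b = wt3 (index_drop x).
  by apply: (addIr (mu - wt3 (index_drop x))); rewrite -e addrCA subrr addr0.
by have := height_low bl; rewrite eb ltNge height_drop.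
Qed.

Lemma cartan_word_scale nu w (y : V) : weight_vector nu y -> all cartan w ->
  exists c, word_act w y = c *: y.
Proof.
move=> hy; elim: w => [|b w IH] /=; first by exists 1; rewrite scale1r.
case/andP => bc /IH[c ->]; case: b bc => [[i|]|] // _.
by exists (c * (nu 0 i)%:~R); rewrite linearZ /= /gact hy scalerA.
Qed.

(** Lowering letters never lead to the top and Cartan letters only scale, so that
    raising words of the right weight decide. *)
Lemma maximal_sum_weightP d (y : V) : weight_vector (mu - wt3 d) y ->
  y \in maximal_sum V <->
  forall x, x \in low_indices d -> top (word_act (up_word x) y) = 0.
Proof.
move=> hy; split=> [/maximal_sumP h x _|h]; first exact: h.
apply/maximal_sumP.
apply: (@pbw_closed _ _ _ (int_neq0 (n := 2) isT) (fun u => top u = 0)) => [|c u u' hu hu'|w].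
- exact: linear0.
- by rewrite linearP /= hu hu' mulr0 addr0.
move=> /standard_split[wl [wh [wr [-> lo ca ra [_ swr]]]]].
case: wl lo => [|b wl] /=; last by case/andP=> bl _; rewrite top_low.
move=> _; have [x hx ->] := up_wordP swr ra.
have hx' := weight_vector_word (up_word x) hy.
rewrite word_act_cat; have [c ->] := cartan_word_scale hx' ca.
rewrite linearZ /=; have [/h ->|xd] := boolP (x \in low_indices d); first exact: mulr0.
have [->|/(vcoord_weight int_neq0 hx')] := eqVneq (top (word_act (up_word x) y)) 0.
  exact: mulr0.
rewrite up_word_weight (_ : index_drop top_index = (0, 0, 0)) //.
rewrite (_ : wt3 (0, 0, 0) = 0); last by apply/rowP; apply: ord3P; rewrite !mxE.
rewrite subr0 addrCA -{1}[mu]addr0 => /addrI/esym/eqP; rewrite subr_eq0 => /eqP/wt3_inj e.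
by rewrite mem_low_indices hx e eqxx in xd.
Qed.

Lemma maximal_sum_proper : v \notin maximal_sum V.
Proof.
apply/negP => /maximal_sumP /(_ [::]) /=; rewrite top_gen.
by apply/eqP; apply: oner_neq0.
Qed.

Lemma proper_in_maximal_sum (N : {pred V}) : is_submodule N -> v \notin N ->
  {subset N <= maximal_sum V}.
Proof.
move=> NN Nv y Ny; apply/maximal_sumP => w; apply: (proper_top NN); first by exists v.
exact: submod_word.
Qed.

(** A highest weight vector of another weight has no component at the top, and
    neither have its images under lowering words; so it lies in the largest proper
    submodule. *)
Lemma maximal_sum_singular nu (y : V) : singular_mod (maximal_sum V) nu y ->
  y \notin maximal_sum V -> nu = mu.
Proof.
move=> ys Jy; have JN := in_maximal_sum_submodule V.
apply/rowP => i; apply/eqP/negPn/negP => neq; case/negP: Jy.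
have [[J0 Jl] _] := JN; have topJ u : u \in maximal_sum V -> top u = 0.
  by move/maximal_sumP/(_ [::]).
have y0 : top y = 0.
  have := topJ _ (ys.2 i); rewrite linearB linearZ /= (vcoord_cartan int_neq0).
  rewrite (_ : index_drop top_index = (0, 0, 0)) //.
  rewrite (_ : wt3 (0, 0, 0) = 0); last by apply/rowP; apply: ord3P; rewrite !mxE.
  rewrite subr0 -mulrBl -intrB => /eqP; rewrite mulf_eq0 => /orP[|/eqP //].
  by rewrite (negbTE (int_neq0 _)) // subr_eq0 eq_sym.
apply/maximal_sumP.
apply: (singular_span (int_neq0 (n := 2) isT) JN ys (Q := fun u => top u = 0)).
- by move=> c u u' hu hu'; rewrite linearP /= hu hu' mulr0 addr0.
- exact: topJ.
move=> [[[k0 k1] k2] S] /= hS; rewrite /low_word /=.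
have lowcat (w w' : seq gbasis) : all (mem lows) w -> top (word_act w' y) = 0 ->
    top (word_act (w ++ w') y) = 0.
  by case: w => //= b w /andP[bl _] _; apply: top_low.
have allnseq n b : b \in lows -> all (mem lows) (nseq n b).
  by move=> bl; apply/allP => c /nseqP[->].
apply: (lowcat); first exact: allnseq.
apply: (lowcat); first by rewrite all_map; apply/allP => -[[] []].
apply: (lowcat); first exact: allnseq.
by rewrite -[nseq k2 _]cats0; apply: (lowcat); first exact: allnseq.
Qed.

End MaximalSubmodule.

(** * Ranks of contravariant forms *)

(** Only [zeta] remains a variable: the exponents are 0 and the weight is [m]. *)
Definition numeric (m : int * int * int) : seq zpoly :=
  [:: pzeta; [::]; [::]; [::]; pint m.1.1; pint m.1.2; pint m.2].

Definition vec_word (s : seq zpoly) (w : seq gbasis) (v : vec) : vec :=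
  foldr (vec_act s) v w.

Definition vec_coef (x : pbw_index) (v : vec) : zpoly :=
  foldr (fun t p => if t.2 == x then poly_add t.1 p else p) [::] v.

(** The matrix of the form that pairs lowering with raising words of weight [d]
    on the Verma module of highest weight [m]; the rows are the basis vectors. *)
Definition form_entry (m : int * int * int) (x y : low_index) : zpoly :=
  vec_coef (0, [::]) (vec_word (numeric m) (up_word y) (unit_vec (embed_index x))).

Definition form_matrix (m d : int * int * int) : seq (seq zpoly) :=
  [seq [seq form_entry m x y | y <- low_indices d] | x <- low_indices d].

(** Certifies that [p] is a nonzero multiple of [zeta ^ i * (1 + zeta) ^ j] with
    [i, j <= 3].  The sum of the coefficients is the value at [zeta = 1], hence the
    factor is this sum divided by [2 ^ j]. *)
Definition nonvanishing (p : zpoly) : bool :=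
  has (fun ij : nat * nat =>
    let c := Z.div (foldr (fun t => Z.add t.1) Z0 p) (Z.pow 2 (Z.of_nat ij.2)) in
    ~~ Z.eqb c Z0 &&
    nilp (poly_add p (poly_mul (poly_const (Z.opp c))
      (poly_mul_exp pzeta ij.1 (poly_mul_exp (poly_add pzeta (pint 1)) ij.2 (pint 1))))))
  [seq (i, j) | i <- iota 0 4, j <- iota 0 4].

Definition eliminate (n : nat) (r : seq zpoly) (c : nat) (s : seq zpoly) : seq zpoly :=
  [seq poly_add (poly_mul (nth [::] r c) (nth [::] s j))
         (poly_opp (poly_mul (nth [::] s c) (nth [::] r j))) | j <- iota 0 n].

(** Gaussian elimination without division.  The pivots must be certified not to
    vanish at any irrational [zeta]; the result is [None] if there is no such pivot. *)
Fixpoint form_rank (fuel n : nat) (rows : seq (seq zpoly)) : option nat :=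
  if all (all (@nilp _)) rows then Some 0%N else
  if fuel is fuel'.+1 then
    let i := find (has nonvanishing) rows in
    let r := nth [::] rows i in
    let c := find nonvanishing r in
    if [&& i < size rows, c < n & nonvanishing (nth [::] r c)]%N then
      if form_rank fuel' n [seq eliminate n r c s | s <- take i rows ++ drop i.+1 rows]
      is Some k then Some k.+1 else None
    else None
  else None.

Definition drop_between (l l' : int * int * int) : int * int * int :=
  (l.1.1 - l'.1.1, l.1.2 - l'.1.2, l.2 - l'.2).
Definition rho3 : int * int * int := (-1, 1, 1).

(** The dimension of the weight space of [L_l] with weight [l' - rho], if at most 8
    pivots are needed and all can be certified. *)
Definition simple_dim (l l' : int * int * int) : option nat :=
  let d := drop_between l l' in
  form_rank 8 (size (low_indices d)) (form_matrix (drop_between l rho3) d).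

(** The weights of the block that can occur in the five Verma modules.  Whenever
    one of them is higher than another it comes first. *)
Definition linked : seq (int * int * int) :=
  [:: (1, 1, 1); (1, 1, -1); (1, -1, 1); (1, -1, -1); (0, 0, 0);
      (-1, 1, 1); (-1, 1, -1); (-1, -1, 1); (-1, -1, -1);
      (-2, 2, 2); (-2, 2, -2); (-2, -2, 2); (-2, -2, -2)].

Lemma poly_val_zeta (K : fieldType) (zeta : K) E : poly_val (zeta :: E) pzeta = zeta.
Proof.
have := poly_val_coef zeta E (0, 1).
by rewrite /pcoef /coef poly_valD poly_valM !poly_val_int /= !mul1r !add0r.
Qed.

Section FormRank.
Variables (K : fieldType) (zeta : K).
Hypothesis zeta_free : forall a b : int, coef zeta (a, b) = 0 -> a = 0 /\ b = 0.

Lemma int_neq0_of_free n : n != 0 -> n%:~R != 0 :> K.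
Proof.
apply: contraNneq => n0; have [] := zeta_free (a := n) (b := 0) => [|-> //].
by rewrite /coef /= n0 mul0r addr0.
Qed.

Lemma nonvanishing_val E p : nonvanishing p -> poly_val (zeta :: E) p != 0.
Proof.
case/hasP => -[i j] _ /andP[]; set c := Z.div _ _ => c0 /nilP /(congr1 (poly_val (zeta :: E))).
rewrite poly_valD poly_valM !poly_val_mul_exp poly_valD !poly_val_int poly_val_const.
rewrite poly_val_zeta mulr1 poly_val_nil zvalN mulNr => /eqP; rewrite subr_eq0 => /eqP ->.
rewrite !mulf_neq0 ?expf_neq0 //.
- rewrite /zval int_neq0_of_free //; apply: contraNneq c0 => c0; apply/Z.eqb_spec.
  by rewrite -[c]int_of_ZK c0.
- by apply/eqP => z0; have [] := zeta_free (a := 0) (b := 1); rewrite // /coef /= z0 mulr0 addr0.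
by apply/eqP => z1; have [] := zeta_free (a := 1) (b := 1); rewrite // /coef /= mul1r addrC.
Qed.

Variables (E : seq K) (n : nat).
Local Notation val := (poly_val (zeta :: E)).

Definition row_val (r : seq zpoly) : 'rV[K]_n := \row_j val (nth [::] r j).

Lemma row_val_eliminate r s c :
  row_val (eliminate n r c s) =
  val (nth [::] r c) *: row_val s - val (nth [::] s c) *: row_val r.
Proof.
apply/rowP => j; rewrite !mxE (nth_map 0%N) ?size_iota // nth_iota // add0n.
by rewrite poly_valD poly_valN !poly_valM.
Qed.

(** A row operation replaces the other rows by their combinations with the pivot row
    that vanish in the pivot column, so the span loses exactly the pivot line. *)
Lemma form_rank_dim fuel rows k : form_rank fuel n rows = Some k ->
  \dim <<map row_val rows>>%VS = k.
Proof.
elim: fuel rows k => [|fuel IH] rows k /=;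
  case: ifP => [/allP zero|_] //.
1,2: case=> <-; apply/eqP; rewrite dimv_eq0 -subv0; apply/span_subvP => _ /mapP[r /zero /allP r0 ->];
  rewrite memv0; apply/eqP/rowP => j; rewrite !mxE;
  have [/(mem_nth [::])/r0/nilP -> |jr] := ltnP j (size r); 
  rewrite ?poly_val_nil // nth_default // poly_val_nil //.
set i := find _ rows; set r := nth [::] rows i; set c := find _ r.
case: ifP => // /and3P[ir cn pc].
case e : (form_rank _ _ _) => [k'|] // [<-] {k}.
have {e}/IH := e; set rest := take i rows ++ drop i.+1 rows => dk.
have p0 : val (nth [::] r c) != 0 by apply: nonvanishing_val.
have pr : perm_eq rows (r :: rest).
  by rewrite -{1}(cat_take_drop i rows) (drop_nth [::] ir) -cat1s perm_catCA.
rewrite (eq_span (perm_mem (perm_map row_val pr))) /= span_cons.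
set U := <<_>>%VS in dk; have -> : (<[row_val r]> + <<map row_val rest>> = <[row_val r]> + U)%VS.
  apply/eqP; rewrite eqEsubv !subv_add !addvSl /=; apply/andP; split; apply/span_subvP.
    move=> _ /mapP[s sr ->].
    have -> : row_val s = (val (nth [::] r c))^-1 *: (row_val (eliminate n r c s)) +
        ((val (nth [::] r c))^-1 * val (nth [::] s c)) *: row_val r.
      by rewrite row_val_eliminate scalerBr !scalerA mulVf // scale1r subrK.
    rewrite addrC memv_add ?memvZ ?memv_line // memv_span //.
    by rewrite -map_comp; apply: (map_f (row_val \o eliminate n r c)).
  move=> _ /mapP[_ /mapP[s sr ->] ->]; rewrite row_val_eliminate addrC -scaleNr.
  by rewrite memv_add ?memvZ ?memv_line // memv_span // map_f.
rewrite dimv_disjoint_sum ?dk ?dim_vline.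
  rewrite (_ : row_val r != 0) //; apply: contraNneq p0 => /rowP/(_ (Ordinal cn)).
  by rewrite !mxE /= => ->.
apply/eqP; rewrite -subv0; apply/subvP => u /memv_capP[/vlineP[a ->] aU].
suff : (a *: row_val r) 0 (Ordinal cn) = 0.
  rewrite !mxE /= => /eqP; rewrite mulf_eq0 (negbTE p0) orbF => /eqP ->.
  by rewrite scale0r mem0v.
move: aU; move: (_ *: _) => w; pose f : 'rV[K]_n -> K^o := fun u => u 0 (Ordinal cn).
have fl : linear f by move=> b u1 u2; rewrite /f !mxE.
pose g : {linear 'rV[K]_n -> K^o} := HB.pack f (GRing.isLinear.Build K _ _ *:%R f fl).
suff /subvP h : (U <= lker (linfun g))%VS.
  by move/h; rewrite memv_ker lfunE => /eqP.
apply/span_subvP => _ /mapP[_ /mapP[s _ ->] ->]; rewrite memv_ker lfunE /= /f.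
by rewrite row_val_eliminate !mxE /= mulrC subrr.
Qed.

Lemma vec_coef_val k i v : mcoeff (exps_add k i.1, i.2)
    (vec_val (pbw K) (zeta :: E) k v : model_space K) = val (vec_coef i v).
Proof.
elim: v => [|t v IH]; first by rewrite vec_val_nil poly_val_nil; apply: mcoeff0.
rewrite vec_val_cons.
transitivity (val t.1 * mcoeff (exps_add k i.1, i.2) (pbw K (exps_add k t.2.1, t.2.2)) +
  val (vec_coef i v)).
  by rewrite -IH -mcoeffZ; apply: mcoeffD.
have inj : injective (fun x : pbw_index => (exps_add k x.1, x.2)).
  move=> [[[a b] c] S] [[[a' b'] c'] S'] [/addrI -> /addrI -> /addrI -> ->] //.
rewrite pbw_coef (inj_eq inj t.2 i) /=.
by case: eqP => _; rewrite ?poly_valD ?mulr1 ?mulr0 ?add0r.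
Qed.

End FormRank.

Section FormMatrix.
Variables (K : fieldType) (zeta : K) (m : int * int * int) (V : lieModule (D21 zeta)).
Local Notation mu := (wt3 m).
Hypothesis int_neq0 : forall n : int, n != 0 -> n%:~R != 0 :> K.
Variable vl : verma_like mu V.
Local Notation E := (point zeta mu 0).

Lemma numeric_point : [seq poly_val E p | p <- numeric m] = E.
Proof.
rewrite /numeric /= !poly_val_nil !poly_val_int /point !mxE /=.
by rewrite poly_val_zeta.
Qed.

Lemma model_vec_word w v :
  word_act w (vec_val (pbw K) E 0 v : model zeta mu) =
  vec_val (pbw K) E 0 (vec_word (numeric m) w v) :> model_space K.
Proof.
elim: w => //= b w ->; rewrite (vec_actE _ (model_straightens zeta mu b) numeric_point).
exact: model_gact.
Qed.

Lemma form_entryE x y : x.2 \in odd_subsets ->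
  vcoord vl top_index (word_act (up_word y) (low_vec vl x)) =
  poly_val E (form_entry m x y).
Proof.
move=> hx; rewrite /vcoord to_model_word to_model_low //.
have -> : pbw K (embed_index x) = vec_val (pbw K) E 0 (unit_vec (embed_index x)).
  by case: x {hx} => [[[a b] c] S]; rewrite vec_val_unit /exps_add !add0r.
etransitivity; first exact: (congr1 (mcoeff _) (model_vec_word _ _)).
rewrite (_ : embed_index top_index = (exps_add 0 0, [::])); last by [].
exact: (vec_coef_val _ _ 0 (0, [::])).
Qed.

End FormMatrix.

(** * Linkage *)

(** An operator is a combination of words; the coefficients are [a + b zeta]. *)
Definition word_op := seq ((int * int) * seq gbasis).

(** The quadratic Casimir element, normalised to act on a highest weight vector
    of weight [nu] by the form [(nu + rho, nu + rho)]. *)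
Definition casimir : word_op :=
  flatten [seq [:: (t.2, [:: bH t.1.1; bH t.1.1]);
                   ((t.2.1 * 2 * t.1.2, t.2.2 * 2 * t.1.2), [:: bH t.1.1]);
                   ((4 * t.2.1, 4 * t.2.2), [:: bE t.1.1 false; bE t.1.1 true])] |
    t <- [:: ((0 : 'I_3, -1), (-1, -1)); ((1, 1), (1, 0)); ((2, 1), (0, 1))]] ++
  [seq ((- (2 * sgn a.1 * sgn a.2), 0), [:: lower_odd a; opposite (lower_odd a)]) | a <- all_odd].

(** The Casimir element of the [i]-th sl_2, shifted by its value [c ^ 2]. *)
Definition sl2_casimir (i : 'I_3) (c : int) : word_op :=
  [:: ((1, 0), [:: bH i; bH i]); ((2, 0), [:: bH i]); ((1 - c ^+ 2, 0), [::]);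
      ((4, 0), [:: bE i false; bE i true])].

(** The odd lowering operators have [epsilon_1]-coordinate 1 or -1, two of each.  So
    a product of distinct ones shifts this coordinate by at most 1, or by 2 with
    [epsilon_2]-coordinate 0.  This explains the four values: for the even subalgebra
    the Verma module of [l] is filtered by Verma modules with these shifts, and each
    of them is killed by one of the Casimir elements.  The product kills the whole
    module by [annihilators_five]. *)
Definition sl2_annihilators (l : int * int * int) : seq word_op :=
  [:: sl2_casimir 1 (l.1.2 - 1); sl2_casimir 1 (l.1.2 + 1); sl2_casimir 1 l.1.2;
      sl2_casimir 2 l.2].

Definition vec_op (s : seq zpoly) (T : word_op) (v : vec) : vec :=
  vec_sum [seq vec_scale (pcoef t.1) (vec_word s t.2 v) | t <- T].

(** The exponents remain variables. *)
Definition partly_generic (m : int * int * int) : seq zpoly :=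
  [:: pzeta; pk 0; pk 1; pk 2; pint m.1.1; pint m.1.2; pint m.2].

Definition annihilates (m : int * int * int) (Ts : seq word_op) : bool :=
  all (fun S => nilp (foldr (vec_op (partly_generic m)) (unit_vec (0, S)) Ts)) odd_subsets.

(** The five Verma modules are those of highest weight [l - rho]. *)
Definition five : seq (int * int * int) :=
  [:: (0, 0, 0); (1, -1, -1); (1, -1, 1); (1, 1, -1); (1, 1, 1)].

Lemma annihilators_five : all (fun l => annihilates (drop_between l rho3) [:: casimir] &&
  annihilates (drop_between l rho3) (sl2_annihilators l)) five.
Proof. by vm_compute. Qed.

Section WordOperators.
Variables (K : fieldType) (zeta : K) (M : lieModule (D21 zeta)).

Definition op_val (T : word_op) (u : M) : M := \sum_(t <- T) coef zeta t.1 *: word_act t.2 u.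

Lemma op_val_linear T : linear (op_val T).
Proof.
move=> c u v; rewrite /op_val scaler_sumr -big_split; apply: eq_bigr => t _ /=.
by rewrite linearP scalerDr !scalerA mulrC.
Qed.
HB.instance Definition _ T := GRing.isLinear.Build K M M *:%R (op_val T) (op_val_linear T).

Definition cartan_value (nu : weight) (b : gbasis) : int :=
  if b is inl (inl i) then nu 0 i else 0.

Definition op_scalar (nu : weight) (T : word_op) : K :=
  \sum_(t <- T) coef zeta t.1 * (\prod_(b <- t.2) cartan_value nu b)%:~R.

Variables (B : {pred M}) (nu : weight) (m : M).
Hypothesis BN : is_submodule B.
Hypothesis m_singular : singular_mod B nu m.

(** The words whose action on a highest weight vector is evident. *)
Definition good_word (w : seq gbasis) : bool :=
  all cartan w || raising (last (bH 0) w).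

Lemma good_word_scalar w : good_word w ->
  word_act w m - (\prod_(b <- w) cartan_value nu b)%:~R *: m \in B.
Proof.
have [[B0 Bl] _] := BN; case/orP => [|].
  elim: w => [|b w IH] /=; first by rewrite big_nil scale1r subrr.
  case/andP; case: b => [[i|]|] // _ /IH wm; rewrite big_cons /=.
  have := BN.2 (gvec K (bH i) : D21 zeta) _ wm.
  rewrite -[act _ _]/(gact (bH i) _) linearB linearZ /= => hwm.
  have := Bl 1 _ _ hwm (Bl (\prod_(b <- w) cartan_value nu b)%:~R _ _ (m_singular.2 i) B0).
  by rewrite scale1r addr0 scalerBr scalerA addrA subrK intrM mulrC.
case/lastP: w => // w b; rewrite last_rcons => br.
rewrite -cats1 big_cat big_seq1 /= (_ : cartan_value nu b = 0); last first.
  by case: b br => [[]|].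
rewrite mulr0 scale0r subr0 word_act_cat; apply: submod_word => //.
by apply: (act_n_plus m (conj B0 Bl)).1 => //; exact: m_singular.1.
Qed.

Lemma op_val_scalar T : all (fun t => good_word t.2) T ->
  op_val T m - op_scalar nu T *: m \in B.
Proof.
have [[B0 Bl] _] := BN => /allP hT.
rewrite /op_val /op_scalar scaler_suml -sumrB big_seq.
elim/big_ind: _ => // [u v Bu Bv|t tT]; first by rewrite -[u]scale1r; apply: (Bl).
rewrite -scalerA -scalerBr -[_ *: _]addr0; apply: (Bl) => //.
exact/good_word_scalar/hT.
Qed.

Lemma op_val_submod T u : u \in B -> op_val T u \in B.
Proof.
have [[B0 Bl] _] := BN => Bu; rewrite /op_val.
elim/big_ind: _ => // [v w Bv Bw|t _]; first by rewrite -[v]scale1r; apply: (Bl).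
by rewrite -[_ *: _]addr0; apply: (Bl) => //; apply: submod_word.
Qed.

(** Modulo [B] each operator acts on [m] by its scalar. *)
Lemma annihilated_scalar Ts : m \notin B -> all (all (fun t => good_word t.2)) Ts ->
  foldr op_val m Ts = 0 -> \prod_(T <- Ts) op_scalar nu T = 0.
Proof.
have [[B0 Bl] _] := BN => Bm good e.
have : foldr op_val m Ts - (\prod_(T <- Ts) op_scalar nu T) *: m \in B.
  elim: Ts good {e} => [|T Ts IH] /=; first by rewrite big_nil scale1r subrr.
  case/andP => /op_val_scalar hT /IH h; rewrite big_cons.
  have := Bl 1 _ _ (op_val_submod T h) (Bl (\prod_(T <- Ts) op_scalar nu T) _ _ hT B0).
  by rewrite scale1r addr0 linearB linearZ /= scalerBr scalerA addrA subrK mulrC.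
rewrite e sub0r => Bc; apply/eqP/negPn/negP => c0; case/negP: Bm.
have := Bl (- (\prod_(T <- Ts) op_scalar nu T)^-1) _ _ Bc B0.
by rewrite addr0 scaleNr scalerN opprK scalerA mulVf // scale1r.
Qed.

End WordOperators.

Section Annihilators.
Variables (K : fieldType) (zeta : K) (m : int * int * int) (V : lieModule (D21 zeta)).
Local Notation mu := (wt3 m).
Hypothesis int_neq0 : forall n : int, n != 0 -> n%:~R != 0 :> K.
Variable vl : verma_like mu V.

Lemma partly_generic_point k :
  [seq poly_val (point zeta mu k) p | p <- partly_generic m] = point zeta mu k.
Proof.
have := generic_point zeta mu k; rewrite /generic /partly_generic /= => -[-> e0 e1 e2 _ _ _].
by rewrite !poly_val_int /pk /= e0 e1 e2 /point !mxE.
Qed.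

Local Notation mpbw := (pbw K : pbw_index -> model zeta mu).

Lemma gact_straightens b : straightens zeta mu mpbw b (@gact K zeta (model zeta mu) b).
Proof. move=> x; rewrite model_gact; exact: model_straightens. Qed.

Lemma op_val_vec E s k T v : [seq poly_val (zeta :: E) p | p <- s] = point zeta mu k ->
  op_val T (vec_val mpbw (zeta :: E) k v) = vec_val mpbw (zeta :: E) k (vec_op s T v).
Proof.
move=> sE; rewrite vec_val_sum big_map; apply: eq_bigr => t _.
rewrite vec_valZ poly_val_coef; congr (_ *: _).
elim: t.2 => //= b w ->.
by rewrite (vec_actE _ (@gact_straightens b) sE).
Qed.

Lemma model_annihilated Ts k S : annihilates m Ts -> S \in odd_subsets ->
  foldr (fun T u => op_val T u) (mpbw (k, S)) Ts = 0.
Proof.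
move=> /allP h /h /nilP e.
have <- : vec_val mpbw (point zeta mu k) k (unit_vec (0, S)) = mpbw (k, S).
  by rewrite vec_val_unit exps_add0.
rewrite -[RHS](vec_val_nil mpbw (point zeta mu k) k) -e.
elim: Ts {h e} => [|T Ts IH] //=.
by rewrite IH (op_val_vec _ _ (partly_generic_point k)).
Qed.

Lemma to_model_op T y : to_model vl (op_val T y) = op_val T (to_model vl y).
Proof.
pose f : {linear V -> model zeta mu} := HB.pack (to_model vl)
  (GRing.isLinear.Build K V (model zeta mu) *:%R (to_model vl) (to_model_linear vl)).
rewrite -[to_model vl (op_val T y)]/(f _) linear_sum; apply: eq_bigr => t _.
by rewrite linearZ /= to_model_word.
Qed.

Lemma op_seq_linear Ts : linear (fun y : V => foldr (fun T u => op_val T u) y Ts).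
Proof. by elim: Ts => [|T Ts IH] c y z //=; rewrite IH linearP. Qed.

Lemma verma_annihilated Ts (y : V) : annihilates m Ts ->
  foldr (fun T u => op_val T u) y Ts = 0.
Proof.
move=> ann; have op_seq0 : foldr (fun T u => op_val T u) (0 : V) Ts = 0.
  by have := op_seq_linear Ts (-1) 0 0; rewrite scaler0 addr0 scaleN1r addNr.
elim/(verma_ind int_neq0 vl): y => [c y z hy hz||x hx] //.
  by rewrite op_seq_linear hy hz scaler0 addr0.
apply: (vcoord_ext int_neq0 (vl := vl)) => z; rewrite linear0 /vcoord.
have -> : to_model vl (foldr (fun T u => op_val T u) (low_vec vl x) Ts) =
    foldr (fun T u => op_val T u) (mpbw (embed_index x)) Ts.
  elim: Ts {ann op_seq0} => [|T Ts IH] /=; first exact: to_model_low.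
  by rewrite to_model_op IH.
rewrite [embed_index x]surjective_pairing model_annihilated //; exact: mcoeff0.
Qed.

End Annihilators.

Section Linkage.
Variables (K : fieldType) (zeta : K) (l : int * int * int) (V : lieModule (D21 zeta)).
Local Notation mu := (wt3 (drop_between l rho3)).
Hypothesis zeta_free : forall a b : int, coef zeta (a, b) = 0 -> a = 0 /\ b = 0.
Hypothesis l_five : l \in five.
Variable vl : verma_like mu V.
Variables (B : {pred V}) (nu : weight) (m : V).
Hypothesis BN : is_submodule B.
Hypothesis m_singular : singular_mod B nu m.
Hypothesis m_nu : weight_vector nu m.
Hypothesis Bm : m \notin B.
Let int_neq0 := int_neq0_of_free zeta_free.

Let a := nu 0 0 - 1.
Let b := nu 0 1 + 1.
Let c := nu 0 2 + 1.

(** The Casimir element acts by [b ^ 2 + zeta c ^ 2 - (1 + zeta) a ^ 2], which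
    vanishes on the whole module; 1 and [zeta] are linearly independent. *)
Lemma casimir_linkage : b ^+ 2 = a ^+ 2 /\ c ^+ 2 = a ^+ 2.
Proof.
have /andP[ann _] := allP annihilators_five l l_five.
have := annihilated_scalar BN m_singular Bm _ (verma_annihilated int_neq0 vl m ann).
move=> /(_ isT); rewrite big_seq1 /op_scalar /casimir /= !big_cons !big_nil /=.
rewrite ?big_cons ?big_nil /= => e.
have [] := zeta_free (a := b ^+ 2 - a ^+ 2) (b := c ^+ 2 - a ^+ 2); last first.
  by move=> /subr0_eq -> /subr0_eq ->.
rewrite -[RHS]e /coef /a /b /c /=; rewrite ?(intrD, intrM, intrN); ring.
Qed.

Lemma sl2_scalar i n : op_scalar zeta nu (sl2_casimir i n) = ((nu 0 i + 1) ^+ 2 - n ^+ 2)%:~R.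
Proof.
rewrite /op_scalar /sl2_casimir !big_cons !big_nil /= ?big_cons ?big_nil /coef /=.
rewrite ?(intrD, intrM, intrN); ring.
Qed.

Lemma sl2_linkage : [|| b ^+ 2 == (l.1.2 - 1) ^+ 2, b ^+ 2 == (l.1.2 + 1) ^+ 2,
  b ^+ 2 == l.1.2 ^+ 2 | c ^+ 2 == l.2 ^+ 2].
Proof.
have /andP[_ ann] := allP annihilators_five l l_five.
have := annihilated_scalar BN m_singular Bm _ (verma_annihilated int_neq0 vl m ann).
move=> /(_ isT); rewrite !big_cons big_nil !sl2_scalar mulr1.
have z (n : int) : n%:~R = 0 :> K -> n = 0.
  by move=> n0; apply/eqP/negPn/negP => /int_neq0; rewrite n0 eqxx.
move/eqP; rewrite !mulf_eq0 => /or4P[] /eqP/z/subr0_eq <-;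
  by rewrite /b /c eqxx ?orbT.
Qed.

(** The Casimir element leaves the weights [(+-n, +-n, +-n)], and the sl_2 Casimir
    elements bound [n]. *)
Lemma linked_weight : exists2 l', l' \in linked & nu = wt3 (drop_between l' rho3).
Proof.
have m0 : m != 0 by apply: contraNneq Bm => ->; have [[]] := BN.
(* All weights are below the highest one, whose first label is at most 1. *)
have : a <= 1.
  have [x xm] : exists x, vcoord vl x m != 0.
    apply/not_existsP => h; case/eqP: m0; apply: (vcoord_ext int_neq0 (vl := vl)) => x.
    by rewrite linear0; apply/eqP/negPn/negP/h.
  rewrite /a -(vcoord_weight int_neq0 m_nu xm) !mxE /drop_between /=.
  have : l.1.1 <= 1 by move: l_five; rewrite !inE => /or4P[|||/orP[]] /eqP ->.
  by rewrite /odd_drop /=; lia.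
have [ba ca] := casimir_linkage; have := sl2_linkage; rewrite ba ca.
have -> : nu = wt3 (drop_between (a, b, c) rho3).
  rewrite [LHS]wt3_eta; congr wt3; rewrite /drop_between /a /b /c /=.
  by congr (_, _, _); lia.
move=> h a1; exists (a, b, c) => //.
have : (b == a) || (b == - a) by rewrite -eqf_sqr ba.
have : (c == a) || (c == - a) by rewrite -eqf_sqr ca.
have a2 : -2 <= a.
  rewrite lerNl; move: l_five h; rewrite !inE => /or4P[|||/orP[]] /eqP -> /=; nia.
move: (a) (b) (c) a1 a2 => a' b' c' a1 a2.
have /or4P[] : [|| a' == 1, a' == 0, a' == -1 | a' == -2] by move: a1 a2; clear; lia.
all: by move=> /eqP -> /orP[] /eqP -> /orP[] /eqP ->.
Qed.

End Linkage.

(** * Simple subquotients *)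

Definition simple_top (K : fieldType) (zeta : K) (W : lieModule (D21 zeta)) :
    lieModule (D21 zeta) :=
  quotient_module (act_linearl (l := W)) (act_linearr (l := W))
    (maximal_sum_stable (M := W)) (maximal_sum_br (M := W)).

Section SimpleTop.
Variables (K : fieldType) (zeta : K) (W : lieModule (D21 zeta)).
Local Notation J := (maximal_sum W).

Definition to_top (y : W) : simple_top W := \pi_(quot J) y.

Lemma to_top_linear : linear to_top.
Proof. by move=> c y z; rewrite /to_top quot_piD quot_piZ. Qed.
HB.instance Definition _ := GRing.isLinear.Build K W (simple_top W) *:%R to_top to_top_linear.

Lemma to_top_act x y : act x (to_top y) = to_top (act x y).
Proof. exact: (quot_opE (act_linearr (l := W)) (maximal_sum_stable (M := W))). Qed.

Lemma to_top_eq0 y : to_top y = 0 <-> y \in J.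
Proof.
rewrite -(linear0 to_top); split=> [/quot_piP|h]; first by rewrite subr0.
by apply/quot_piP; rewrite subr0.
Qed.

Lemma to_top_surj (q : simple_top W) : exists y, q = to_top y.
Proof. by exists (repr q); rewrite /to_top reprK. Qed.

End SimpleTop.

Section Subquotient.
Variables (K : fieldType) (zeta : K) (V W : lieModule (D21 zeta)) (nu : weight).
Hypothesis int_neq0 : forall n : int, n != 0 -> n%:~R != 0 :> K.
Variable wl : verma_like nu W.
Variables (A B : {pred V}).
Hypothesis AN : is_submodule A.
Hypothesis BN : is_submodule B.
Local Notation w := (hw_gen wl).
Local Notation J := (maximal_sum W).

Lemma submod0 (M : lieModule (D21 zeta)) (N : {pred M}) : is_submodule N -> 0 \in N.
Proof. by case=> [[]]. Qed.

Lemma submodD (M : lieModule (D21 zeta)) (N : {pred M}) u v : is_submodule N ->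
  u \in N -> v \in N -> u + v \in N.
Proof. by move=> [[_ Nl] _] Nu Nv; rewrite -[u]scale1r; apply: Nl. Qed.

Lemma submodZ (M : lieModule (D21 zeta)) (N : {pred M}) c u : is_submodule N ->
  u \in N -> c *: u \in N.
Proof. by move=> [[N0 Nl] _] Nu; rewrite -[_ *: _]addr0; apply: Nl. Qed.

Lemma submodB (M : lieModule (D21 zeta)) (N : {pred M}) u v : is_submodule N ->
  u \in N -> v \in N -> u - v \in N.
Proof. by move=> NN Nu Nv; rewrite -scaleN1r; apply: submodD => //; apply: submodZ. Qed.

Lemma actB (M : lieModule (D21 zeta)) x (u v : M) : act x (u - v) = act x u - act x v.
Proof. by rewrite addrC -scaleN1r act_linearr scaleN1r addrC. Qed.

Section FromSingular.
Variable m : V.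
Hypothesis AB : simple_quotient A B.
Hypothesis Am : m \in A.
Hypothesis Bm : m \notin B.
Hypothesis m_singular : singular_mod B nu m.

(** As [A / B] is simple, this submodule is [B] or [A]; used with all tensors it
    shows that [m] generates [A / B], and used with the tensors that send [w] into
    the largest proper submodule it identifies the annihilators. *)
Definition congruent (P : tensor_algebra K -> Prop) : {pred V} :=
  fun a => `[< a \in A /\ exists2 t, P t & a - tensor_act m t \in B >].

Lemma congruent_submod (P : tensor_algebra K -> Prop) : P 0 -> (forall c s t, P s -> P t -> P (c *: s + t)) ->
  (forall (x : D21 zeta) t, P t -> P (tensor_gen x * t)) -> is_submodule (congruent P).
Proof.
move=> P0 Pl Pg; split=> [|x u /asboolP[Au [t Pt Bt]]]; first split.
- apply/asboolP; split; first exact: submod0.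
  by exists 0 => //; rewrite tensor_act0 subr0; apply: submod0.
- move=> c u v /asboolP[Au [s Ps Bs]] /asboolP[Av [t Pt Bt]]; apply/asboolP.
  split; first exact: AN.1.2.
  exists (c *: s + t); first exact: Pl.
  by rewrite tensor_act_linear opprD addrACA -scalerBr; apply: BN.1.2.
apply/asboolP; split; first exact: AN.2.
exists (tensor_gen x * t); first exact: Pg.
rewrite tensor_actM tensor_act_gen.
by rewrite -actB; apply: BN.2.
Qed.

Lemma congruent_cases (P : tensor_algebra K -> Prop) : P 0 -> (forall c s t, P s -> P t -> P (c *: s + t)) ->
  (forall (x : D21 zeta) t, P t -> P (tensor_gen x * t)) -> congruent P =i B \/ congruent P =i A.
Proof.
move=> P0 Pl Pg; case: AB => BA _ max; apply: max.
- exact: congruent_submod.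
- move=> b Bb; apply/asboolP; split; first exact: BA.
  by exists 0 => //; rewrite tensor_act0 subr0.
by move=> a /asboolP[].
Qed.

Lemma tensor_sub m1 t : tensor_act m1 (1 - t) = m1 - tensor_act m1 t :> V.
Proof. by rewrite tensor_actB tensor_act1. Qed.

Lemma tensor_mod_gen a : a \in A -> exists t, a - tensor_act m t \in B.
Proof.
move=> Aa; have [//|//|//|e|e] := @congruent_cases (fun _ => True).
- case/negP: Bm; rewrite -e; apply/asboolP; split=> //.
  by exists 1 => //; rewrite tensor_act1 subrr; apply: submod0.
have /asboolP[_ [t _ Bt]] : a \in congruent (fun _ => True) by rewrite e.
by exists t.
Qed.

Lemma tensor_kernel t : tensor_act m t \in B -> tensor_act w t \in J.
Proof.
move=> Bt; pose N : {pred W} :=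
  fun y => `[< exists2 t, y = tensor_act w t & tensor_act m t \in B >].
have NN : is_submodule N.
  split=> [|x y /asboolP[s -> Bs]]; first split.
  - by apply/asboolP; exists 0; rewrite tensor_act0 //; apply: submod0.
  - move=> c y z /asboolP[s -> Bs] /asboolP[s' -> Bs']; apply/asboolP.
    by exists (c *: s + s'); rewrite tensor_act_linear //; apply: BN.1.2.
  apply/asboolP; exists (tensor_gen x * s); rewrite tensor_actM tensor_act_gen //.
  exact: BN.2.
apply: (proper_in_maximal_sum int_neq0 (vl := wl) NN); last by apply/asboolP; exists t.
apply/negP => /asboolP[s ws Bs]; case/negP: Bm.
have /hw_free/(verma_relation_mod BN m_singular) : tensor_act w (1 - s) = 0.
  by rewrite tensor_actB tensor_act1 -ws subrr.
by rewrite tensor_sub => /(submodD BN)/(_ Bs); rewrite subrK.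
Qed.

Lemma tensor_kernelP t : tensor_act m t \in B <-> tensor_act w t \in J.
Proof.
split; first exact: tensor_kernel.
move=> Jt; have JN := in_maximal_sum_submodule W.
have [|c s s' Js Js'|x s Js|e|e] := @congruent_cases (fun t => tensor_act w t \in J).
- by rewrite tensor_act0; apply: submod0.
- by rewrite tensor_act_linear; apply: JN.1.2.
- by rewrite tensor_actM tensor_act_gen; apply: JN.2.
- rewrite -e; apply/asboolP; split; first exact: submod_tensor.
  by exists t => //; rewrite subrr; apply: submod0.
have /asboolP[_ [s Js]] : m \in congruent (fun t => tensor_act w t \in J) by rewrite e.
rewrite -tensor_sub => /tensor_kernel; rewrite tensor_actB tensor_act1.
move/(submodD JN)/(_ Js); rewrite subrK => Jw.
by case/negP: (maximal_sum_proper int_neq0 wl).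
Qed.

(** The vectors [m] and [w] have the same annihilator modulo [B] and modulo the largest
    proper submodule of [W], so [t m] is mapped to [t w]. *)
Lemma iso_of_singular : subquotient_iso A B (simple_top W).
Proof.
have [g gP] : {g : V -> tensor_algebra K & forall a, a \in A -> a - tensor_act m (g a) \in B}.
  apply: (choice (P := fun a t => a \in A -> a - tensor_act m t \in B)) => a.
  have [Aa|] := boolP (a \in A); last by exists 0.
  by have [t Bt] := tensor_mod_gen Aa; exists t.
have fE a t : a \in A -> a - tensor_act m t \in B ->
    to_top (tensor_act w (g a)) = to_top (tensor_act w t).
  move=> Aa Bt; apply/eqP; rewrite -subr_eq0 -linearB -tensor_actB /=.
  apply/eqP/to_top_eq0/tensor_kernelP; rewrite tensor_actB.
  have := submodB BN Bt (gP a Aa).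
  by rewrite opprB addrC addrA subrK.
exists (fun a => to_top (tensor_act w (g a))); split.
- move=> u v Au Av a.
  have Bt : a *: u + v - tensor_act m (a *: g u + g v) \in B.
    by rewrite tensor_act_linear opprD addrACA -scalerBr; apply: BN.1.2; apply: gP.
  etransitivity; first exact: (fE _ _ (AN.1.2 a u v Au Av) Bt).
  etransitivity; first exact: (congr1 (@to_top _ _ W) (tensor_act_linear _ _ _ _)).
  exact: to_top_linear.
- move=> v Av x; rewrite to_top_act.
  have Bt : act x v - tensor_act m (tensor_gen x * g v) \in B.
    by rewrite tensor_actM tensor_act_gen -actB; apply: BN.2; apply: gP.
  etransitivity; first exact: (fE _ _ (AN.2 x v Av) Bt).
  by rewrite tensor_actM tensor_act_gen.
- move=> q; have [y ->] := to_top_surj q; have [t ->] := hw_generates wl y.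
  exists (tensor_act m t); first exact: submod_tensor.
  by apply: fE; [exact: submod_tensor|rewrite subrr; apply: submod0].
move=> v Av; have Bg := gP v Av; split.
  move/to_top_eq0/tensor_kernelP => /(submodD BN)/(_ Bg).
  by rewrite addrC subrK.
move=> Bv; apply/to_top_eq0/tensor_kernelP.
by have := submodB BN Bv Bg; rewrite opprB addrC subrK.
Qed.

End FromSingular.

(** Lift the image of the generator of [W]. *)
Lemma singular_of_iso : subquotient_iso A B (simple_top W) ->
  exists m, [/\ m \in A, m \notin B & singular_mod B nu m].
Proof.
case=> f [fl fa fs fk]; have [m Am fm] := fs (to_top w).
have BE a : a \in A -> (a \in B) = (f a == 0).
  by move=> Aa; apply/idP/eqP => /(fk a Aa).
have f0 : f 0 = 0 by apply/(fk 0); [exact: submod0|exact: submod0].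
have fZ c a : a \in A -> f (c *: a) = c *: f a.
  by move=> Aa; have := fl a 0 Aa (submod0 AN) c; rewrite f0 !addr0.
exists m; split=> //.
  rewrite BE // fm; apply/eqP => /to_top_eq0; apply/negP.
  exact: (maximal_sum_proper int_neq0 wl).
split=> [x xn|i].
  rewrite BE ?fa // ?fm; last exact: AN.2.
  rewrite to_top_act; apply/eqP/to_top_eq0.
  have [/(_ x xn)/eqP -> _] := hw_singular wl; exact: (submod0 (in_maximal_sum_submodule W)).
have Ah : gact (bH i) m \in A by apply: AN.2.
rewrite BE; last by apply: submodB => //; apply: submodZ.
rewrite -scaleNr addrC fl // fa // fm to_top_act.
have [_ /(_ i)/eqP/subr0_eq e] := hw_singular wl.
have -> : to_top (act (gvec K (bH i) : D21 zeta) w) = (nu 0 i)%:~R *: to_top w.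
  exact: etrans (congr1 (@to_top _ _ W) e) (linearZ_LR _ _ _).
by rewrite scaleNr addNr.
Qed.

End Subquotient.

(** The highest weight of a simple quotient is determined by [maximal_sum_singular]. *)
Lemma iso_weight_unique (K : fieldType) (zeta : K) (V W W' : lieModule (D21 zeta))
    (nu nu' : weight) (wl : verma_like nu W) (wl' : verma_like nu' W') (A B : {pred V}) :
  (forall n : int, n != 0 -> n%:~R != 0 :> K) -> is_submodule A -> is_submodule B ->
  subquotient_iso A B (simple_top W) -> subquotient_iso A B (simple_top W') -> nu = nu'.
Proof.
move=> int_neq0 AN BN /(singular_of_iso int_neq0 wl AN BN)[m [Am Bm [mn mh]]].
case=> f [fl fa fs fk]; have [y fm] := to_top_surj (f m).
have f0 : f 0 = 0 by apply/(fk 0); apply: submod0.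
have fB a : a \in A -> a \in B -> f a = 0 by move=> Aa /(fk a Aa).
apply: (maximal_sum_singular int_neq0 wl' (y := y)).
  split=> [x xn|i]; apply/to_top_eq0.
    by rewrite -to_top_act -fm -fa // fB ?mn //; apply: AN.2.
  have Ah : gact (bH i) m \in A by apply: AN.2.
  rewrite linearB linearZ /= -[to_top (gact _ _)]to_top_act -fm -fa //.
  have Ad : gact (bH i) m - (nu 0 i)%:~R *: m \in A by apply: submodB => //; apply: submodZ.
  have := fB _ Ad (mh i); rewrite -scaleNr addrC fl // scaleNr addrC; exact.
apply/negP => /to_top_eq0; rewrite -fm => /(fk m Am).
exact/negP.
Qed.

(** * Dimensions of weight spaces of submodules *)

(** A subspace of largest dimension inside [P]. *)
Lemma submod_vspace (K : fieldType) (vT : vectType K) (P : {pred vT}) :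
  submod_closed P -> exists U : {vspace vT}, forall u, (u \in U) = (u \in P).
Proof.
move=> [P0 Pl].
pose good n := `[< exists2 U : {vspace vT}, \dim U = n & forall u, u \in U -> u \in P >].
have g0 : exists n, good n.
  by exists 0%N; apply/asboolP; exists 0%VS; rewrite ?dimv0 // => u; rewrite memv0 => /eqP->.
have gb n : good n -> (n <= \dim {:vT})%N.
  by move=> /asboolP[U <- _]; apply: dimvS; apply: subvf.
case: (ex_maxnP g0 gb) => n /asboolP[U dU UP] max; exists U => u.
apply/idP/idP => [/UP //|Pu].
have gUu : good (\dim (U + <[u]>)%VS).
  apply/asboolP; exists (U + <[u]>)%VS => // _ /memv_addP[v Uv [_ /vlineP[c ->] ->]].
  by rewrite addrC; apply: Pl => //; apply: UP.
have /eqP e : U == (U + <[u]>)%VS by rewrite eqEdim addvSl dU max.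
by rewrite e; apply: (subvP (addvSr _ _)); apply: memv_line.
Qed.

(** Rank and nullity for a map that is linear only on [U]. *)
Lemma dim_image (K : fieldType) (vT wT : vectType K) (U X : {vspace vT}) (Y : {vspace wT})
    (g : vT -> wT) : (X <= U)%VS ->
  {in U &, forall u v a, g (a *: u + v) = a *: g u + g v} ->
  {in U, forall u, (g u == 0) = (u \in X)} ->
  {in U, forall u, g u \in Y} -> (forall y, y \in Y -> exists2 u, u \in U & g u = y) ->
  \dim U = (\dim X + \dim Y)%N.
Proof.
move=> XU gl gk gY gs.
pose h u := g (projv U u).
have hl : linear h.
  by move=> a u v; rewrite /h linearP gl // memv_proj.
pose h' : {linear vT -> wT} := HB.pack h (GRing.isLinear.Build K vT wT *:%R h hl).
have hE u : u \in U -> linfun h' u = g u by move=> Uu; rewrite lfunE /= /h projv_id.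
have <- : (U :&: lker (linfun h'))%VS = X.
  apply/vspaceP => u; rewrite memv_cap memv_ker; apply/andP/idP => [[Uu]|Xu].
    by rewrite hE // gk.
  by have Uu := subvP XU u Xu; rewrite Uu hE // gk.
have <- : (linfun h' @: U)%VS = Y.
  apply/vspaceP => y; apply/memv_imgP/idP => [[v Uv ->]|/gs[v Uv <-]].
    by rewrite hE // gY.
  by exists v; rewrite ?hE.
by rewrite limg_ker_dim.
Qed.

Section WeightSpaces.
Variables (K : fieldType) (zeta : K) (mu : weight) (V : lieModule (D21 zeta)).
Hypothesis int_neq0 : forall n : int, n != 0 -> n%:~R != 0 :> K.
Variable vl : verma_like mu V.
Implicit Types (A B N : {pred V}) (d : int * int * int).

Definition basis_index d j : low_index := nth top_index (low_indices d) j.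

Lemma basis_index_mem d (j : 'I_(size (low_indices d))) : basis_index d j \in low_indices d.
Proof. exact: mem_nth. Qed.

Lemma basis_index_odd d (j : 'I_(size (low_indices d))) : (basis_index d j).2 \in odd_subsets.
Proof. by have := basis_index_mem j; rewrite mem_low_indices => /andP[]. Qed.

(** Identifies a weight space with row vectors, so that its subspaces have
    dimensions. *)
Definition weight_embed d (u : 'rV[K]_(size (low_indices d))) : V :=
  \sum_j u 0 j *: low_vec vl (basis_index d j).

Lemma weight_embed_linear d : linear (@weight_embed d).
Proof.
move=> c u v; rewrite /weight_embed scaler_sumr -big_split; apply: eq_bigr => j _ /=.
by rewrite !mxE scalerDl scalerA.
Qed.
HB.instance Definition _ d := GRing.isLinear.Build K _ V *:%R (@weight_embed d)
  (@weight_embed_linear d).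

Lemma weight_part_embed d (y : V) :
  weight_part vl d y = weight_embed (\row_(j < size (low_indices d)) vcoord vl (basis_index d j) y).
Proof.
rewrite /weight_part (big_nth top_index) big_mkord; apply: eq_bigr => j _.
by rewrite mxE.
Qed.

Lemma vcoord_embed d u (j : 'I_(size (low_indices d))) :
  vcoord vl (basis_index d j) (weight_embed u) = u 0 j.
Proof.
rewrite linear_sum (bigD1 j) //= linearZ /= vcoord_low ?basis_index_odd // eqxx mulr1.
rewrite big1 ?addr0 // => i ij; rewrite linearZ /= vcoord_low ?basis_index_odd //.
by rewrite /basis_index nth_uniq ?low_indices_uniq // eq_sym (inj_eq val_inj) (negbTE ij) mulr0.
Qed.

Lemma weight_embed_part d (u : 'rV[K]_(size (low_indices d))) :
  weight_part vl d (weight_embed u) = weight_embed u.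
Proof.
rewrite weight_part_embed; congr weight_embed; apply/rowP => j.
by rewrite mxE vcoord_embed.
Qed.

Lemma weight_embed_weight d (u : 'rV[K]_(size (low_indices d))) :
  weight_vector (mu - wt3 d) (weight_embed u).
Proof. by rewrite -weight_embed_part; apply: weight_part_weight. Qed.

Lemma weight_space_exists N d : exists U : {vspace 'rV[K]_(size (low_indices d))},
  is_submodule N -> forall u, (u \in U) = (weight_embed u \in N).
Proof.
have [NN|nN] := pselect (is_submodule N); last by exists 0%VS.
pose P : {pred 'rV[K]_(size (low_indices d))} := fun u => weight_embed u \in N.
have PN : submod_closed P.
  split=> [|c u v Nu Nv]; rewrite -[_ \in P]/(weight_embed _ \in N).
    by rewrite linear0; apply: submod0.
  by rewrite linearP; apply: NN.1.2.
by have [U h] := submod_vspace PN; exists U => _ u; rewrite h.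
Qed.

Definition weight_space N d := projT1 (cid (weight_space_exists N d)).
Definition weight_dim N d : nat := \dim (weight_space N d).

Lemma mem_weight_space N d u : is_submodule N ->
  (u \in weight_space N d) = (weight_embed u \in N).
Proof. by move=> NN; rewrite /weight_space; case: cid => U /= ->. Qed.

Lemma weight_dimS A B d : is_submodule A -> is_submodule B -> {subset A <= B} ->
  (weight_dim A d <= weight_dim B d)%N.
Proof.
move=> AN BN AB; apply: dimvS; apply/subvP => u.
by rewrite !mem_weight_space //; apply: AB.
Qed.

Lemma weight_dim_lt A B d y : is_submodule A -> is_submodule B -> {subset A <= B} ->
  weight_vector (mu - wt3 d) y -> y \in B -> y \notin A -> (weight_dim A d < weight_dim B d)%N.
Proof.
move=> AN BN AB hy By Ay; rewrite ltnNge; apply: contra Ay => le.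
have /eqP e : weight_space A d == weight_space B d.
  rewrite eqEdim le andbT; apply/subvP => u.
  by rewrite !mem_weight_space //; apply: AB.
have := weight_part_id int_neq0 vl hy; rewrite weight_part_embed => yE.
by rewrite -yE -mem_weight_space // e mem_weight_space // yE.
Qed.

Lemma weight_dim_full N d : is_submodule N -> N =i predT -> weight_dim N d = size (low_indices d).
Proof.
move=> NN full; rewrite /weight_dim (_ : weight_space N d = fullv).
  by rewrite dimvf /dim /= mul1n.
by apply/vspaceP => u; rewrite mem_weight_space // full memvf.
Qed.

Lemma weight_dim0 N d : is_submodule N -> N =i pred1 0 -> weight_dim N d = 0%N.
Proof.
move=> NN zero; apply/eqP; rewrite dimv_eq0; apply/eqP/vspaceP => u.
rewrite mem_weight_space // zero memv0; apply/eqP/eqP => [u0|->]; last exact: linear0.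
by apply/rowP => j; rewrite -vcoord_embed u0 linear0 mxE.
Qed.

(** The component of [y] of another weight is a nonzero multiple of a component of an
    element of [N]. *)
Lemma weight_mod N d y : is_submodule N ->
  (forall i, gact (bH i) y - ((mu - wt3 d) 0 i)%:~R *: y \in N) ->
  y - weight_part vl d y \in N.
Proof.
move=> NN hy; have [s [us ds ys]] := verma_weight_sum int_neq0 vl d y.
have partN e : e != d -> weight_part vl e y \in N.
  move=> ed; have [i ni] : exists i, (mu - wt3 e) 0 i != (mu - wt3 d) 0 i.
    apply/not_existsP => same; case/eqP: ed; apply/wt3_inj/oppr_inj/(addrI mu)/rowP => i.
    exact/eqP/negPn/negP/same.
  have := weight_part_submod int_neq0 vl e NN (hy i).
  have -> : weight_part vl e (gact (bH i) y - ((mu - wt3 d) 0 i)%:~R *: y) =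
      ((mu - wt3 e) 0 i - (mu - wt3 d) 0 i)%:~R *: weight_part vl e y.
    rewrite /weight_part scaler_sumr big_seq [RHS]big_seq; apply: eq_bigr => x.
    rewrite mem_low_indices => /andP[_ /eqP xe].
    by rewrite linearB linearZ /= (vcoord_cartan int_neq0) xe -mulrBl -intrB scalerA.
  move/(submodZ ((mu - wt3 e) 0 i - (mu - wt3 d) 0 i)%:~R^-1 NN).
  by rewrite scalerA mulVf ?scale1r // int_neq0 // subr_eq0.
rewrite {1}ys (bigD1_seq d) //= addrAC subrr add0r.
elim/big_ind: _ => [|u v|e]; [exact: submod0|exact: submodD|exact: partN].
Qed.

End WeightSpaces.

(** * Weight dimensions of simple subquotients *)

Section SimpleDimension.
Variables (K : fieldType) (zeta : K) (mu : weight) (V W : lieModule (D21 zeta)).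
Variables (m : int * int * int) (dV dW : int * int * int).
Hypothesis zeta_free : forall a b : int, coef zeta (a, b) = 0 -> a = 0 /\ b = 0.
Variables (vl : verma_like mu V) (wl : verma_like (wt3 m) W).
Hypothesis same_weight : mu - wt3 dV = wt3 m - wt3 dW.
Let int_neq0 := int_neq0_of_free zeta_free.
Local Notation n := (size (low_indices dW)).
Local Notation J := (maximal_sum W).
Local Notation top := (vcoord wl top_index).

(** The values of all raising words that bring the weight to the top. *)
Definition top_values (y : W) : 'rV[K]_n := \row_j top (word_act (up_word (basis_index dW j)) y).

Lemma top_values_linear : linear top_values.
Proof. by move=> c y z; apply/rowP => j; rewrite !mxE !linearP. Qed.
HB.instance Definition _ := GRing.isLinear.Build K W 'rV[K]_n *:%R top_values top_values_linear.

Lemma top_values_maximal y : y \in J -> top_values y = 0.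
Proof.
by move=> Jy; apply/rowP => j; rewrite !mxE; apply: (maximal_sumP int_neq0 wl y).1.
Qed.

Lemma top_values0 y : weight_vector (wt3 m - wt3 dW) y -> top_values y = 0 -> y \in J.
Proof.
move=> hy /rowP y0; apply/(maximal_sum_weightP int_neq0 wl hy) => x xd.
have xn : (index x (low_indices dW) < n)%N by rewrite index_mem.
by have := y0 (Ordinal xn); rewrite !mxE /basis_index /= nth_index.
Qed.

Definition top_form (u : 'rV[K]_n) : 'rV[K]_n := top_values (weight_embed wl u).

Lemma top_form_linear : linear top_form.
Proof. by move=> c u v; rewrite /top_form !linearP. Qed.
HB.instance Definition _ := GRing.isLinear.Build K 'rV[K]_n 'rV[K]_n *:%R top_form top_form_linear.

(** The rows of the form matrix are the values of [top_form] on the basis. *)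
Lemma top_form_dim fuel k : form_rank fuel n (form_matrix m dW) = Some k ->
  \dim (limg (linfun top_form)) = k.
Proof.
move=> /(form_rank_dim zeta_free (behead (point zeta (wt3 m) 0))) <-.
set E := behead _; congr (\dim _); apply/eqP.
have rowE (j : 'I_n) : row_val zeta E n (nth [::] (form_matrix m dW) j) =
    top_values (low_vec wl (basis_index dW j)).
  apply/rowP => i; rewrite !mxE (nth_map top_index) // (nth_map top_index) //.
  by rewrite -(form_entryE wl) ?basis_index_odd.
have szE : size (form_matrix m dW) = n by rewrite size_map.
rewrite eqEsubv; apply/andP; split.
  apply/subvP => _ /memv_imgP[u _ ->]; rewrite lfunE /= /top_form linear_sum.
  apply: memv_suml => j _; rewrite linearZ /= memvZ // -rowE memv_span //.
  by rewrite map_f // mem_nth // szE.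
apply/span_subvP => _ /mapP[r /(nthP [::])[j jn <-] ->]; rewrite szE in jn.
rewrite (rowE (Ordinal jn)); apply/memv_imgP; exists (delta_mx 0 (Ordinal jn)); first exact: memvf.
rewrite lfunE /= /top_form /weight_embed (bigD1 (Ordinal jn)) //= big1 ?addr0.
  by rewrite mxE !eqxx scale1r.
by move=> i /negbTE ij; rewrite mxE ij andbF scale0r.
Qed.

Variables (A B : {pred V}).
Hypothesis AN : is_submodule A.
Hypothesis BN : is_submodule B.
Hypothesis BA : {subset B <= A}.

(** The map [top_values] kills the largest proper submodule and is injective modulo
    it on a weight space; so on the weight space of [A] it has kernel [B] and the
    image computed by [form_rank]. *)
Lemma simple_weight_dim fuel k : subquotient_iso A B (simple_top W) ->
  form_rank fuel n (form_matrix m dW) = Some k ->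
  weight_dim vl A dV = (weight_dim vl B dV + k)%N.
Proof.
case=> f [fl fa fs fk] /top_form_dim <-.
have f0 : f 0 = 0 by apply/(fk 0 (submod0 AN))/submod0.
have fB a : a \in A -> a \in B -> f a = 0 by move=> Aa /(fk a Aa).
have fD a b : a \in A -> b \in A -> f (a - b) = f a - f b.
  by move=> Aa Ab; rewrite addrC -scaleN1r fl // scaleN1r addrC.
have fZ c a : a \in A -> f (c *: a) = c *: f a.
  by move=> Aa; have := fl a 0 Aa (submod0 AN) c; rewrite f0 !addr0.
pose G q := top_values (repr (q : simple_top W)).
have GE y : G (to_top y) = top_values y.
  apply/eqP; rewrite -subr_eq0 -linearB; apply/eqP/top_values_maximal/to_top_eq0.
  by rewrite linearB /= /to_top reprK subrr.
have lift a : a \in A -> weight_vector (mu - wt3 dV) a ->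
    exists2 y, weight_vector (wt3 m - wt3 dW) y & f a = to_top y.
  move=> Aa ha; have [y fy] := to_top_surj (f a).
  exists (weight_part wl dW y); first exact: weight_part_weight.
  rewrite fy; apply/eqP; rewrite -subr_eq0 -linearB; apply/eqP/to_top_eq0.
  apply: (weight_mod int_neq0 wl (in_maximal_sum_submodule W)) => i.
  apply/to_top_eq0; rewrite linearB linearZ /= -to_top_act -fy -fa // ha.
  by rewrite fZ // same_weight subrr.
apply: (@dim_image _ _ _ _ _ _ (fun u => G (f (weight_embed vl u)))).
- by apply/subvP => u; rewrite !mem_weight_space //; apply: BA.
- move=> u v; rewrite !mem_weight_space // => Au Av c.
  have [y fy] := to_top_surj (f (weight_embed vl u)).
  have [z fz] := to_top_surj (f (weight_embed vl v)).
  by rewrite linearP fl // fy fz -linearP !GE linearP.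
- move=> u; rewrite !mem_weight_space // => Au.
  have [y hy fy] := lift _ Au (weight_embed_weight vl u).
  rewrite fy GE; apply/eqP/idP => [/(top_values0 hy) Jy|Bu].
    by apply/(fk _ Au); rewrite fy; apply/to_top_eq0.
  by apply: top_values_maximal; apply/to_top_eq0; rewrite -fy fB.
- move=> u; rewrite mem_weight_space // => Au.
  have [y hy fy] := lift _ Au (weight_embed_weight vl u).
  rewrite fy GE -(weight_part_id int_neq0 wl hy) weight_part_embed.
  by apply/memv_imgP; eexists; [exact: memvf|rewrite lfunE].
move=> _ /memv_imgP[u _ ->]; rewrite lfunE /=.
have [a Aa fau] := fs (to_top (weight_embed wl u)).
(* A preimage of a weight vector may be replaced by its weight component. *)
have ha i : gact (bH i) a - ((mu - wt3 dV) 0 i)%:~R *: a \in B.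
  have Ah : gact (bH i) a \in A by apply: AN.2.
  apply/(fk _ (submodB AN Ah (submodZ _ AN Aa))); rewrite fD ?fZ //; last exact: submodZ.
  rewrite fa // fau to_top_act same_weight.
  have -> : act (gvec K (bH i) : D21 zeta) (weight_embed wl u) = _ := weight_embed_weight wl u i.
  by rewrite linearZ /= subrr.
have Ba := weight_mod int_neq0 vl BN ha.
have Ap := weight_part_submod int_neq0 vl dV AN Aa.
exists (\row_(j < size (low_indices dV)) vcoord vl (basis_index dV j) a).
  by rewrite mem_weight_space // -weight_part_embed.
rewrite -weight_part_embed.
have -> : f (weight_part vl dV a) = f a.
  by apply/eqP; rewrite eq_sym -subr_eq0 -fD // fB // BA.
by rewrite fau GE.
Qed.

End SimpleDimension.

(** * Submodules of Verma modules in category O *)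

Definition finitely_generated (K : fieldType) (zeta : K) (V : lieModule (D21 zeta))
    (N : {pred V}) :=
  exists2 s : seq V, {subset s <= N} &
    forall N', is_submodule N' -> {subset s <= N'} -> {subset N <= N'}.

Section CategoryO.
Variables (K : fieldType) (zeta : K) (mu : weight) (V : lieModule (D21 zeta)).
Hypothesis int_neq0 : forall n : int, n != 0 -> n%:~R != 0 :> K.
Variable vl : verma_like mu V.
Local Notation low_vec := (low_vec vl).
Local Notation vcoord := (vcoord vl).

Lemma vcoord_invalid x y : x.2 \notin odd_subsets -> vcoord x y = 0.
Proof.
move=> hx; elim/(verma_ind int_neq0 vl): y => [c y z hy hz||z hz].
- by rewrite linearP /= hy hz mulr0 addr0.
- exact: linear0.
by rewrite vcoord_low //; case: eqP hx => // ->; rewrite hz.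
Qed.

(** The vectors of bounded depth: a finite-dimensional space stable under raising. *)
Definition bounded (h : nat) : {pred V} :=
  fun y => `[< forall x, vcoord x y != 0 -> (height (wt3 (index_drop x)) <= h%:Z)%R >].

Definition box (h : nat) : seq low_index :=
  [seq x <- [seq (k, T) | k <- [seq (k, c) | k <- [seq (a, b) | a <- iota 0 h.+1, b <- iota 0 h.+1],
                                   c <- iota 0 h.+1], T <- odd_subsets]
   | height (wt3 (index_drop x)) <= h%:Z].

Lemma height_exps x : (x.1.1.1 + x.1.1.2 + x.1.2)%:Z <= height (wt3 (index_drop x)).
Proof.
case: x => [[[k0 k1] k2] S]; rewrite /height !mxE /index_drop /odd_drop /=.
elim: S => [|a S IH] /=; first lia.
by move: IH; case: a => [[] []]; rewrite /sgn /=; lia.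
Qed.

Lemma mem_box h x : x.2 \in odd_subsets -> height (wt3 (index_drop x)) <= h%:Z -> x \in box h.
Proof.
move=> hx hh; rewrite mem_filter hh andTb; have := le_trans (height_exps x) hh.
rewrite lez_nat => le; case: x hx {hh} le => [[[a b] c] T] hT le; rewrite /= in le.
apply: (allpairs_f pair) => //; apply: (allpairs_f pair).
  by apply: (allpairs_f pair); rewrite mem_iota /=; lia.
by rewrite mem_iota /=; lia.
Qed.

Lemma box_uniq h : uniq (box h).
Proof.
rewrite filter_uniq // allpairs_uniq //; last by move=> [? ?] [? ?] _ _ [-> ->].
rewrite allpairs_uniq ?iota_uniq //; last by move=> [? ?] [? ?] _ _ [-> ->].
by rewrite allpairs_uniq ?iota_uniq //; move=> [? ?] [? ?] _ _ [-> ->].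
Qed.

Lemma bounded_expand h y : y \in bounded h -> y = \sum_(x <- box h) vcoord x y *: low_vec x.
Proof.
move/asboolP => hy; apply: (vcoord_ext int_neq0 (vl := vl)) => z.
have [hz|hz] := boolP (z.2 \in odd_subsets); last by rewrite !vcoord_invalid.
rewrite linear_sum /= big_seq.
have -> : \sum_(x <- box h | x \in box h) vcoord z (vcoord x y *: low_vec x) =
    \sum_(x <- box h | x \in box h) (if x == z then vcoord z y else 0).
  apply: eq_bigr => x; rewrite mem_filter => /andP[_ /allpairsP[[k T] [_ /= hT xE]]].
  rewrite linearZ /= vcoord_low ?xE // eq_sym.
  by case: eqP => [->|_]; rewrite ?mulr1 ?mulr0.
rewrite -big_seq; have [zb|zb] := boolP (z \in box h).
  rewrite (bigD1_seq z) ?box_uniq //= eqxx big1 ?addr0 // => x /negbTE ->; exact: erefl.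
rewrite big1_seq => [|x /andP[_ xb]].
  by apply/eqP; apply: contraNT zb => /hy; apply: mem_box.
by case: eqP => // xz; rewrite -xz xb in zb.
Qed.

Lemma bounded_lin_comb h y : y \in bounded h -> lin_comb (map low_vec (box h)) y.
Proof.
move=> hy; exists (fun i => vcoord (nth top_index (box h) i) y).
rewrite {1}(bounded_expand hy) (big_nth top_index) -(size_map low_vec) big_mkord.
apply: eq_bigr => i _; congr (_ *: _).
by rewrite (nth_map top_index) // (leq_trans (ltn_ord i)) ?size_map.
Qed.

Lemma bounded_closed h : submod_closed (bounded h).
Proof.
split=> [|c y z /asboolP hy /asboolP hz].
  by apply/asboolP => x; rewrite linear0 eqxx.
apply/asboolP => x; rewrite linearP /=.
have [y0|/hy //] := eqVneq (vcoord x y) 0.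
by rewrite y0 mulr0 add0r => /hz.
Qed.

Lemma in_category_O_submod (N : {pred V}) : is_submodule N ->
  finitely_generated N -> in_category_O N.
Proof.
move=> NN fg; split=> // v Nv.
  have [s [_ _ ys]] := verma_weight_sum int_neq0 vl 0 v.
  exists [seq weight_part vl e v | e <- s]; first by rewrite big_map.
  move=> _ /mapP[e _ ->]; split; first exact: weight_part_submod.
  by exists (mu - wt3 e); apply: weight_part_weight.
have [s [us hs] ys] := verma_expand int_neq0 vl v.
(* Any bound for the heights in the support of [v] will do. *)
pose h := (\sum_(x <- s) absz (height (wt3 (index_drop x))))%N.
have low_bounded x : x.2 \in odd_subsets -> height (wt3 (index_drop x)) <= h%:Z ->
    low_vec x \in bounded h.
  move=> hx le; apply/asboolP => z; rewrite vcoord_low //.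
  by have [-> //|] := eqVneq z x; rewrite eqxx.
have hs_le x : x \in s -> height (wt3 (index_drop x)) <= h%:Z.
  move=> xs; rewrite -[height _]gez0_abs ?height_drop // lez_nat /h.
  by rewrite (big_rem x) //= leq_addr.
have Bh := bounded_closed h.
exists (map low_vec (box h)).
  apply: bounded_lin_comb; rewrite (ys s) // big_seq.
  elim/big_ind: _ => [|u w Bu Bw|x xs]; first exact: Bh.1.
    by rewrite -[u]scale1r; apply: Bh.2.
  rewrite -[_ *: _]addr0; apply: Bh.2; last exact: Bh.1.
  by apply: low_bounded; [apply: hs|apply: hs_le].
move=> x _ xn /mapP[z zb ->]; apply: bounded_lin_comb.
apply: (act_n_plus _ Bh).2 xn => b br; apply/asboolP => z' z0.
have zh : height (wt3 (index_drop z)) <= h%:Z by move: zb; rewrite mem_filter => /andP[].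
have e := vcoord_weight int_neq0 (weight_vector_gact b (low_vec_weight vl z)) z0.
have -> : wt3 (index_drop z') = wt3 (index_drop z) - bweight b.
  by apply/oppr_inj/(addrI mu); rewrite e opprB addrCA.
rewrite heightB; move: (height_raising br) zh.
by move: (height _) (height _) => a c; clear; lia.
Qed.

End CategoryO.

(** * Composition series *)

Section CompositionSeries.
Variables (K : fieldType) (zeta : K) (l : int * int * int) (V : lieModule (D21 zeta)).
Hypothesis zeta_free : forall a b : int, coef zeta (a, b) = 0 -> a = 0 /\ b = 0.
Hypothesis l_five : l \in five.
Variable vl : verma_like (wt3 (drop_between l rho3)) V.
Implicit Types (A B N : {pred V}).
Let int_neq0 := int_neq0_of_free zeta_free.

Lemma drop_between_wt3 l1 l2 :
  wt3 (drop_between l1 rho3) - wt3 (drop_between l1 l2) = wt3 (drop_between l2 rho3).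
Proof.
by apply/rowP; apply: ord3P; rewrite !mxE /drop_between /=; ring.
Qed.

Lemma linked_singular A B : is_submodule A -> is_submodule B -> ~ {subset A <= B} ->
  exists l' m, [/\ l' \in linked, m \in A, m \notin B,
    weight_vector (wt3 (drop_between l' rho3)) m & singular_mod B (wt3 (drop_between l' rho3)) m].
Proof.
move=> AN BN nAB; have [|nu [m [Am Bm hm up]]] := exists_singular int_neq0 vl AN BN.
  have [y /not_implyP[Ay /negP By]] : exists y, ~ (y \in A -> y \in B) by exact/existsNP.
  by exists y.
have sm : singular_mod B nu m.
  split=> [x xn|i]; first exact: (act_n_plus m BN.1).2.
  by rewrite /gact hm subrr; apply: submod0.
have [l' hl' e] := linked_weight zeta_free l_five vl BN sm hm Bm.
by exists l', m; split; rewrite // -e.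
Qed.

(** A finite measure of submodules: it grows in strict inclusions, because the
    difference contains a highest weight vector of linked weight. *)
Definition linked_dim N : nat := \sum_(l' <- linked) weight_dim vl N (drop_between l l').

Lemma linked_dim_lt A B : is_submodule A -> is_submodule B -> {subset A <= B} ->
  ~ {subset B <= A} -> (linked_dim A < linked_dim B)%N.
Proof.
move=> AN BN AB /(linked_singular BN AN)[l' [m [hl' Bm Am hm _]]].
rewrite /linked_dim (big_rem l' hl') [ltnRHS](big_rem l' hl') -addSn.
apply: leq_add; last by apply: leq_sum => l'' _; apply: weight_dimS.
by apply: (weight_dim_lt int_neq0 vl AN BN AB _ Bm Am); rewrite drop_between_wt3.
Qed.

Local Notation whole := ((fun _ => true) : {pred V}).

(** A submodule properly above [B] of least [linked_dim]; it is generated by [B] and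
    any further vector. *)
Lemma minimal_above B : is_submodule B -> finitely_generated B -> ~ (B =i predT) ->
  exists A, [/\ is_submodule A, finitely_generated A & simple_quotient A B].
Proof.
move=> BN [s sB sgen] nfull.
pose above A := [/\ is_submodule A, {subset B <= A} & ~ {subset A <= B}].
pose good k := `[< exists2 A, above A & linked_dim A = k >].
have exg : exists k, good k.
  exists (linked_dim whole); apply/asboolP; exists whole => //; split=> //.
  by move=> h; apply: nfull => y; apply/idP; apply: h.
case: (ex_minnP exg) => k /asboolP[A [AN BA nAB] <-] kmin.
have AB : simple_quotient A B.
  split=> // N NN BN' NA; have [NB|nNB] := pselect {subset N <= B}.
    by left=> y; apply/idP/idP => [/NB|/BN'].
  right=> y; apply/idP/idP => [/NA //|]; move: y.
  have [//|nAN] := pselect {subset A <= N}.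
  have := linked_dim_lt NN AN NA nAN; rewrite ltnNge kmin //.
  by apply/asboolP; exists N.
exists A; split=> //.
have [y /not_implyP[Ay By]] : exists y, ~ (y \in A -> y \in B) by exact/existsNP.
exists (y :: s) => [z|N NN sN]; first by rewrite inE => /orP[/eqP ->|/sB/BA].
(* The intersection of [A] and [N] contains [B] and [y], hence it is [A]. *)
have [_ _ /(_ (fun z => (z \in A) && (z \in N)))] := AB; case.
- split=> [|x z /andP[Az Nz]]; last by apply/andP; split; [apply: AN.2|apply: NN.2].
  split=> [|c z z' /andP[Az Nz] /andP[Az' Nz']]; apply/andP; split.
  + exact: submod0.
  + exact: submod0.
  + exact: AN.1.2.
  + exact: NN.1.2.
- move=> z Bz; apply/andP; split; first exact: BA.
  by apply: (sgen N NN) => // z' sz'; apply: sN; rewrite inE sz' orbT.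
- by move=> z /andP[].
- by move=> e; case: By; rewrite -e; apply/andP; split=> //; apply: sN; rewrite mem_head.
by move=> e z; rewrite -e => /andP[].
Qed.

Lemma series_above B : is_submodule B -> finitely_generated B ->
  exists n W, [/\ W 0%N = B, W n =i predT,
    forall i, (i <= n)%N -> is_submodule (W i) /\ finitely_generated (W i) &
    forall i, (i < n)%N -> simple_quotient (W i.+1) (W i)].
Proof.
have [k] := ubnP (linked_dim whole - linked_dim B); elim: k B => // k IH B szB BN Bfg.
have [full|nfull] := pselect (B =i predT).
  by exists 0%N, (fun _ => B); split.
have [A [AN Afg AB]] := minimal_above BN Bfg nfull.
have [BA nAB _] := AB; have lt1 := linked_dim_lt BN AN BA nAB.
have [|n [W [W0 Wn WN WS]]] := IH A _ AN Afg.
  have : (linked_dim B < linked_dim whole)%N.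
    apply: linked_dim_lt => // h; apply: nfull => y; apply/idP; exact: h.
  by move: lt1 szB; clear; lia.
exists n.+1, (fun i => if i is j.+1 then W j else B); split=> //.
  by case=> [|i] le //; apply: WN.
by case=> [|i] lt; [rewrite W0|apply: WS].
Qed.

Lemma composition_series_exists : exists n W, composition_series (M := V) n W.
Proof.
have [|n [W [W0 Wn WN WS]]] := series_above (zero_submodule V).
  by exists [::] => // N NN _ y /eqP ->; apply: submod0.
exists n, W; split=> // [|i le]; first by rewrite W0.
by have [? ?] := WN i le; apply: (in_category_O_submod int_neq0 vl).
Qed.

End CompositionSeries.

(** * Multiplicities from dimensions *)

Section Triangular.
Variables (T : eqType) (k : T -> T -> nat).

(** The first equation determines the multiplicity of the first element; remove it
    and continue. *)
Lemma unitriangular_perm (L s t : seq T) : uniq L ->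
  pairwise (fun x y => k y x == 0%N) L -> all (fun x => k x x == 1%N) L ->
  {subset s <= L} -> {subset t <= L} ->
  {in L, forall y, \sum_(x <- s) k x y = \sum_(x <- t) k x y}%N -> perm_eq s t.
Proof.
have split_sum a (r : seq T) y : (\sum_(x <- r) k x y =
    count_mem a r * k a y + \sum_(x <- filter (predC1 a) r) k x y)%N.
  rewrite (bigID (pred1 a)) /= big_filter; congr (_ + _)%N.
  rewrite (eq_bigr (fun => k a y)) => [|x /eqP -> //].
  by rewrite big_const_seq iter_addn_0 mulnC.
elim: L s t => [|a L IH] s t.
  case: s t => [|x s] [|y t] // _ _ _; first by move=> _ /(_ y (mem_head _ _)).
    by move=> /(_ x (mem_head _ _)).
  by move=> /(_ x (mem_head _ _)).
move=> /andP[aL uL] /andP[aL0 pL] /andP[/eqP aa dL] sL tL e.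
have rest r : {subset r <= a :: L} -> {subset filter (predC1 a) r <= L}.
  by move=> rL x; rewrite mem_filter => /andP[/negbTE xa /rL]; rewrite inE xa.
have count_a r : {subset r <= a :: L} -> (\sum_(x <- r) k x a = count_mem a r)%N.
  move=> rL; rewrite (split_sum a) aa muln1 big_seq big1 ?addn0 // => x /(rest r rL) xL.
  exact/eqP/(allP aL0).
have ca : count_mem a s = count_mem a t.
  by rewrite -!count_a // e // mem_head.
have p : perm_eq (filter (predC1 a) s) (filter (predC1 a) t).
  apply: IH => // [||y yL]; [exact: rest|exact: rest|].
  have := e y; rewrite inE yL orbT => /(_ isT).
  by rewrite (split_sum a s) (split_sum a t) ca => /addnI.
apply/allP => x _; have /permP/(_ (pred1 x)) := p; rewrite !count_filter.
have [-> _|xa e2] := eqVneq x a; first by rewrite /= ca.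
apply/eqP; etransitivity; last (etransitivity; first exact: e2).
  by apply: eq_count => z /=; case: eqP => // ->; rewrite xa.
by apply: eq_count => z /=; case: eqP => // ->; rewrite xa.
Qed.

End Triangular.

Definition dim_table (l l' : int * int * int) : nat := odflt 0%N (simple_dim l l').

Lemma simple_dimE l l' : simple_dim l l' =
  form_rank 8 (size (low_indices (drop_between l l')))
    (form_matrix (drop_between l rho3) (drop_between l l')).
Proof. by []. Qed.

Lemma simple_dim_table l l' : l \in linked -> l' \in linked ->
  form_rank 8 (size (low_indices (drop_between l l')))
    (form_matrix (drop_between l rho3) (drop_between l l')) = Some (dim_table l l').
Proof.
have h : all (fun l => all (fun l' => simple_dim l l' == Some (dim_table l l')) linked) linked.
  by vm_compute.
move=> hl hl'; have /allP/(_ l' hl')/eqP := allP h l hl.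
exact: etrans (esym (simple_dimE l l')).
Qed.

Lemma dim_table_triangular : pairwise (fun l l' => dim_table l' l == 0%N) linked &&
  all (fun l => dim_table l l == 1%N) linked.
Proof. by vm_compute. Qed.

Lemma linked_uniq : uniq linked.
Proof. by []. Qed.

(** The dimensions of all linked weight spaces of the Verma module of [l] are those
    of the sum of the simple modules of [p]. *)
Definition factors_check (l : int * int * int) (p : seq (int * int * int)) : bool :=
  all (mem linked) p &&
  all (fun l' => size (low_indices (drop_between l l')) ==
    sumn [seq dim_table x l' | x <- p]) linked.

Definition five_factors : seq (seq (int * int * int)) :=
  [:: [:: (0, 0, 0); (-1, 1, 1); (-1, 1, -1); (-1, -1, 1); (-1, -1, -1); (-1, -1, -1)];
      [:: (1, -1, -1); (0, 0, 0); (-1, -1, -1); (-2, -2, -2)];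
      [:: (1, -1, 1); (1, -1, -1); (0, 0, 0); (-1, 1, 1); (-1, -1, 1); (-1, -1, -1);
          (-2, -2, 2); (-2, -2, -2)];
      [:: (1, 1, -1); (1, -1, -1); (0, 0, 0); (-1, 1, 1); (-1, 1, -1); (-1, -1, -1);
          (-2, 2, -2); (-2, -2, -2)];
      [:: (1, 1, 1); (1, 1, -1); (1, -1, 1); (1, -1, -1); (0, 0, 0); (-1, 1, 1); (-1, 1, 1);
          (-1, 1, -1); (-1, -1, 1); (-1, -1, -1);
          (-2, 2, 2); (-2, 2, -2); (-2, -2, 2); (-2, -2, -2)]].

Lemma five_factors_check i : (i < 5)%N ->
  factors_check (nth (0, 0, 0) five i) (nth [::] five_factors i).
Proof.
have h : all (fun i => factors_check (nth (0, 0, 0) five i) (nth [::] five_factors i)) (iota 0 5).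
  by vm_compute.
by move=> lt; apply: (allP h i); rewrite mem_iota.
Qed.

Section Multiplicities.
Variables (K : fieldType) (zeta : K).
Hypothesis zeta_free : forall a b : int, coef zeta (a, b) = 0 -> a = 0 /\ b = 0.
Let int_neq0 := int_neq0_of_free zeta_free.

Lemma wt3_rho l : wt3 l - rho = wt3 (drop_between l rho3).
Proof. by apply/rowP; apply: ord3P; rewrite !mxE. Qed.

Definition Verma_like (l : int * int * int) :
    verma_like (wt3 (drop_between l rho3)) (Verma zeta (wt3 l)) :=
  eq_rect _ (fun nu => verma_like nu (Verma zeta (wt3 l)))
    (verma_module_like zeta (wt3 l - rho)) _ (wt3_rho l).

Variable l : int * int * int.
Hypothesis l_five : l \in five.
Variable V : lieModule (D21 zeta).
Variable vl : verma_like (wt3 (drop_between l rho3)) V.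
Variables (n : nat) (W : nat -> {pred V}).
Hypothesis series : composition_series n W.

Lemma series_submodule i : (i <= n)%N -> is_submodule (W i).
Proof. by case: series => _ _ h _ /h[]. Qed.

(** Each step of the series contains a highest weight vector of linked weight. *)
Lemma series_factors : exists f : nat -> int * int * int, forall i, (i < n)%N ->
  f i \in linked /\ subquotient_iso (W i.+1) (W i) (Simple zeta (wt3 (f i))).
Proof.
suff h i : exists l', (i < n)%N ->
    l' \in linked /\ subquotient_iso (W i.+1) (W i) (Simple zeta (wt3 l')).
  by have [f fP] := boolp.choice h; exists f.
have [lt|] := boolP (i < n)%N; last by exists l.
have [_ _ _ /(_ i lt) simple] := series; have [_ nsub _] := simple.
have AN := series_submodule lt; have BN := series_submodule (ltnW lt).
have [l' [m [hl' Am Bm _ ms]]] := linked_singular zeta_free l_five vl AN BN nsub.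
exists l' => _; split=> //.
exact: (iso_of_singular int_neq0 (Verma_like l') AN BN simple Am Bm ms).
Qed.

Variable f : nat -> int * int * int.
Hypothesis f_linked : forall i, (i < n)%N -> f i \in linked.
Hypothesis f_iso : forall i, (i < n)%N ->
  subquotient_iso (W i.+1) (W i) (Simple zeta (wt3 (f i))).

Lemma series_multiplicity lam :
  composition_multiplicity n W lam = count_mem lam [seq wt3 (f i) | i <- index_iota 0 n].
Proof.
rewrite /composition_multiplicity -sum1dep_card count_map -sum1_count big_mkord.
apply: eq_bigl => i /=.
have AN := series_submodule (ltn_ord i); have BN := series_submodule (ltnW (ltn_ord i)).
apply/asboolP/eqP => [iso|<-]; last exact: f_iso.
have := iso_weight_unique (verma_module_like zeta (wt3 (f i) - rho))
  (verma_module_like zeta (lam - rho)) int_neq0 AN BN (f_iso (ltn_ord i)) iso.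
exact: addIr.
Qed.

(** Each factor contributes its own weight space. *)
Lemma series_dim_step i l' : (i < n)%N -> l' \in linked ->
  weight_dim vl (W i.+1) (drop_between l l') =
    (weight_dim vl (W i) (drop_between l l') + dim_table (f i) l')%N.
Proof.
move=> lt hl'; have [_ _ _ /(_ i lt)[BA _ _]] := series.
apply: (simple_weight_dim zeta_free vl (Verma_like (f i)) _
  (series_submodule lt) (series_submodule (ltnW lt)) BA (f_iso lt)
  (simple_dim_table (f_linked lt) hl')).
by rewrite !drop_between_wt3.
Qed.

Lemma series_dim l' : l' \in linked ->
  size (low_indices (drop_between l l')) = (\sum_(i <- index_iota 0 n) dim_table (f i) l')%N.
Proof.
move=> hl'; have [W0 Wn _ _] := series.
have dimE i : (i <= n)%N -> weight_dim vl (W i) (drop_between l l') =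
    (\sum_(j <- index_iota 0 i) dim_table (f j) l')%N.
  elim: i => [|i IH] lt; last by rewrite big_nat_recr // -(IH (ltnW lt)) series_dim_step.
  by rewrite big_geq // (weight_dim0 vl _ (series_submodule lt) W0).
exact: etrans (esym (weight_dim_full vl _ (series_submodule (leqnn n)) Wn)) (dimE n (leqnn n)).
Qed.

Lemma series_perm p : factors_check l p -> perm_eq [seq f i | i <- index_iota 0 n] p.
Proof.
case/andP => /allP pl /allP pd; have /andP[tri diag] := dim_table_triangular.
apply: (unitriangular_perm linked_uniq tri diag) => [x xs|x xp|l' hl'].
- case/(@mapP nat _ f): xs => i; rewrite mem_index_iota => /andP[_ lt] ->; exact: f_linked.
- exact: pl.
by rewrite big_map -(series_dim hl') (eqP (pd l' hl')) sumnE big_map.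
Qed.

End Multiplicities.

(** The weight spaces of the factors of a series add up to those of the Verma
    module, and the linked weight spaces suffice to recover the factors. *)
Lemma verma_composition_factors (K : fieldType) (zeta : K) l p :
  (forall a b : int, coef zeta (a, b) = 0 -> a = 0 /\ b = 0) ->
  l \in five -> factors_check l p -> composition_factors (Verma zeta (wt3 l)) (map wt3 p).
Proof.
move=> zeta_free l_five check; have vl := Verma_like zeta l.
split; first exact: (composition_series_exists zeta_free l_five vl).
move=> n W series lam.
have [f fP] := series_factors zeta_free l_five vl series.
rewrite (series_multiplicity zeta_free series (fun i lt => (fP i lt).2)).
have /(perm_map wt3)/permP <- := series_perm zeta_free vl series (fun i lt => (fP i lt).1)
  (fun i lt => (fP i lt).2) check.
by rewrite -map_comp.
Qed.

(** * The composition factors *)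

Lemma irrational_free (R : realType) (zeta : complex R) :
  (forall q : rat, zeta <> ratr q) -> forall a b : int, coef zeta (a, b) = 0 -> a = 0 /\ b = 0.
Proof.
move=> irr a b; rewrite /coef /= => e; have [b0|b0] := eqVneq b 0.
  by move: e; rewrite b0 mul0r addr0 => /eqP; rewrite intr_eq0 => /eqP.
case: (irr (- (a%:~R / b%:~R))); rewrite rmorphN fmorph_div !rmorph_int.
have b0' : b%:~R != 0 :> complex R by rewrite intr_eq0.
by apply: (mulfI b0'); rewrite mulrN mulrCA mulfV // mulr1; apply/eqP; rewrite -addr_eq0 addrC e.
Qed.

Theorem proposition3p13 (R : realType) (zeta : complex R)
    (zeta_irrational : forall q : rat, zeta <> ratr q) :
  [/\ composition_factors (Verma zeta (wt 0 0 0))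
        [:: wt 0 0 0; wt (-1) 1 1; wt (-1) 1 (-1); wt (-1) (-1) 1;
            wt (-1) (-1) (-1); wt (-1) (-1) (-1)],
      composition_factors (Verma zeta (wt 1 (-1) (-1)))
        [:: wt 1 (-1) (-1); wt 0 0 0; wt (-1) (-1) (-1); wt (-2) (-2) (-2)],
      composition_factors (Verma zeta (wt 1 (-1) 1))
        [:: wt 1 (-1) 1; wt 1 (-1) (-1); wt 0 0 0; wt (-1) 1 1;
            wt (-1) (-1) 1; wt (-1) (-1) (-1); wt (-2) (-2) 2;
            wt (-2) (-2) (-2)],
      composition_factors (Verma zeta (wt 1 1 (-1)))
        [:: wt 1 1 (-1); wt 1 (-1) (-1); wt 0 0 0; wt (-1) 1 1;
            wt (-1) 1 (-1); wt (-1) (-1) (-1); wt (-2) 2 (-2);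
            wt (-2) (-2) (-2)] &
      composition_factors (Verma zeta (wt 1 1 1))
        [:: wt 1 1 1; wt 1 1 (-1); wt 1 (-1) 1; wt 1 (-1) (-1); wt 0 0 0;
            wt (-1) 1 1; wt (-1) 1 1; wt (-1) 1 (-1); wt (-1) (-1) 1;
            wt (-1) (-1) (-1);
            wt (-2) 2 2; wt (-2) 2 (-2); wt (-2) (-2) 2; wt (-2) (-2) (-2)]].
Proof.
have free := irrational_free zeta_irrational.
have factors i : (i < 5)%N ->
    composition_factors (Verma zeta (wt3 (nth (0, 0, 0) five i)))
      (map wt3 (nth [::] five_factors i)).
  move=> lt; apply: (verma_composition_factors free); first exact: mem_nth.
  exact: five_factors_check.
split.
- exact: (factors 0%N isT).
- exact: (factors 1%N isT).
- exact: (factors 2%N isT).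
- exact: (factors 3%N isT).
exact: (factors 4%N isT).
Qed.
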